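(* Let $\mathcal{G}$ be a generalized Sasaki metric on $\mathcal{T}M$, with horizontal bundle $\mathcal{H}$ and associated horizontal tensors $\sigma,\psi,\beta$, such that the metric $\sigma$ is projectable to $M$ and $\beta$ is non degenerate. Let $\mathcal{D}^{\mathcal{C}}$ be its double metric Cartan connection. Then $\mathcal{G}$ (with the connection $\mathcal{D}^{\mathcal{C}}$) is Einstein-Cartan if and only if $Ric_{\mathcal{D}^{\mathcal{C}}}=0$, and this condition is equivalent to the fact that the projection of $\sigma$ to $M$ is a Ricci flat metric.
   Context: All objects are $C^\infty$ (along the zero section continuity may suffice). $M$ is an $m$-dimensional manifold, $\mathcal{T}M$ is the total space of $\pi:TM\to M$; $\mathcal{V}=\ker\pi_*$. The tangent structure is $S\mathcal{X}=(\pi_*\mathcal{X})^v$ (vertical lift). A horizontal bundle is a subbundle $\mathcal{H}$ with $T\mathcal{T}M=\mathcal{H}\oplus\mathcal{V}$. $S'$ equals $(S|_{\mathcal{H}})^{-1}$ on $\mathcal{V}$ and $0$ on $\mathcal{H}$. Horizontal tensors (on $\mathcal{H}$) are extended by zero on vertical arguments. A horizontal metric $\sigma$ is projectable to $M$ if it is the horizontal lift of a (pseudo-)Riemannian metric $s$ of $M$, i.e. $\sigma(X^h,Y^h)=s(X,Y)$; $s$ is called the projection of $\sigma$. For a bilinear form $a$, $\flat_aX=a(X,\cdot)$, and $\sharp_a=\flat_a^{-1}$ if $a$ is non degenerate. Generalized Sasaki metric. Given $\mathcal{H}$, a non degenerate symmetric horizontal tensor $\sigma$ and a horizontal $2$-form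 $\psi$, define $Q\in End(\mathcal{H})$ by $\flat_\psi=-\flat_\sigma\circ Q$ and $\beta$ by $\flat_\beta=\flat_\sigma\circ(Id-Q^2)$. The corresponding generalized Sasaki metric is the (pseudo-)Riemannian metric $\mathcal{G}$ of $\mathcal{T}M$ with $2\mathcal{G}(\mathcal{X},\mathcal{X}')=\beta(\mathcal{X},\mathcal{X}')$, $2\mathcal{G}(\mathcal{X},\mathcal{Y})=-\psi(\mathcal{X},S'\mathcal{Y})$, $2\mathcal{G}(\mathcal{Y},\mathcal{Y}')=\sigma(S'\mathcal{Y},S'\mathcal{Y}')$ for $\mathcal{X},\mathcal{X}'\in\mathcal{H}$, $\mathcal{Y},\mathcal{Y}'\in\mathcal{V}$. The subordinated tangent metric $\gamma$ is defined by $\mathcal{H}\perp_\gamma\mathcal{V}$, $\gamma|_{\mathcal{H}}=\sigma$, $\gamma(S\mathcal{X},S\mathcal{X}')=\sigma(\mathcal{X},\mathcal{X}')$. Connections. Let $D$ be the Levi-Civita connection of $\gamma$. The canonical connection $\nabla^D$ of $\gamma$ is the linear connection on $\mathcal{T}M$ with $$\nabla^D_{\mathcal{X}}\mathcal{Y}=pr_{\mathcal{V}}[\mathcal{X},\mathcal{Y}],\ \nabla^D_{\mathcal{Y}}\mathcal{X}=pr_{\mathcal{H}}[\mathcal{Y},\mathcal{X}],\ \nabla^D_{\mathcal{X}}\mathcal{X}'=pr_{\mathcal{H}}D_{\mathcal{X}}\mathcal{X}',\ \nabla^D_{\mathcal{Y}}\mathcal{Y}'=pr_{\mathcal{V}}D_{\mathcal{Y}}\mathcal{Y}'$$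 for $\mathcal{X},\mathcal{X}'\in\Gamma\mathcal{H}$, $\mathcal{Y},\mathcal{Y}'\in\Gamma\mathcal{V}$. The Cartan tensor is $C(\mathcal{X},\mathcal{X}',\mathcal{X}'')=(\nabla^D_{S\mathcal{X}}\sigma)(\mathcal{X}',\mathcal{X}'')$ on horizontal arguments (zero if an argument is vertical), $\Psi$ is defined by $\gamma(\Psi(\mathcal{Z},\mathcal{Z}'),\mathcal{Z}'')=\frac12C(S'\mathcal{Z},\mathcal{Z}',\mathcal{Z}'')$, and the Cartan connection is $\nabla^{\mathcal{C}}_{\mathcal{Z}}\mathcal{Z}'=\nabla^D_{\mathcal{Z}}\mathcal{Z}'+\Psi(\mathcal{Z},\mathcal{Z}')$. The double metric Cartan connection $\mathcal{D}^{\mathcal{C}}$ of $\mathcal{G}$ is the linear ($\mathcal{G}$-metric, in general with torsion) connection on $\mathcal{T}M$ given, for $\mathcal{Z}\in T\mathcal{T}M$ and $\mathcal{X}\in\Gamma\mathcal{H}$, by $$\mathcal{D}^{\mathcal{C}}_{\mathcal{Z}}(S\mathcal{X})=S\nabla^{\mathcal{C}}_{\mathcal{Z}}\mathcal{X},\qquad \mathcal{D}^{\mathcal{C}}_{\mathcal{Z}}\mathcal{X}=\nabla^{\mathcal{C}}_{\mathcal{Z}}\mathcal{X}+S\big((\nabla^{\mathcal{C}}_{\mathcal{Z}}Q)\mathcal{X}\big).$$ Ricci curvature of a linear connection $\nabla$: $Ric_\nabla(\mathcal{Z}',\mathcal{Z})$ is the trace of $\mathcal{U}\mapsto R_\nabla(\mathcal{U},\mathcal{Z})\mathcal{Z}'$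 (not necessarily symmetric). A manifold $N$ with a (pseudo-)Riemannian metric $\mathcal{G}$ and a $\mathcal{G}$-metric connection $\nabla$ with torsion is Einstein-Cartan if there is a real constant $\lambda$ such that $$Ric_\nabla(\mathcal{Z},\mathcal{Z}')+Ric_\nabla(\mathcal{Z}',\mathcal{Z})=2\lambda\,\mathcal{G}(\mathcal{Z},\mathcal{Z}')\qquad(\mathcal{Z},\mathcal{Z}'\in TN).$$ *)

(* Defs.v *)
From HB Require Import structures.
From mathcomp Require Import all_boot all_order all_algebra.
From mathcomp Require Import all_classical all_reals all_analysis.

Set Implicit Arguments.
Unset Strict Implicit.
Unset Printing Implicit Defensive.
Import Order.TTheory GRing.Theory Num.Theory numFieldNormedType.Exports.
Local Open Scope classical_set_scope.
Local Open Scope ring_scope.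

(** * Smooth functions on Euclidean space *)

Fixpoint Ck (R : realType) (n k : nat) (U : set 'rV[R]_n) (g : 'rV[R]_n -> R)
    : Prop :=
  match k with
  | 0 => forall x, U x -> {for x, continuous g}
  | k'.+1 => (forall x, U x -> differentiable g x) /\
             forall a : 'rV[R]_n, Ck k' U (fun x => 'd g x a)
  end.

Definition smooth_pt (R : realType) (n : nat) (g : 'rV[R]_n -> R)
    (x : 'rV[R]_n) : Prop :=
  exists U : set 'rV[R]_n, [/\ open U, U x & forall k, Ck k U g].

(** * Manifolds

    A manifold is a set with an atlas of charts with values in [R^n]; its
    topology is the one for which the charts are homeomorphisms onto open sets.
    The axioms are kept apart, in [is_manifold], so that the total space of the
    tangent bundle can be introduced by its charts alone. *)

Record chart (R : realType) (n : nat) (T : Type) := Chart {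
  dom : set T;
  coord : T -> 'rV[R]_n }.

Record chartedSpace (R : realType) (n : nat) := ChartedSpace {
  pt :> Type;
  atlas : set (chart R n pt) }.

Section Charted.
Variables (R : realType) (n : nat) (N : chartedSpace R n).
Implicit Types (c : chart R n N) (p q : N) (f : N -> R) (P : set N).

(** [P] holds near [p], as seen in the chart [c]; in particular the image of the
    chart has to be a neighbourhood of [coord c p]. *)
Definition near_in c p P : Prop :=
  dom c p /\
  \forall x \near coord c p, exists q, [/\ dom c q, coord c q = x & P q].

Definition near_pt p P : Prop := exists2 c, atlas c & near_in c p P.

Definition is_manifold : Prop :=
  [/\ (forall p, exists2 c, atlas c & dom c p),
      (forall c, atlas c ->
         {in dom c &, injective (coord c)} /\
         forall p, dom c p -> near_in c p setT),
      (forall c c' p, atlas c -> atlas c' -> dom c p -> dom c' p ->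
         forall i : 'I_n, exists2 g, smooth_pt g (coord c p) &
           near_in c p
             (fun q => dom c' q /\ coord c' q ord0 i = g (coord c q))),
      (forall p q, p <> q ->
         exists P P', [/\ near_pt p P, near_pt q P' & P `&` P' = set0])
    & (exists A : set (chart R n N),
         [/\ A `<=` atlas (c:=N), countable A
           & forall p, exists2 c, A c & dom c p])].

(** [f] need not be defined globally in a meaningful way: it is only required to
    be smooth on some neighbourhood of [p]. *)
Definition smooth_at p f : Prop :=
  exists2 c, atlas c &
  exists2 g, smooth_pt g (coord c p) & near_in c p (fun q => f q = g (coord c q)).

(** * Tangent vectors

    Tangent vectors at [p] are the operators [f |-> d(f o coord^-1)(a)] on the
    functions that are smooth near [p]. To make them plain elements of a vector
    space of functionals, they take the value [0] on all other functions. *)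

Definition functional : Type := (N -> R) -> R.

HB.instance Definition _ := GRing.Lmodule.on functional.

Implicit Types (u v w : functional) (X Y Z : N -> functional).

Definition is_tangent p v : Prop :=
  (forall f, ~ smooth_at p f -> v f = 0) /\
  exists c, [/\ atlas c, dom c p &
    exists a : 'rV[R]_n, forall f g, smooth_pt g (coord c p) ->
      near_in c p (fun q => f q = g (coord c q)) -> v f = 'd g (coord c p) a].

(** Vector fields are only required to be smooth near a given point, like the
    functions they act on. *)
Definition smooth_field p X : Prop :=
  near_pt p (fun q => is_tangent q (X q)) /\
  forall f, smooth_at p f -> smooth_at p (fun q => X q f).

Definition lie X Y : N -> functional := fun p f =>
  if `[< smooth_at p f >] then X p (fun q => Y q f) - Y p (fun q => X q f)
  else 0.

(** Some vector field extending a tangent vector. *)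
Definition extension p u : N -> functional :=
  xget (fun=> 0) [set X | smooth_field p X /\ X p = u].

(** * Linear algebra in the tangent spaces *)

Definition is_basis (V : set functional) (k : nat) (e : 'I_k -> functional)
    : Prop :=
  (forall a : 'rV[R]_k, V (\sum_i a ord0 i *: e i)) /\
  (forall v, V v -> exists! a : 'rV[R]_k, v = \sum_i a ord0 i *: e i).

Definition trace (V : set functional) (L : functional -> functional) : R :=
  xget 0 [set t | exists k (e : 'I_k -> functional) (A : 'M[R]_k),
    [/\ is_basis V e, (forall j, L (e j) = \sum_i A i j *: e i) & t = \tr A]].

Definition smooth_subbundle (k : nat) (H : N -> set functional) : Prop :=
  (forall p v, H p v -> is_tangent p v) /\
  forall p, exists E : 'I_k -> N -> functional,
    (forall i, smooth_field p (E i)) /\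
    near_pt p (fun q => is_basis (H q) (fun i => E i q)).

Definition section_of (H : N -> set functional) p X : Prop :=
  smooth_field p X /\ near_pt p (fun q => H q (X q)).

(** * Covariant 2-tensors and metrics *)

Definition tensor2 : Type := N -> functional -> functional -> R.
Implicit Types (a g : tensor2).

Definition is_tensor2 a : Prop :=
  [/\ (forall p (r : R) u v w, is_tangent p u -> is_tangent p v ->
         is_tangent p w -> a p (r *: u + v) w = r * a p u w + a p v w),
      (forall p (r : R) u v w, is_tangent p u -> is_tangent p v ->
         is_tangent p w -> a p w (r *: u + v) = r * a p w u + a p w v)
    & (forall p X Y, smooth_field p X -> smooth_field p Y ->
         smooth_at p (fun q => a q (X q) (Y q)))].

Definition symmetric2 a : Prop :=
  forall p u v, is_tangent p u -> is_tangent p v -> a p u v = a p v u.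

Definition skew2 a : Prop :=
  forall p u v, is_tangent p u -> is_tangent p v -> a p u v = - a p v u.

Definition nondegenerate_on (H : N -> set functional) a : Prop :=
  forall p u, H p u -> (forall v, H p v -> a p u v = 0) -> u = 0.

(** Pseudo-Riemannian metrics. *)
Definition is_metric g : Prop :=
  [/\ is_tensor2 g, symmetric2 g & nondegenerate_on is_tangent g].

(** * Linear connections

    [nab p u X] is the covariant derivative at [p] of the field [X], smooth near
    [p], in the direction of the tangent vector [u]. *)

Definition connection : Type :=
  forall p : N, functional -> (N -> functional) -> functional.
Implicit Types (nab D : connection).

Definition is_connection nab : Prop :=
  [/\ (forall p u X, is_tangent p u -> smooth_field p X ->
         is_tangent p (nab p u X)) /\
      (forall p X Y, smooth_field p X -> smooth_field p Y ->
         smooth_field p (fun q => nab q (X q) Y)),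
      (forall p u X Y, is_tangent p u -> smooth_field p X -> smooth_field p Y ->
         near_pt p (fun q => X q = Y q) -> nab p u X = nab p u Y),
      (forall p (r : R) u v X, is_tangent p u -> is_tangent p v ->
         smooth_field p X -> nab p (r *: u + v) X = r *: nab p u X + nab p v X),
      (forall p u X Y, is_tangent p u -> smooth_field p X -> smooth_field p Y ->
         nab p u (fun q => X q + Y q) = nab p u X + nab p u Y)
    & (forall p u f X, is_tangent p u -> smooth_at p f -> smooth_field p X ->
         nab p u (fun q => f q *: X q) = u f *: X p + f p *: nab p u X)].

Definition is_levi_civita g D : Prop :=
  [/\ is_connection D,
      (forall p X Y, smooth_field p X -> smooth_field p Y ->
         D p (X p) Y - D p (Y p) X = lie X Y p)
    & (forall p u X Y, is_tangent p u -> smooth_field p X -> smooth_field p Y ->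
         u (fun q => g q (X q) (Y q)) =
         g p (D p u X) (Y p) + g p (X p) (D p u Y))].

Definition curvature nab X Y Z : N -> functional := fun p =>
  nab p (X p) (fun q => nab q (Y q) Z) - nab p (Y p) (fun q => nab q (X q) Z)
  - nab p (lie X Y p) Z.

(** [curvature nab] is a tensor: its value on tangent vectors is computed on
    arbitrary extensions. *)
Definition curv nab p u v w : functional :=
  curvature nab (extension p u) (extension p v) (extension p w) p.

(** The order of the arguments matters: this is the trace of
    [u |-> R(u, w) w']. *)
Definition Ric nab : tensor2 := fun p w' w =>
  trace (is_tangent p) (fun u => curv nab p u w w').

Definition ricci_flat nab : Prop :=
  forall p u v, is_tangent p u -> is_tangent p v -> Ric nab p u v = 0.

Definition einstein_cartan g nab : Prop :=
  exists lambda : R, forall p u v, is_tangent p u -> is_tangent p v ->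
    Ric nab p u v + Ric nab p v u = 2 * lambda * g p u v.

End Charted.

(** * The total space of the tangent bundle *)

Section TangentBundle.
Variables (R : realType) (m : nat) (M : chartedSpace R m).

Record tangentVector := TangentVector {
  foot : M;
  vec : functional M;
  vecP : is_tangent foot vec }.

Definition tangent_chart (c : chart R m M) : chart R (m + m) tangentVector :=
  @Chart R (m + m) tangentVector
    [set z | dom c (foot z)]
    (fun z => row_mx (coord c (foot z))
                (\row_i vec z (fun q => coord c q ord0 i))).

Definition TM : chartedSpace R (m + m) :=
  @ChartedSpace R (m + m) tangentVector (@tangent_chart @` @atlas R m M).

Implicit Types (z : TM) (u v w : functional TM).

Definition proj_push z w : functional M := fun f =>
  if `[< smooth_at (foot z) f >] then w (f \o foot) else 0.

Definition vertical z : set (functional TM) :=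
  [set w | is_tangent z w /\ proj_push z w = 0].

(** The point [z + t u] of the fibre of [z] (the second branch is not used when
    [u] is tangent to [M] at the foot of [z]). *)
Definition fibre_line z (u : functional M) (t : R) : TM :=
  if pselect (is_tangent (foot z) (vec z + t *: u)) is left h
  then TangentVector h else z.

(** The vertical lift of [u] is the velocity of the line [t |-> z + t u]. *)
Definition vertical_lift z (u : functional M) : functional TM := fun F =>
  if `[< smooth_at z F >] then derive1 (fun t : R => F (fibre_line z u t)) 0
  else 0.

Definition tstruct z w : functional TM := vertical_lift z (proj_push z w).

(** * Horizontal bundles *)

Definition horizontal_bundle (H : TM -> set (functional TM)) : Prop :=
  smooth_subbundle m H /\
  forall z w, is_tangent z w -> exists! u, H z u /\ vertical z (w - u).

Section Horizontal.
Variable H : TM -> set (functional TM).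

Definition prH z w : functional TM :=
  xget 0 [set u | H z u /\ vertical z (w - u)].
Definition prV z w : functional TM := w - prH z w.

Definition tstruct' z w : functional TM :=
  xget 0 [set u | H z u /\ tstruct z u = prV z w].

Definition horizontal_lift z (u : functional M) : functional TM :=
  xget 0 [set w | H z w /\ proj_push z w = u].

Definition horizontal_tensor (a : tensor2 TM) : Prop :=
  is_tensor2 a /\
  forall z v w, vertical z v -> is_tangent z w -> a z v w = 0 /\ a z w v = 0.

(** [sigma] is the horizontal lift of [s]. *)
Definition is_projection (sigma : tensor2 TM) (s : tensor2 M) : Prop :=
  is_metric s /\
  forall z (u v : functional M), is_tangent (foot z) u -> is_tangent (foot z) v ->
    sigma z (horizontal_lift z u) (horizontal_lift z v) = s (foot z) u v.

(** * Generalized Sasaki metrics *)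

Variables sigma psi : tensor2 TM.

Definition Qend z u : functional TM :=
  xget 0 [set q | H z q /\ forall v, H z v -> psi z u v = - sigma z q v].

Definition beta : tensor2 TM := fun z u v => sigma z (u - Qend z (Qend z u)) v.

(** Horizontal tensors vanish on vertical arguments and [tstruct'] vanishes on
    horizontal ones, so that each of the terms below only contributes to the
    block of the metric in which it is expected. *)
Definition sasaki_metric : tensor2 TM := fun z w w' =>
  2^-1 * (beta z w w' - psi z w (tstruct' z w') - psi z w' (tstruct' z w)
          + sigma z (tstruct' z w) (tstruct' z w')).

Definition tangent_metric : tensor2 TM := fun z w w' =>
  sigma z w w' + sigma z (tstruct' z w) (tstruct' z w').

(** * The canonical connection and the Cartan connections *)

Definition is_canonical_connection (D nab : connection TM) : Prop :=
  is_connection nab /\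
  forall z X X' Y Y', section_of H z X -> section_of H z X' ->
    section_of vertical z Y -> section_of vertical z Y' ->
    [/\ nab z (X z) Y = prV z (lie X Y z),
        nab z (Y z) X = prH z (lie Y X z),
        nab z (X z) X' = prH z (D z (X z) X')
      & nab z (Y z) Y' = prV z (D z (Y z) Y')].

(** Some horizontal field extending a horizontal vector. *)
Definition horizontal_extension z u : TM -> functional TM :=
  xget (fun=> 0) [set X | section_of H z X /\ X z = u].

Section Cartan.
Variable nabD : connection TM.

Definition cov_sigma z w (X X' : TM -> functional TM) : R :=
  w (fun y => sigma y (X y) (X' y))
  - sigma z (nabD z w X) (X' z) - sigma z (X z) (nabD z w X').

Definition cartan_tensor z u u' u'' : R :=
  cov_sigma z (tstruct z u) (horizontal_extension z (prH z u'))
                      (horizontal_extension z (prH z u'')).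

Definition Psi z w w' : functional TM :=
  xget 0 [set v | is_tangent z v /\
    forall w'', is_tangent z w'' ->
      tangent_metric z v w'' = 2^-1 * cartan_tensor z (tstruct' z w) w' w''].

Definition cartan_connection : connection TM := fun z w Z =>
  nabD z w Z + Psi z w (Z z).

Definition cov_Q z w (X : TM -> functional TM) : functional TM :=
  cartan_connection z w (fun y => Qend y (X y)) - Qend z (cartan_connection z w X).

Definition is_double_cartan_connection (DC : connection TM) : Prop :=
  is_connection DC /\
  forall z w X, is_tangent z w -> section_of H z X ->
    DC z w (fun y => tstruct y (X y)) = tstruct z (cartan_connection z w X) /\
    DC z w X = cartan_connection z w X + tstruct z (cov_Q z w X).

End Cartan.
End Horizontal.
End TangentBundle.

(* Main.v *)
(** In a chart of [M] write [e_a] for the horizontal lift of the coordinate field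
    [d/dx^a] and [V_a] for its vertical lift. Since [sigma] is the lift of [s],
    the Koszul identities for the subordinated tangent metric and for [s] agree
    on the [e_a], whose brackets are vertical; so the canonical connection acts
    on them through the Christoffel symbols of [s], composed with the projection.
    As [sigma(e_a, e_b)] is constant along the fibres, the Cartan tensor vanishes
    and the Cartan connection is the canonical one. The fields
    [E_a = e_a - S Q e_a] and [V_a] then form a frame of the tangent bundle of
    [TM] in which the double Cartan connection is the sum of two copies of the
    pull-back of the Levi-Civita connection of [s]: the correction [S (nabla Q)]
    is exactly absorbed by [E_a]. Its curvature vanishes on vertical vectors and
    takes values in the two copies, whence
    [Ric(w', w) = Ric_s (pi_* w') (pi_* w)].
    On vertical vectors the Ricci tensor is zero while the metric is
    [sigma / 2], which forces [lambda = 0]; the symmetry of [Ric_s] does the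
    rest. *)

From Pilot Require Import Defs.
From HB Require Import structures.
From mathcomp Require Import all_boot all_order all_algebra.
From mathcomp Require Import all_classical all_reals all_analysis.
From mathcomp Require Import ring lra.
Import Pilot.Defs.

Set Implicit Arguments.
Unset Strict Implicit.
Unset Printing Implicit Defensive.
Import Order.TTheory GRing.Theory Num.Theory numFieldNormedType.Exports.
Local Open Scope classical_set_scope.
Local Open Scope ring_scope.

(** * Smooth functions on Euclidean space *)

(** The field [E_a] is the component of [e_a] orthogonal to the vertical bundle: for [f] horizontal,
    [2 G(e_a, S f) = sigma(Q e_a, f) = 2 G(S Q e_a, S f)]. In the frame [E_a], [V_a] the metric is
    half of two copies of [s]. The trace nevertheless yields [Ric_s] once and not twice: the
    connection form only involves differentials of base coordinates, so the curvature vanishes as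
    soon as it is contracted with some [V_a]. The main obstacle is that lifts, projections, [Q] and
    extensions are all specified by choice. Their existence, uniqueness and smoothness are settled
    in charts: a horizontal vector is determined by its values on the base coordinates, a vertical
    one by its values on the fibre coordinates. Curvature is also defined through chosen extensions;
    it is computed once, for a local frame whose connection form is a combination of the
    differentials of given functions, and the formula is applied both on [M] and on [TM M]. The
    symmetry of [Ric_s] comes from the Bianchi identity and from the vanishing trace of the
    curvature operators, itself due to the symmetry of the second derivatives of the Gram matrix. *)

Section NearDiff.
Variables (R : realType) (V W : normedModType R).
Implicit Types (f g : V -> W) (x : V).

(** The first-order expansion only concerns the germ at [x], so [g] inherits that of [f]; uniqueness
    of the differential then identifies the two differentials. *)
Lemma near_diff_locally f g x : (\forall y \near x, f y = g y) ->
  differentiable f x -> g \o shift x = cst (g x) + 'd f x +o_ 0 id.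
Proof.
move=> fg df; apply/eqaddoP => e e0.
have /eqaddoP/(_ e e0) := diff_locally df; apply: filter_app.
have := fg; rewrite (near_shift 0 x); apply: filter_app; near=> y => /=.
by rewrite subr0 !fctE /= => <-; rewrite (nbhs_singleton fg).
Unshelve. all: by end_near. Qed.

Lemma near_diff f g x : (\forall y \near x, f y = g y) ->
  differentiable f x -> 'd g x = 'd f x :> (V -> W).
Proof.
by move=> fg df; apply: diff_unique; [exact: diff_continuous|exact: near_diff_locally].
Qed.

Lemma near_differentiable f g x : (\forall y \near x, f y = g y) ->
  differentiable f x -> differentiable g x.
Proof.
move=> fg df; apply/diff_locallyP; rewrite (near_diff fg df); split.
  exact: diff_continuous.
exact: near_diff_locally.
Qed.

End NearDiff.

Lemma row_sum_delta (R : realType) n (a : 'rV[R]_n) :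
  a = \sum_i a ord0 i *: delta_mx ord0 i.
Proof.
rewrite [LHS]matrix_sum_delta big_ord1; apply: eq_bigr => i _.
by [].
Qed.

Lemma linear_row_sum (R : realType) n (V : lmodType R)
    (f : {linear 'rV[R]_n -> V}) a :
  f a = \sum_i a ord0 i *: f (delta_mx ord0 i).
Proof.
by rewrite {1}[a]row_sum_delta linear_sum; apply: eq_bigr => i _; rewrite linearZ.
Qed.


(** * Calculus of directional derivatives *)

Section DiffAt.
Variables (R : realType) (n : nat).
Implicit Types (f g : 'rV[R]_n -> R) (x a : 'rV[R]_n).

(** Made opaque below: unification between terms ['d f x a] does not terminate
    in reasonable time. *)
Definition dd f x a : R := 'd f x a.

Lemma ddE f x a : differentiable f x -> dd f x a = 'D_a f x.
Proof. by move=> df; exact: esym (deriveE a df). Qed.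

Lemma near_dd f g x a : (\forall y \near x, f y = g y) ->
  differentiable f x -> dd g x a = dd f x a.
Proof. by move=> fg df; exact: (congr1 (fun h => h a) (near_diff fg df)). Qed.

Lemma dd_cst (r : R) x a : dd (fun=> r) x a = 0.
Proof.
rewrite ddE; last exact: differentiable_cst.
exact: (@derive_cst _ _ _ r x a).
Qed.

Lemma ddD f g x a : differentiable f x -> differentiable g x ->
  dd (fun y => f y + g y) x a = dd f x a + dd g x a.
Proof.
move=> df dg; rewrite !ddE//; last exact: (differentiableD df dg).
exact: (deriveD (diff_derivable df) (diff_derivable dg)).
Qed.

Lemma ddM f g x a : differentiable f x -> differentiable g x ->
  dd (fun y => f y * g y) x a = f x * dd g x a + g x * dd f x a.
Proof.
move=> df dg; rewrite !ddE//; last exact: (differentiableM df dg).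
exact: (deriveM (diff_derivable df) (diff_derivable dg)).
Qed.

Lemma ddV f x a : f x != 0 -> differentiable f x ->
  dd (fun y => (f y)^-1) x a = - (f x) ^- 2 * dd f x a.
Proof.
move=> fx0 df; rewrite !ddE//; last exact: (differentiableV df fx0).
exact: (deriveV fx0 (diff_derivable df)).
Qed.

Lemma dd_lin (f : {linear 'rV[R]_n -> R}) x a : continuous f -> dd f x a = f a.
Proof. by move=> cf; exact: (congr1 (fun h => h a) (diff_lin x cf)). Qed.

Lemma dd_comp k (F : 'rV[R]_n -> 'rV[R]_k) (g : 'rV[R]_k -> R) x a :
  differentiable F x -> differentiable g (F x) ->
  dd (fun y => g (F y)) x a = 'd g (F x) ('d F x a).
Proof.
move=> dF dg; exact: (congr1 (fun h => h a) (diff_comp dF dg)).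
Qed.

Lemma dd_row_sum f x a : dd f x a = \sum_i a ord0 i * dd f x (delta_mx ord0 i).
Proof. exact: linear_row_sum. Qed.

Lemma ddDr f x a b : dd f x (a + b) = dd f x a + dd f x b.
Proof. exact: linearD. Qed.

Lemma ddZr f x r a : dd f x (r *: a) = r * dd f x a.
Proof. exact: linearZ. Qed.

End DiffAt.

(** * Closure properties of C^k functions on open sets *)

Section Ck.
Variables (R : realType) (n : nat).
Implicit Types (U V : set 'rV[R]_n) (f g : 'rV[R]_n -> R) (x a b : 'rV[R]_n).

Lemma CkSP k U g : Ck k.+1 U g <->
  (forall x, U x -> differentiable g x) /\ forall a, Ck k U (fun x => dd g x a).
Proof. by []. Qed.

Lemma Ck_sub k U V f : U `<=` V -> Ck k V f -> Ck k U f.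
Proof.
move=> UV; elim: k f => [|k IH] f; first by move=> h x /UV; exact: h.
by move=> /CkSP[h1 h2]; apply/CkSP; split=> [x Ux|a]; [exact: h1 _ (UV _ Ux)|exact: IH (h2 a)].
Qed.

Lemma eq_Ck k U f g : open U -> {in U, f =1 g} -> Ck k U f -> Ck k U g.
Proof.
move=> oU; elim: k f g => [|k IH] f g fg.
  move=> h x Ux.
  have H : \forall y \near x, f y = g y.
    by near=> y; apply: fg; rewrite inE; near: y; exact: open_nbhs_nbhs.
  apply: (cvg_trans (near_eq_cvg H)); rewrite -(nbhs_singleton H).
  exact: h.
have H x : U x -> \forall y \near x, f y = g y.
  by move=> Ux; near=> y; apply: fg; rewrite inE; near: y; exact: open_nbhs_nbhs.
move=> /CkSP[h1 h2]; apply/CkSP; split=> [x Ux|a].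
  exact: (near_differentiable (H x Ux)) (h1 x Ux).
apply: IH (h2 a) => x; rewrite inE => Ux.
by rewrite (near_dd a (H x Ux) (h1 x Ux)).
Unshelve. all: by end_near. Qed.

(** [Ck k.+1] does not mention the lower orders: the loss of one order goes down the recursion until
    differentiability yields continuity. Product and chain rules need it for the factor that is not
    differentiated. *)
Lemma CkS k U f : Ck k.+1 U f -> Ck k U f.
Proof.
elim: k f => [|k IH] f /CkSP [h1 h2].
  by move=> x Ux; exact/differentiable_continuous/h1.
by apply/CkSP; split=> // a; exact: (IH _ (h2 a)).
Qed.

Lemma Ck_cst k U (r : R) : Ck k U (fun=> r).
Proof.
elim: k r => [|k IH] r; first by move=> x _; exact: cst_continuous.
apply/CkSP; split=> [x _|a]; first exact: differentiable_cst.
rewrite (_ : (fun x => _) = fun=> 0); first exact: IH.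
by apply/funext => x; rewrite dd_cst.
Qed.

Lemma Ck_linear k U (f : {linear 'rV[R]_n -> R}) : continuous f -> Ck k U f.
Proof.
case: k => [|k] cf; first by move=> x _; exact: cf.
apply/CkSP; split=> [x _|a]; first exact: linear_differentiable.
rewrite (_ : (fun x => _) = fun=> f a); first exact: Ck_cst.
by apply/funext => x; rewrite (dd_lin x a cf).
Qed.

Lemma CkD k U f g : open U -> Ck k U f -> Ck k U g ->
  Ck k U (fun x => f x + g x).
Proof.
move=> oU; elim: k f g => [|k IH] f g.
  by move=> h1 h2 x Ux; apply: continuousD; [exact: h1|exact: h2].
move=> /CkSP[f1 f2] /CkSP[g1 g2]; apply/CkSP; split=> [x Ux|a].
  exact: differentiableD (f1 _ Ux) (g1 _ Ux).
apply: eq_Ck (IH _ _ (f2 a) (g2 a)) => // x /[!inE] Ux.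
by rewrite (ddD a (f1 _ Ux) (g1 _ Ux)).
Qed.

Lemma CkM k U f g : open U -> Ck k U f -> Ck k U g ->
  Ck k U (fun x => f x * g x).
Proof.
move=> oU; elim: k f g => [|k IH] f g.
  by move=> h1 h2 x Ux; apply: continuousM; [exact: h1|exact: h2].
move=> fk gk; have /CkSP[f1 f2] := fk; have /CkSP[g1 g2] := gk.
apply/CkSP; split=> [x Ux|a].
  exact: differentiableM (f1 _ Ux) (g1 _ Ux).
apply: eq_Ck (CkD oU (IH _ _ (CkS fk) (g2 a)) (IH _ _ (CkS gk) (f2 a))) => //.
by move=> x /[!inE] Ux; rewrite (ddM a (f1 _ Ux) (g1 _ Ux)).
Qed.

Lemma Ck_sum k U I (r : seq I) (P : pred I) (f : I -> 'rV[R]_n -> R) : open U ->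
  (forall i, P i -> Ck k U (f i)) -> Ck k U (fun x => \sum_(i <- r | P i) f i x).
Proof.
move=> oU H; elim: r => [|i r IH].
  by apply: eq_Ck (Ck_cst k U 0) => // x _; rewrite big_nil.
apply: (@eq_Ck _ _ (fun x => (if P i then f i x else 0) +
    \sum_(j <- r | P j) f j x)) => // [x _|].
  by rewrite big_cons; case: (P i); rewrite ?add0r.
by apply: CkD => //; case: (boolP (P i)) => Pi; [exact: H|exact: Ck_cst].
Qed.

Lemma CkV k U f : open U -> (forall x, U x -> f x != 0) -> Ck k U f ->
  Ck k U (fun x => (f x)^-1).
Proof.
move=> oU f0; elim: k f f0 => [|k IH] f f0.
  by move=> h1 x Ux; apply: continuousV; [exact: f0|exact: h1].
move=> fk; have /CkSP[f1 f2] := fk; apply/CkSP; split=> [x Ux|a].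
  exact: differentiableV (f1 _ Ux) (f0 _ Ux).
(* The derivative [- (1/f)^2 df] contains [1/f] itself, at the order covered by the induction
   hypothesis. *)
have H := IH _ f0 (CkS fk).
apply: eq_Ck (CkM oU (CkM oU (Ck_cst k U (-1)) (CkM oU H H)) (f2 a)) => //.
move=> x /[!inE] Ux; rewrite (ddV a (f0 _ Ux) (f1 _ Ux)).
by rewrite -exprVn expr2 mulN1r.
Qed.

End Ck.

(** * Composition with vector-valued maps *)

Section Comp.
Variables (R : realType) (n k : nat) (F : 'I_k -> 'rV[R]_n -> R).

Let G (x : 'rV[R]_n) : 'rV[R]_k := \row_i F i x.

(** A neighbourhood in the space of rows contains a product of neighbourhoods of the entries, and
    there are finitely many entries. *)
Lemma continuous_row x : (forall i, {for x, continuous (F i)}) ->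
  {for x, continuous G}.
Proof.
move=> cF B [P0 hP0 PB].
have : \forall y \near nbhs x, forall j, P0 ord0 j (F j y).
  by apply: filter_forall => j; apply: cF; have := hP0 ord0 j; rewrite mxE; exact.
by apply: filterS => y H; apply: PB => i j; rewrite (ord1 i) mxE; exact: H.
Qed.

Lemma differentiable_row x : (forall i, differentiable (F i) x) ->
  differentiable G x /\ forall a, 'd G x a = \row_i 'd (F i) x a.
Proof.
move=> dF.
have GE : G = \sum_i (fun y => F i y *: (delta_mx ord0 i : 'rV[R]_k)).
  apply/funext => y; rewrite fct_sumE [LHS]row_sum_delta.
  by apply: eq_bigr => i _; rewrite mxE.
have di i : differentiable (fun y => F i y *: (delta_mx ord0 i : 'rV[R]_k)) x.
  exact: differentiableZl.
split; first by rewrite GE; exact: differentiable_sum.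
move=> a; rewrite -deriveE; last by rewrite GE; exact: differentiable_sum.
rewrite GE derive_sum; last by move=> i; exact: diff_derivable.
rewrite [RHS]row_sum_delta; apply: eq_bigr => i _.
by rewrite deriveE// diffZl// mxE.
Qed.

(** By the chain rule the derivative is a sum of products of a derivative of [F i] with a partial
    derivative of [g] taken after [G]; hence an induction on the order that is uniform in [g]. *)
Lemma Ck_comp j U V (g : 'rV[R]_k -> R) : open U -> open V ->
  (forall x, U x -> V (G x)) -> (forall i, Ck j U (F i)) -> Ck j V g ->
  Ck j U (fun x => g (G x)).
Proof.
move=> oU oV UV; elim: j g => [|j IH] g.
  move=> FC gC x Ux; apply: (@continuous_comp _ _ _ G g); last exact/gC/UV.
  by apply: continuous_row => i; exact: FC.
move=> FC /CkSP[g1 g2].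
have FC' i : Ck j U (F i) by exact: CkS.
have dF x : U x -> differentiable G x /\ forall a, 'd G x a = \row_i 'd (F i) x a.
  by move=> Ux; apply: differentiable_row => i; case: (FC i) => + _; exact.
apply/CkSP; split=> [x Ux|a].
  apply: (@differentiable_comp _ _ _ _ G g); first by case: (dF x Ux).
  exact/g1/UV.
apply: (@eq_Ck _ _ _ _
  (fun x => \sum_i dd (F i) x a * dd g (G x) (delta_mx ord0 i))) => //.
  move=> x /[!inE] Ux; rewrite (dd_comp a (dF x Ux).1 (g1 _ (UV _ Ux))).
  rewrite (dF _ Ux).2 linear_row_sum; apply: eq_bigr => i _.
  by rewrite mxE.
apply: Ck_sum => // i _; apply: (CkM oU); first exact: ((CkSP _ _ _).1 (FC i)).2.
exact: IH FC' (g2 _).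
Qed.

End Comp.

(** * Second differences over a parallelogram *)

Section Line.
Variables (R : realType) (n : nat).
Implicit Types (g : 'rV[R]_n -> R) (x y a b : 'rV[R]_n).

Lemma is_derive_line g y a (s : R) : differentiable g (y + s *: a) ->
  is_derive s 1 (fun s => g (y + s *: a)) (dd g (y + s *: a) a).
Proof.
move=> dg; pose l (s : R) := y + s *: a.
have dl : is_diff s l (0 + ( *:%R^~ a)).
  exact: (@is_diffD _ _ _ (cst y) (fun s : R => s *: a)).
have ll : differentiable l s by exact: ex_diff.
have df : differentiable (g \o l) s by exact: (differentiable_comp ll dg).
apply: DeriveDef; first exact: (diff_derivable (f := g \o l)).
rewrite (deriveE (f := g \o l))//.
rewrite (congr1 (fun h => h 1) (diff_comp ll dg)) /= diff_val /=.
by rewrite [X in 'd g _ X](_ : _ = a)// fctE /= add0r scale1r.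
Qed.

Lemma near_parallelogram x a b (P : set 'rV[R]_n) : (\forall y \near x, P y) ->
  exists2 h : R, 0 < h & forall s t, 0 <= s <= h -> 0 <= t <= h ->
    P (x + s *: a + t *: b).
Proof.
move=> /nbhs_ballP[e /= e0 eP].
pose h := e / (2 * (`|a| + `|b| + 1)).
have ab0 : 0 < `|a| + `|b| + 1 by rewrite ltr_wpDl// addr_ge0.
have h0 : 0 < h by rewrite divr_gt0// mulr_gt0.
exists h => // s t /andP[s0 sh] /andP[t0 th]; apply: eP.
rewrite -ball_normE /ball_ /= -addrA opprD addrA subrr sub0r normrN.
apply: (le_lt_trans (ler_normD _ _)); rewrite !normrZ !ger0_norm//.
have : s * `|a| + t * `|b| <= h * (`|a| + `|b| + 1).
  rewrite !mulrDr mulr1; apply: ler_wpDr; first exact: ltW.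
  by apply: lerD; exact: ler_wpM2r.
move=> /le_lt_trans; apply.
by rewrite /h invfM mulrA divfK ?gt_eqF// ltr_pdivrMr// mulr2n mulrDr mulr1 ltrDl.
Qed.

(** Two applications of the mean value theorem: along [a], to the difference of [g] between two
    parallel sides; then along [b], to the derivative of [g] in the direction [a]. *)
Lemma second_difference g x a b (h : R) : 0 < h ->
  (forall s t, 0 <= s <= h -> 0 <= t <= h ->
    differentiable g (x + s *: a + t *: b) /\
    differentiable (fun y => dd g y a) (x + s *: a + t *: b)) ->
  exists s t, [/\ 0 <= s <= h, 0 <= t <= h &
    g (x + h *: a + h *: b) - g (x + h *: a) - g (x + h *: b) + g x =
    h ^+ 2 * dd (fun y => dd g y a) (x + s *: a + t *: b) b].
Proof.
move=> h0 dg.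
pose f := (fun s => g ((x + h *: b) + s *: a)) - (fun s => g (x + s *: a)).
pose f' s := dd g ((x + h *: b) + s *: a) a - dd g (x + s *: a) a.
have df s : 0 <= s <= h -> is_derive s 1 f (f' s).
  move=> sh; have [d0 _] := dg s 0 sh (introT andP (conj (lexx _) (ltW h0))).
  have [d1 _] := dg s h sh (introT andP (conj (ltW h0) (lexx _))).
  rewrite scale0r addr0 in d0; rewrite addrAC in d1.
  exact: is_deriveB (is_derive_line d1) (is_derive_line d0).
have fc : {within `[0, h], continuous f}.
  apply: derivable_within_continuous => s; rewrite in_itv /= => sh.
  exact: (@ex_derive _ _ _ _ _ _ _ (df s sh)).
have df' s : s \in `]0, h[ -> is_derive s 1 f (f' s).
  by rewrite in_itv /= => /andP[s0 sh]; apply: df; rewrite !ltW.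
have [s] := MVT h0 df' fc; rewrite in_itv /= subr0 => /andP[s0 sh].
have {}sh : 0 <= s <= h by rewrite !ltW.
rewrite /f !fctE /= !scale0r !addr0 => E1.
pose k t := dd g ((x + s *: a) + t *: b) a.
pose k' t := dd (fun y => dd g y a) ((x + s *: a) + t *: b) b.
have dk t : 0 <= t <= h -> is_derive t 1 k (k' t).
  by move=> th; apply: (is_derive_line (g := fun y => dd g y a)); case: (dg s t sh th).
have kc : {within `[0, h], continuous k}.
  apply: derivable_within_continuous => t; rewrite in_itv /= => th.
  exact: (@ex_derive _ _ _ _ _ _ _ (dk t th)).
have dk' t : t \in `]0, h[ -> is_derive t 1 k (k' t).
  by rewrite in_itv /= => /andP[t0 th]; apply: dk; rewrite !ltW.
have [t] := MVT h0 dk' kc; rewrite in_itv /= subr0 => /andP[t0 th].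
rewrite /k scale0r addr0 => E2.
have {}th : 0 <= t <= h by rewrite !ltW.
exists s, t; split=> //.
have -> : x + h *: a + h *: b = x + h *: b + h *: a by rewrite addrAC.
have -> : dd (fun y => dd g y a) (x + s *: a + t *: b) b = k' t by [].
rewrite expr2 -mulrA [h * k' t]mulrC -E2.
rewrite (addrAC x (s *: a)) -/(f' s) mulrC -E1.
ring.
Qed.

End Line.

(** * Germs of smooth functions and symmetry of second derivatives *)

Section SmoothPt.
Variables (R : realType) (n : nat).
Implicit Types (f g : 'rV[R]_n -> R) (x a b : 'rV[R]_n).

Lemma smooth_pt_near f x : smooth_pt f x -> \forall y \near x, smooth_pt f y.
Proof.
move=> [U [oU Ux fU]]; apply: (filterS _ (open_nbhs_nbhs (conj oU Ux))) => y Uy.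
by exists U.
Qed.

Lemma smooth_pt_differentiable f x : smooth_pt f x -> differentiable f x.
Proof. by move=> [U [oU Ux fU]]; case: (fU 1%N) => + _; apply. Qed.

Lemma smooth_pt_diff f x a : smooth_pt f x -> smooth_pt (fun y => dd f y a) x.
Proof.
by move=> [U [oU Ux fU]]; exists U; split=> // k; case: (fU k.+1) => _; apply.
Qed.

Lemma eq_smooth_pt f g x : (\forall y \near x, f y = g y) ->
  smooth_pt f x -> smooth_pt g x.
Proof.
move=> fg [U [oU Ux fU]]; exists (U `&` [set y | f y = g y]^°); split.
- by apply: openI => //; exact: open_interior.
- by split.
- move=> k; have oV : open (U `&` [set y | f y = g y]^°).
    by apply: openI => //; exact: open_interior.
  apply: (@eq_Ck _ _ _ _ f) => //.
    by move=> y /[!inE] -[_]; exact: interior_subset.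
  by apply: (Ck_sub _ (fU k)) => y [].
Qed.

Lemma smooth_pt_cst (r : R) x : smooth_pt (fun=> r) x.
Proof. by exists setT; split=> // [|k]; [exact: openT|exact: Ck_cst]. Qed.

Lemma smooth_pt_linear (f : {linear 'rV[R]_n -> R}) x : continuous f ->
  smooth_pt f x.
Proof. by exists setT; split=> // [|k]; [exact: openT|exact: Ck_linear]. Qed.

Lemma smooth_pt2 f g x : smooth_pt f x -> smooth_pt g x ->
  exists U, [/\ open U, U x, (forall k, Ck k U f) & (forall k, Ck k U g)].
Proof.
move=> [U [oU Ux fU]] [V [oV Vx gV]]; exists (U `&` V); split=> //.
- exact: openI.
- by move=> k; apply: Ck_sub (fU k) => y [].
- by move=> k; apply: Ck_sub (gV k) => y [].
Qed.

Lemma smooth_ptD f g x : smooth_pt f x -> smooth_pt g x ->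
  smooth_pt (fun y => f y + g y) x.
Proof.
move=> fx gx; have [U [oU Ux fU gU]] := smooth_pt2 fx gx.
by exists U; split=> // k; exact: CkD.
Qed.

Lemma smooth_ptM f g x : smooth_pt f x -> smooth_pt g x ->
  smooth_pt (fun y => f y * g y) x.
Proof.
move=> fx gx; have [U [oU Ux fU gU]] := smooth_pt2 fx gx.
by exists U; split=> // k; exact: CkM.
Qed.

Lemma smooth_pt_sum I (r : seq I) (P : pred I) (f : I -> 'rV[R]_n -> R) x :
  (forall i, P i -> smooth_pt (f i) x) ->
  smooth_pt (fun y => \sum_(i <- r | P i) f i y) x.
Proof.
move=> H; elim: r => [|i r IH].
  apply: eq_smooth_pt (smooth_pt_cst 0 x).
  by apply: (@filterE _ (nbhs x)) => y; rewrite big_nil.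
apply: (@eq_smooth_pt (fun y => (if P i then f i y else 0) +
    \sum_(j <- r | P j) f j y)).
  by apply: (@filterE _ (nbhs x)) => y; rewrite big_cons; case: (P i); rewrite ?add0r.
by apply: smooth_ptD => //; case: (boolP (P i)) => Pi;
  [exact: H|exact: smooth_pt_cst].
Qed.

Lemma smooth_pt_continuous f x : smooth_pt f x -> {for x, continuous f}.
Proof. by move=> /smooth_pt_differentiable/differentiable_continuous. Qed.

Lemma smooth_ptV f x : f x != 0 -> smooth_pt f x ->
  smooth_pt (fun y => (f y)^-1) x.
Proof.
move=> fx0 fx; have [U [oU Ux fU]] := fx.
have nz : \forall y \near x, f y != 0.
  have := smooth_pt_continuous fx; move=> /cvgrPdist_lt/(_ `|f x|).
  rewrite normr_gt0 => /(_ fx0); apply: filterS => y.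
  by apply: contraTneq => ->; rewrite subr0 ltxx.
pose V := U `&` [set y | f y != 0]^°.
have oV : open V by apply: openI => //; exact: open_interior.
exists V; split=> // k; apply: CkV => //.
  by move=> y [_ /interior_subset].
by apply: Ck_sub (fU k) => y [].
Qed.

(** The second difference over a small parallelogram is symmetric in [a] and [b], and it equals
    [h ^+ 2] times either mixed derivative at some point of the parallelogram. Continuity brings
    both within [e / 2] of their values at [x]. *)
Lemma diff_symmetric g x a b : smooth_pt g x ->
  dd (fun y => dd g y a) x b = dd (fun y => dd g y b) x a.
Proof.
move=> gx; apply/eqP; rewrite eq_le; move: a b.
suff H a b : dd (fun y => dd g y a) x b <= dd (fun y => dd g y b) x a.
  by move=> a b; rewrite !H.
have nab := smooth_pt_continuous (smooth_pt_diff b (smooth_pt_diff a gx)).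
have nba := smooth_pt_continuous (smooth_pt_diff a (smooth_pt_diff b gx)).
apply/ler_addgt0Pl => e e0; have e20 : 0 < e / 2 by rewrite divr_gt0.
move/cvgrPdist_lt/(_ _ e20): nab => nab; move/cvgrPdist_lt/(_ _ e20): nba => nba.
have sg := smooth_pt_near gx.
have N : \forall y \near x,
    [/\ `|dd (fun y => dd g y a) x b - dd (fun y => dd g y a) y b| < e / 2,
     `|dd (fun y => dd g y b) x a - dd (fun y => dd g y b) y a| < e / 2 &
     smooth_pt g y] by near=> y; split; near: y.
have [h h0 hP] := near_parallelogram a b N.
have sm s t : 0 <= s <= h -> 0 <= t <= h -> smooth_pt g (x + s *: a + t *: b).
  by move=> sh th; case: (hP s t sh th).
have [s [t [sh th E]]] : exists s t, [/\ 0 <= s <= h, 0 <= t <= h &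
    g (x + h *: a + h *: b) - g (x + h *: a) - g (x + h *: b) + g x =
    h ^+ 2 * dd (fun y => dd g y a) (x + s *: a + t *: b) b].
  apply: second_difference => // s t sh th; split.
    exact: smooth_pt_differentiable (sm _ _ sh th).
  exact: smooth_pt_differentiable (smooth_pt_diff _ (sm _ _ sh th)).
have [s' [t' [sh' th' E']]] : exists s t, [/\ 0 <= s <= h, 0 <= t <= h &
    g (x + h *: b + h *: a) - g (x + h *: b) - g (x + h *: a) + g x =
    h ^+ 2 * dd (fun y => dd g y b) (x + s *: b + t *: a) a].
  apply: second_difference => // s' t' sh' th'; rewrite addrAC; split.
    exact: smooth_pt_differentiable (sm _ _ th' sh').
  exact: smooth_pt_differentiable (smooth_pt_diff _ (sm _ _ th' sh')).
have : h ^+ 2 * dd (fun y => dd g y a) (x + s *: a + t *: b) b =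
       h ^+ 2 * dd (fun y => dd g y b) (x + s' *: b + t' *: a) a.
  by rewrite -E -E' (addrAC x (h *: b)); ring.
move/(mulfI _); rewrite expf_eq0 /= gt_eqF// => /(_ isT) EE.
have [n1 _ _] := hP s t sh th.
have [_ n2 _] := hP t' s' th' sh'.
rewrite addrAC -EE in n2.
have aux (u v w : R) : `|u - w| < e / 2 -> `|v - w| < e / 2 -> u <= e + v.
  by rewrite !ltr_distl => /andP[? ?] /andP[? ?]; lra.
exact: aux n1 n2.
Unshelve. all: by end_near. Qed.

End SmoothPt.

(** The open set must lie in the finitely many domains of the [F i] and be carried into the domain
    [V] of [g]; interiors make both conditions open. *)
Lemma smooth_pt_comp (R : realType) (n k : nat) (F : 'I_k -> 'rV[R]_n -> R)
    (g : 'rV[R]_k -> R) x :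
  (forall i, smooth_pt (F i) x) -> smooth_pt g (\row_i F i x) ->
  smooth_pt (fun y => g (\row_i F i y)) x.
Proof.
move=> sF sg; have [V [oV Vx gV]] := sg.
have /choice [U HU] : forall i, exists U, [/\ open U, U x & forall j, Ck j U (F i)].
  by move=> i; exact: sF.
pose W := [set y | forall i, U i y]^° `&` [set y | V (\row_i F i y)]^°.
have oW : open W by apply: openI; exact: open_interior.
exists W; split=> //.
  split.
    apply: (filter_forall (F := nbhs x)) => i.
    by case: (HU i) => oU Ux _; exact: open_nbhs_nbhs.
  have : {for x, continuous (fun y => \row_i F i y)}.
    by apply: continuous_row => i; exact: smooth_pt_continuous.
  apply; exact: open_nbhs_nbhs.
move=> j; apply: (@Ck_comp _ _ _ F _ W V) => //.
  by move=> y [_ /interior_subset].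
by move=> i; case: (HU i) => _ _ /(_ j); apply: Ck_sub => y [/interior_subset].
Qed.

Lemma diff_dd (R : realType) n (g : 'rV[R]_n -> R) x a : 'd g x a = dd g x a.
Proof. by []. Qed.

#[global] Opaque dd.

(** * Charted spaces *)

Section CoordSmooth.
Variables (R : realType) (n : nat).
Implicit Types (x a : 'rV[R]_n).

Lemma smooth_pt_coord_dd (i : 'I_n) x : smooth_pt (fun y => y ord0 i) x /\
  forall a, dd (fun y => y ord0 i) x a = a ord0 i.
Proof.
have lf : linear (fun y : 'rV[R]_n => y ord0 i : R) by move=> r y z; rewrite !mxE.
pose fM := GRing.isLinear.Build R 'rV[R]_n R _ _ lf.
pose f : {linear 'rV[R]_n -> R} := HB.pack (fun y : 'rV[R]_n => y ord0 i : R) fM.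
have cf : continuous f by exact: coord_continuous.
by split=> [|a]; [exact: smooth_pt_linear cf|exact: dd_lin cf].
Qed.

Lemma smooth_pt_coord (i : 'I_n) x : smooth_pt (fun y => y ord0 i) x.
Proof. by case: (smooth_pt_coord_dd i x). Qed.

Lemma dd_coord (i : 'I_n) x a : dd (fun y => y ord0 i) x a = a ord0 i.
Proof. by case: (smooth_pt_coord_dd i x). Qed.

End CoordSmooth.

(** The axioms of [is_manifold] that are local; unlike the others they are needed
    on [TM M] as well. *)
Definition smooth_atlas (R : realType) n (N : chartedSpace R n) : Prop :=
  [/\ (forall p : N, exists2 c, atlas c & dom c p),
      (forall c : chart R n N, atlas c ->
         {in dom c &, injective (coord c)} /\
         forall p, dom c p -> near_in c p setT)
    & (forall (c c' : chart R n N) p, atlas c -> atlas c' -> dom c p -> dom c' p ->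
         forall i : 'I_n, exists2 g, smooth_pt g (coord c p) &
           near_in c p
             (fun q => dom c' q /\ coord c' q ord0 i = g (coord c q)))].

Existing Class smooth_atlas.

Lemma manifold_smooth_atlas (R : realType) n (N : chartedSpace R n) :
  is_manifold N -> smooth_atlas N.
Proof. by case. Qed.

Section Charts.
Variables (R : realType) (n : nat) (N : chartedSpace R n).
Context {hN : smooth_atlas N}.
Implicit Types (c : chart R n N) (p q : N) (f g : N -> R) (P Q : set N).

(** The point [p] is a default value taken outside the image of the chart, so that inverses with
    different base points agree on that image. *)
Definition cinv c p x : N :=
  if pselect (exists q, dom c q /\ coord c q = x) is left h then projT1 (cid h) else p.

Lemma chart_inj c p q : atlas c -> dom c p -> dom c q ->
  coord c p = coord c q -> p = q.
Proof.
by case: hN => _ H _ /H [inj _] *; apply: inj; rewrite ?inE.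
Qed.

Lemma cinvK c p q : atlas c -> dom c q -> cinv c p (coord c q) = q.
Proof.
move=> hc cq; rewrite /cinv; case: pselect => [h|[]]; last by exists q.
by case: (cid h) => q' /= [cq' E]; exact: chart_inj E.
Qed.

Lemma near_image c p : atlas c -> dom c p -> \forall x \near coord c p,
  dom c (cinv c p x) /\ coord c (cinv c p x) = x.
Proof.
case: hN => _ H0 _ hc cp; have [_ /(_ _ cp)[_ H]] := H0 _ hc.
by apply: filterS H => x [q [cq <- _]]; rewrite cinvK.
Qed.

Lemma near_inE c p P : atlas c ->
  near_in c p P <-> dom c p /\ \forall x \near coord c p, P (cinv c p x).
Proof.
move=> hc; split=> -[cp]; last first.
  move=> H; split=> //; have := near_image hc cp; apply: filterS2 H => x Px [cx E].
  by exists (cinv c p x).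
by move=> H; split=> //; apply: filterS H => x [q [cq <- Pq]]; rewrite cinvK.
Qed.

Lemma near_cinv_near c p P : atlas c -> dom c p ->
  (\forall x \near coord c p, P (cinv c p x)) ->
  \forall x \near coord c p, \forall y \near x, P (cinv c (cinv c p x) y).
Proof.
move=> hc cp H.
have K : \forall y \near coord c p, P (cinv c p y) /\
    (dom c (cinv c p y) /\ coord c (cinv c p y) = y).
  by apply: filterS2 H (near_image hc cp) => y.
have := near_join K; apply: filterS => x.
by apply: filterS => y [Py [cy E]]; rewrite -E cinvK.
Qed.

(** In dimension [0] the compatibility axiom is void, but then charts are
    defined on single points. *)
Lemma trans_near c c' p : atlas c -> atlas c' -> dom c p -> dom c' p ->
  \forall x \near coord c p, dom c' (cinv c p x).
Proof.
move=> hc hc' cp cp'; have [i _|n0] := pickP (xpredT : pred 'I_n).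
  case: hN => _ _ /(_ _ _ _ hc hc' cp cp' i)[g _] /(near_inE _ _ hc)[_].
  by apply: filterS => x [].
have := near_image hc cp; apply: filterS => x [cx E].
rewrite (chart_inj hc cx cp)// E; apply/rowP => i; by have := n0 i.
Qed.

Lemma trans_smooth c c' p i : atlas c -> atlas c' -> dom c p -> dom c' p ->
  smooth_pt (fun x => coord c' (cinv c p x) ord0 i) (coord c p).
Proof.
move=> hc hc' cp cp'; case: hN => _ _ /(_ _ _ _ hc hc' cp cp' i)[g sg].
move=> /(near_inE _ _ hc)[_ H]; apply: (eq_smooth_pt _ sg).
have := near_image hc cp; apply: filterS2 H => x [c'x ->] [_ ->] //.
Qed.

Lemma trans_continuous c c' p : atlas c -> atlas c' -> dom c p -> dom c' p ->
  {for coord c p, continuous (fun x => coord c' (cinv c p x))}.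
Proof.
move=> hc hc' cp cp'.
have -> : (fun x => coord c' (cinv c p x)) =
    fun x => \row_i coord c' (cinv c p x) ord0 i.
  by apply/funext => x; apply/rowP => i; rewrite mxE.
by apply: continuous_row => i; exact/smooth_pt_continuous/trans_smooth.
Qed.

(** Transport along the continuous change of charts. It allows [near_pt], which asks for one chart
    only, to be tested in any chart around the point, whence a filter. *)
Lemma near_in_chart c c' p P : atlas c -> atlas c' -> dom c p -> dom c' p ->
  near_in c p P -> near_in c' p P.
Proof.
move=> hc hc' cp cp' /(near_inE _ _ hc)[_ H]; apply/(near_inE _ _ hc'); split=> //.
have K : \forall x \near coord c' p, P (cinv c p (coord c (cinv c' p x))).
  apply: (trans_continuous hc' hc cp' cp (t := fun y => P (cinv c p y))).
  by rewrite /= cinvK.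
have := trans_near hc' hc cp' cp; apply: filterS2 K => x /= + cx.
by rewrite cinvK.
Qed.

Lemma near_ptE c p P : atlas c -> dom c p ->
  near_pt p P <-> \forall x \near coord c p, P (cinv c p x).
Proof.
move=> hc cp; split=> [[c' hc' H]|H]; last by exists c => //; apply/near_inE.
have cp' : dom c' p by case: H.
by move/(near_in_chart hc' hc cp' cp): H => /(near_inE _ _ hc)[].
Qed.

Lemma near_pt_filter p : Filter (near_pt p).
Proof.
have [c hc cp] : exists2 c, atlas c & dom c p by case: hN.
split.
- by apply/(near_ptE _ hc cp); exact: filterT.
- move=> P Q /(near_ptE _ hc cp) HP /(near_ptE _ hc cp) HQ.
  by apply/(near_ptE _ hc cp); exact: filterI.
- move=> P Q PQ /(near_ptE _ hc cp) HP.
  by apply/(near_ptE _ hc cp); apply: filterS HP => x; exact: PQ.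
Qed.

#[global] Existing Instance near_pt_filter.

Lemma near_pt_self p P : near_pt p P -> P p.
Proof. by move=> [c hc /(near_inE _ _ hc)[cp /nbhs_singleton]]; rewrite cinvK. Qed.

Lemma near_pt_near p P : near_pt p P -> near_pt p (fun q => near_pt q P).
Proof.
move=> [c hc /(near_inE _ _ hc)[cp H]]; apply/(near_ptE _ hc cp).
apply: filterS2 (near_cinv_near hc cp H) (near_image hc cp) => x K [cx E].
by apply/(near_ptE _ hc cx); rewrite E.
Qed.

Lemma near_pt_dom c p : atlas c -> dom c p -> near_pt p (dom c).
Proof.
move=> hc cp; apply/(near_ptE _ hc cp).
by have := near_image hc cp; apply: filterS => x [].
Qed.

Definition rep c p f : 'rV[R]_n -> R := fun x => f (cinv c p x).

Lemma rep_coord c p f : atlas c -> dom c p -> rep c p f (coord c p) = f p.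
Proof. by move=> hc cp; rewrite /rep cinvK. Qed.

Lemma rep_base c p q f : atlas c -> dom c p -> dom c q ->
  \forall x \near coord c q, rep c p f x = rep c q f x.
Proof.
move=> hc cp cq; apply: filterS (near_image hc cq) => x [cx E].
by rewrite /rep -{1}E !cinvK.
Qed.

(** Composition with the smooth change of charts makes smoothness testable in any chart around [p];
    the closure properties are then inherited from Euclidean space. *)
Lemma smooth_atE c p f : atlas c -> dom c p ->
  smooth_at p f <-> smooth_pt (rep c p f) (coord c p).
Proof.
move=> hc cp; split=> [[c' hc' [g sg H]]|H]; last first.
  exists c => //; exists (rep c p f) => //; apply/near_inE => //; split=> //.
  by apply: filterS (near_image hc cp) => x [cx E]; rewrite /rep E.
have cp' : dom c' p by case: H.
have K : near_pt p (fun q => f q = g (coord c' q)) by exists c'.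
apply: (@eq_smooth_pt _ _ (fun x => g (\row_i coord c' (cinv c p x) ord0 i))).
  move/(near_ptE _ hc cp): K; apply: filterS => x Ex.
  by rewrite /rep Ex; congr g; apply/rowP => i; rewrite mxE.
apply: smooth_pt_comp => [i|]; first exact: trans_smooth.
rewrite (_ : \row_i _ = coord c' p)//; apply/rowP => i.
by rewrite mxE cinvK.
Qed.

Lemma eq_smooth_at p f g : near_pt p (fun q => f q = g q) ->
  smooth_at p f -> smooth_at p g.
Proof.
have [c hc cp] : exists2 c, atlas c & dom c p by case: hN.
move=> /(near_ptE _ hc cp) E /(smooth_atE _ hc cp) sf; apply/(smooth_atE _ hc cp).
exact: (eq_smooth_pt _ sf).
Qed.

Lemma smooth_at_cst p r : smooth_at p (fun=> r).
Proof.
have [c hc cp] : exists2 c, atlas c & dom c p by case: hN.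
by apply/(smooth_atE _ hc cp); exact: smooth_pt_cst.
Qed.

Lemma smooth_atD p f g : smooth_at p f -> smooth_at p g ->
  smooth_at p (fun q => f q + g q).
Proof.
have [c hc cp] : exists2 c, atlas c & dom c p by case: hN.
move=> /(smooth_atE _ hc cp) sf /(smooth_atE _ hc cp) sg.
by apply/(smooth_atE _ hc cp); exact: smooth_ptD.
Qed.

Lemma smooth_atM p f g : smooth_at p f -> smooth_at p g ->
  smooth_at p (fun q => f q * g q).
Proof.
have [c hc cp] : exists2 c, atlas c & dom c p by case: hN.
move=> /(smooth_atE _ hc cp) sf /(smooth_atE _ hc cp) sg.
by apply/(smooth_atE _ hc cp); exact: smooth_ptM.
Qed.

Lemma smooth_atV p f : f p != 0 -> smooth_at p f ->
  smooth_at p (fun q => (f q)^-1).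
Proof.
have [c hc cp] : exists2 c, atlas c & dom c p by case: hN.
move=> f0 /(smooth_atE _ hc cp) sf.
by apply/(smooth_atE _ hc cp); apply: (smooth_ptV _ sf); rewrite rep_coord.
Qed.

Lemma smooth_atN p f : smooth_at p f -> smooth_at p (fun q => - f q).
Proof.
move=> sf; apply: eq_smooth_at (smooth_atM (smooth_at_cst p (-1)) sf).
by apply: filterE => q; rewrite mulN1r.
Qed.

Lemma smooth_at_sum p I (r : seq I) (P : pred I) (f : I -> N -> R) :
  (forall i, P i -> smooth_at p (f i)) ->
  smooth_at p (fun q => \sum_(i <- r | P i) f i q).
Proof.
have [c hc cp] : exists2 c, atlas c & dom c p by case: hN.
move=> sf; apply/(smooth_atE _ hc cp).
by apply: smooth_pt_sum => i Pi; apply/(smooth_atE _ hc cp)/sf.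
Qed.

Lemma smooth_at_prod p I (r : seq I) (P : pred I) (f : I -> N -> R) :
  (forall i, P i -> smooth_at p (f i)) ->
  smooth_at p (fun q => \prod_(i <- r | P i) f i q).
Proof.
move=> sf; elim: r => [|i r IH].
  by apply: eq_smooth_at (smooth_at_cst p 1); apply: filterE => q; rewrite big_nil.
have [Pi|nPi] := boolP (P i).
  apply: eq_smooth_at (smooth_atM (sf i Pi) IH).
  by apply: filterE => q; rewrite big_cons Pi.
apply: eq_smooth_at IH.
by apply: filterE => q; rewrite big_cons (negbTE nPi).
Qed.

Lemma smooth_at_near p f : smooth_at p f -> near_pt p (fun q => smooth_at q f).
Proof.
have [c hc cp] : exists2 c, atlas c & dom c p by case: hN.
move=> /(smooth_atE _ hc cp)/smooth_pt_near H; apply/(near_ptE _ hc cp).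
apply: filterS2 H (near_image hc cp) => x sf [cx E].
apply/(smooth_atE _ hc cx); rewrite -E in sf.
by apply: (eq_smooth_pt _ sf); exact: rep_base.
Qed.

Definition xc c i : N -> R := fun q => coord c q ord0 i.

Lemma rep_xc c p i : atlas c -> dom c p ->
  \forall x \near coord c p, (x : 'rV[R]_n) ord0 i = rep c p (xc c i) x.
Proof.
by move=> hc cp; apply: filterS (near_image hc cp) => x [cx E]; rewrite /rep /xc E.
Qed.

Lemma smooth_xc c p i : atlas c -> dom c p -> smooth_at p (xc c i).
Proof.
move=> hc cp; apply/(smooth_atE _ hc cp).
apply: (eq_smooth_pt (rep_xc i hc cp)); exact: smooth_pt_coord.
Qed.

(** * Tangent vectors *)

Implicit Types (u v w : functional N) (X Y Z : N -> functional N).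

Definition tanvec c p (a : 'rV[R]_n) : functional N := fun f =>
  if `[< smooth_at p f >] then dd (rep c p f) (coord c p) a else 0.

Lemma tanvecE c p a f : smooth_at p f -> tanvec c p a f = dd (rep c p f) (coord c p) a.
Proof. by move=> sf; rewrite /tanvec; case: asboolP. Qed.

Lemma tanvec_tangent c p a : atlas c -> dom c p -> is_tangent p (tanvec c p a).
Proof.
move=> hc cp; split=> [f nf|]; first by rewrite /tanvec; case: asboolP.
exists c; split=> //; exists a => f g sg [_ H].
have sf : smooth_at p f by exists c => //; exists g => //; split.
apply: etrans (tanvecE c a sf) _.
apply: etrans _ (esym (diff_dd _ _ _)); apply: near_dd; last exact: smooth_pt_differentiable.
by apply: filterS H => x [q [cq <- E]]; rewrite /rep cinvK// E.
Qed.

Lemma is_tangentE c p v : atlas c -> dom c p ->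
  is_tangent p v <-> exists a, v = tanvec c p a.
Proof.
move=> hc cp; split=> [[v0 [c' [hc' cp' [a va]]]]|[a ->]]; last exact: tanvec_tangent.
pose T (x : 'rV[R]_n) := \row_i coord c (cinv c' p x) ord0 i.
have TE : T (coord c' p) = coord c p by apply/rowP => i; rewrite mxE cinvK.
have [dT _] : differentiable T (coord c' p) /\ forall a, 'd T (coord c' p) a =
    \row_i 'd (fun x => coord c (cinv c' p x) ord0 i) (coord c' p) a.
  by apply: differentiable_row => i; exact/smooth_pt_differentiable/trans_smooth.
(* The components of a vector change by the differential of the change of charts [T]. *)
exists ('d T (coord c' p) a); apply/funext => f.
rewrite /tanvec; case: asboolP => [sf|]; last exact: v0.
have sf' := (smooth_atE _ hc' cp').1 sf; have sf'' := (smooth_atE _ hc cp).1 sf.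
rewrite (va f _ sf') ?diff_dd; last first.
  apply/near_inE => //; split=> //.
  by apply: filterS (near_image hc' cp') => x [cx E]; rewrite /rep E.
rewrite -TE -[RHS](dd_comp a dT); last first.
  by rewrite TE; exact: smooth_pt_differentiable.
apply: near_dd.
  have H := trans_near hc' hc cp' cp; apply: filterS H => x cx.
  rewrite /rep (_ : T x = coord c (cinv c' p x)) ?cinvK//.
  by apply/rowP => i; rewrite mxE.
apply: (differentiable_comp dT); rewrite TE; exact: smooth_pt_differentiable.
Qed.

Lemma functionalD u v f : (u + v) f = u f + v f. Proof. by []. Qed.

Lemma functionalZ r v f : (r *: v) f = r * v f. Proof. by []. Qed.

Lemma functionalB u v f : (u - v) f = u f - v f. Proof. by []. Qed.

Lemma tanvecD c p a b : tanvec c p (a + b) = tanvec c p a + tanvec c p b.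
Proof.
apply/funext => f; rewrite functionalD /tanvec; case: asboolP => _; first exact: ddDr.
by rewrite addr0.
Qed.

Lemma tanvecZ c p r a : tanvec c p (r *: a) = r *: tanvec c p a.
Proof.
apply/funext => f; rewrite functionalZ /tanvec; case: asboolP => _; first exact: ddZr.
by rewrite mulr0.
Qed.

Lemma tangent0 p : is_tangent p (0 : functional N).
Proof.
have [c hc cp] : exists2 c, atlas c & dom c p by case: hN.
by apply/(is_tangentE _ hc cp); exists 0; rewrite -[in RHS](scale0r 0) tanvecZ scale0r.
Qed.

Lemma tangent_lin p r u v : is_tangent p u -> is_tangent p v ->
  is_tangent p (r *: u + v).
Proof.
have [c hc cp] : exists2 c, atlas c & dom c p by case: hN.
move=> /(is_tangentE _ hc cp)[a ->] /(is_tangentE _ hc cp)[b ->].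
by apply/(is_tangentE _ hc cp); exists (r *: a + b); rewrite tanvecD tanvecZ.
Qed.

Lemma tangentZ p r u : is_tangent p u -> is_tangent p (r *: u).
Proof.
by move=> tu; rewrite -[r *: u]addr0; apply: tangent_lin => //; exact: tangent0.
Qed.

Lemma tangentD p u v : is_tangent p u -> is_tangent p v -> is_tangent p (u + v).
Proof. by move=> tu tv; rewrite -[u]scale1r; exact: tangent_lin. Qed.

Lemma tangentB p u v : is_tangent p u -> is_tangent p v -> is_tangent p (u - v).
Proof. by move=> tu tv; rewrite addrC -scaleN1r; exact: tangent_lin. Qed.

Lemma tangent_sum p I (r : seq I) (P : pred I) (F : I -> functional N) :
  (forall i, P i -> is_tangent p (F i)) -> is_tangent p (\sum_(i <- r | P i) F i).
Proof.
move=> H; apply: big_ind => //; first exact: tangent0.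
by move=> u v; exact: tangentD.
Qed.

Lemma functional_sumE I (r : seq I) (P : pred I) (F : I -> functional N) f :
  (\sum_(i <- r | P i) F i) f = \sum_(i <- r | P i) F i f.
Proof. by elim/big_rec2: _ => // i y1 y2 _ <-. Qed.

Lemma functional_lincombE I (r : seq I) (a : I -> R) (F : I -> functional N) f :
  (\sum_(i <- r) a i *: F i) f = \sum_(i <- r) a i * F i f.
Proof. by rewrite functional_sumE. Qed.

Section Derivation.
Variables (p : N) (v : functional N).
Hypothesis tv : is_tangent p v.

Lemma tangent_nsmooth f : ~ smooth_at p f -> v f = 0.
Proof. by case: tv => H _; exact: H. Qed.

Let chart_at : exists2 c, atlas c & dom c p. Proof. by case: hN. Qed.

(** Smoothness at [p] is shared by functions with the same germ; when it fails, both values are the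
    conventional [0]. *)
Lemma tangent_eq f g : near_pt p (fun q => f q = g q) -> v f = v g.
Proof.
move=> E; have [c hc cp] := chart_at; move: tv => /(is_tangentE _ hc cp)[a ->].
rewrite /tanvec; case: asboolP => [sf|nf]; case: asboolP => [sg|ng].
- apply/esym/near_dd; first exact: ((near_ptE _ hc cp).1 E).
  by apply/smooth_pt_differentiable/smooth_atE.
- by case: ng; exact: eq_smooth_at sf.
- by case: nf; apply: eq_smooth_at sg; apply: filterS E => q; exact: esym.
- by [].
Qed.

Lemma tangent_cst r : v (fun=> r) = 0.
Proof.
have [c hc cp] := chart_at; move: tv => /(is_tangentE _ hc cp)[a ->].
by rewrite tanvecE; [exact: dd_cst|exact: smooth_at_cst].
Qed.

Lemma tangent_addf f g : smooth_at p f -> smooth_at p g ->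
  v (fun q => f q + g q) = v f + v g.
Proof.
have [c hc cp] := chart_at; move: tv => /(is_tangentE _ hc cp)[a ->] sf sg.
rewrite !tanvecE//; last exact: smooth_atD.
by apply: ddD; apply/smooth_pt_differentiable/smooth_atE.
Qed.

Lemma tangent_mulf f g : smooth_at p f -> smooth_at p g ->
  v (fun q => f q * g q) = f p * v g + g p * v f.
Proof.
have [c hc cp] := chart_at; move: tv => /(is_tangentE _ hc cp)[a ->] sf sg.
rewrite !tanvecE//; last exact: smooth_atM.
rewrite -(rep_coord f hc cp) -(rep_coord g hc cp).
by apply: ddM; apply/smooth_pt_differentiable/smooth_atE.
Qed.

Lemma tangent_sumf I (r : seq I) (f : I -> N -> R) :
  (forall i, smooth_at p (f i)) ->
  v (fun q => \sum_(i <- r) f i q) = \sum_(i <- r) v (f i).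
Proof.
move=> sf; elim: r => [|i r IH].
  rewrite big_nil -[RHS](tangent_cst 0); apply: tangent_eq.
  by apply: filterE => q; rewrite big_nil.
rewrite big_cons -IH -tangent_addf//; last exact: smooth_at_sum.
by apply: tangent_eq; apply: filterE => q; rewrite big_cons.
Qed.

Lemma tangent_mulfl r f : smooth_at p f -> v (fun q => r * f q) = r * v f.
Proof.
move=> sf; rewrite (tangent_mulf (smooth_at_cst p r) sf) tangent_cst mulr0.
by rewrite addr0.
Qed.

End Derivation.

Lemma tanvec_xc c p i a : atlas c -> dom c p -> tanvec c p a (xc c i) = a ord0 i.
Proof.
move=> hc cp; rewrite tanvecE; last exact: smooth_xc.
rewrite (near_dd a (rep_xc i hc cp)) ?dd_coord//.
exact/smooth_pt_differentiable/smooth_pt_coord.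
Qed.

Definition partial c i p : functional N := tanvec c p (delta_mx ord0 i).

Lemma tanvec_partial c p a : tanvec c p a = \sum_i a ord0 i *: partial c i p.
Proof.
apply/funext => f; rewrite functional_lincombE /partial /tanvec.
case: asboolP => _; first exact: dd_row_sum.
by rewrite big1// => i _; rewrite mulr0.
Qed.

Lemma tangent_partial c p v : atlas c -> dom c p -> is_tangent p v ->
  v = \sum_i v (xc c i) *: partial c i p.
Proof.
move=> hc cp /(is_tangentE _ hc cp)[a ->].
by rewrite {1}tanvec_partial; apply: eq_bigr => i _; rewrite tanvec_xc.
Qed.

Lemma partial_tangent c i p : atlas c -> dom c p -> is_tangent p (partial c i p).
Proof. exact: tanvec_tangent. Qed.

Lemma partial_xc c i j p : atlas c -> dom c p -> partial c i p (xc c j) = (i == j)%:R.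
Proof. by move=> hc cp; rewrite /partial tanvec_xc// mxE eqxx eq_sym. Qed.

(** In the chart this is a directional derivative of the representative of [f]. The value at a
    nearby [q] uses the representative based at [q], which agrees near [q] with the one based at
    [p]. *)
Lemma smooth_partialf c i p f : atlas c -> dom c p -> smooth_at p f ->
  smooth_at p (fun q => partial c i q f).
Proof.
move=> hc cp sf; have sr := (smooth_atE _ hc cp).1 sf.
apply/(smooth_atE _ hc cp).
apply: (@eq_smooth_pt _ _ (fun x => dd (rep c p f) x (delta_mx ord0 i))); last first.
  exact: smooth_pt_diff.
have := (near_ptE _ hc cp).1 (smooth_at_near sf).
have := smooth_pt_near sr; apply: filterS3 (near_image hc cp) => x [cx E] sx sq.
apply: etrans _ (esym (tanvecE c _ sq)); rewrite E.
have K := rep_base f hc cp cx; rewrite E in K.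
exact: esym (near_dd _ K (smooth_pt_differentiable sx)).
Qed.

End Charts.

(** * Smooth vector fields and Lie brackets *)

Section Fields.
Variables (R : realType) (n : nat) (N : chartedSpace R n).
Context {hN : smooth_atlas N}.
Implicit Types (c : chart R n N) (p q : N) (f g : N -> R) (P Q : set N).
Implicit Types (u v w : functional N) (X Y Z : N -> functional N).

Lemma chart_around p : exists2 c, atlas c & dom c p.
Proof. by case: hN. Qed.

Lemma near_forall (I : finType) p (P : I -> set N) :
  (forall i, near_pt p (P i)) -> near_pt p (fun q => forall i, P i q).
Proof. exact: (filter_forall (F := near_pt p)). Qed.

Lemma smooth_field_at p X : smooth_field p X -> is_tangent p (X p).
Proof. by move=> [/near_pt_self]. Qed.

Lemma eq_smooth_field p X Y : near_pt p (fun q => X q = Y q) ->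
  smooth_field p X -> smooth_field p Y.
Proof.
move=> E [tX sX]; split; first by apply: filterS2 E tX => q <-.
by move=> f /sX; apply: eq_smooth_at; apply: filterS E => q ->.
Qed.

Lemma smooth_field0 p : smooth_field p (fun=> 0 : functional N).
Proof.
split; first by apply: filterE => q; exact: tangent0.
by move=> f _; exact: smooth_at_cst.
Qed.

Lemma smooth_fieldD p X Y : smooth_field p X -> smooth_field p Y ->
  smooth_field p (fun q => X q + Y q).
Proof.
move=> [tX sX] [tY sY]; split; first by apply: filterS2 tX tY => q; exact: tangentD.
by move=> f sf; apply: smooth_atD; [exact: sX|exact: sY].
Qed.

Lemma smooth_fieldZ p f X : smooth_at p f -> smooth_field p X ->
  smooth_field p (fun q => f q *: X q).
Proof.
move=> sf [tX sX]; split; first by apply: filterS tX => q; exact: tangentZ.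
by move=> g sg; apply: smooth_atM => //; exact: sX.
Qed.

Lemma smooth_field_sum p I (r : seq I) (P : pred I) (F : I -> N -> functional N) :
  (forall i, P i -> smooth_field p (F i)) ->
  smooth_field p (fun q => \sum_(i <- r | P i) F i q).
Proof.
move=> H; split.
  elim: r => [|i r IH].
    by apply: filterE => q; rewrite big_nil; exact: tangent0.
  have [Pi|nPi] := boolP (P i); last first.
    by apply: filterS IH => q; rewrite big_cons (negbTE nPi).
  by apply: filterS2 IH (H i Pi).1 => q; rewrite big_cons Pi => *; exact: tangentD.
move=> f sf; apply: eq_smooth_at (_ : smooth_at p (fun q => \sum_(i <- r | P i) F i q f)).
  by apply: filterE => q; rewrite functional_sumE.
by apply: smooth_at_sum => i Pi; exact: (H i Pi).2.
Qed.

Lemma smooth_fieldB p X Y : smooth_field p X -> smooth_field p Y ->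
  smooth_field p (fun q => X q - Y q).
Proof.
move=> sX sY; pose proof (smooth_fieldZ (smooth_at_cst p (-1)) sY) as sY'.
apply: (eq_smooth_field _ (smooth_fieldD sX sY')).
by apply: filterE => q; rewrite scaleN1r.
Qed.

Lemma smooth_partial c p i : atlas c -> dom c p -> smooth_field p (partial c i).
Proof.
move=> hc cp; split; last by move=> f; exact: smooth_partialf.
by apply: filterS (near_pt_dom hc cp) => q cq; exact: partial_tangent.
Qed.

Lemma smooth_field_partial c p X : atlas c -> dom c p -> smooth_field p X ->
  near_pt p (fun q => X q = \sum_i X q (xc c i) *: partial c i q).
Proof.
move=> hc cp [tX _]; apply: filterS2 tX (near_pt_dom hc cp) => q tX cq.
exact: tangent_partial.
Qed.

(** The definition quantifies over all functions smooth at the point, with no neighbourhood uniform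
    in them. The components on the coordinate functions are finitely many, stay smooth near [p] and
    determine the field. *)
Lemma smooth_field_near p X : smooth_field p X ->
  near_pt p (fun q => smooth_field q X).
Proof.
move=> sX; have [c hc cp] := chart_around p.
pose proof (near_pt_near (smooth_field_partial hc cp sX)) as N1.
have N2 : near_pt p (fun q => forall i, smooth_at q (fun q => X q (xc c i))).
  by apply: near_forall => i; apply: smooth_at_near; apply: sX.2; exact: smooth_xc.
apply: filterS3 N1 N2 (near_pt_dom hc cp) => q E H cq.
apply: (eq_smooth_field (X := fun q => \sum_i X q (xc c i) *: partial c i q)).
  by apply: filterS E => q'; exact: esym.
apply: smooth_field_sum => i _; apply: smooth_fieldZ => //.
exact: smooth_partial.
Qed.

Lemma extensionP p u : is_tangent p u ->
  smooth_field p (extension p u) /\ extension p u p = u.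
Proof.
move=> tu; rewrite /extension; case: xgetP => [X _ []//|].
have [c hc cp] := chart_around p.
(* The field with constant components in a chart is an extension, so the choice is not the default
   one. *)
move=> /(_ (fun q => \sum_i u (xc c i) *: partial c i q)) []; split.
  apply: smooth_field_sum => i _.
  by apply: (smooth_fieldZ (smooth_at_cst p _)); exact: smooth_partial.
by rewrite -tangent_partial.
Qed.

Lemma lieE p X Y f : smooth_at p f ->
  lie X Y p f = X p (fun q => Y q f) - Y p (fun q => X q f).
Proof. by move=> sf; rewrite /lie; case: asboolP. Qed.

Lemma partial_symmetric c p i j f : atlas c -> dom c p -> smooth_at p f ->
  partial c i p (fun q => partial c j q f) = partial c j p (fun q => partial c i q f).
Proof.
move=> hc cp sf; pose proof ((smooth_atE _ hc cp).1 sf) as sr.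
pose proof (smooth_pt_near sr) as dr.
have H k : \forall x \near coord c p, dd (rep c p f) x (delta_mx ord0 k) =
    rep c p (fun q => partial c k q f) x.
  pose proof ((near_ptE _ hc cp).1 (smooth_at_near sf)) as sN.
  apply: filterS3 dr (near_image hc cp) sN => x sx [cx E] sq.
  apply: etrans _ (esym (tanvecE c _ sq)); rewrite E.
  pose proof (rep_base f hc cp cx) as K; rewrite E in K.
  exact: esym (near_dd _ K (smooth_pt_differentiable sx)).
have S k l : partial c k p (fun q => partial c l q f) =
    dd (fun x => dd (rep c p f) x (delta_mx ord0 l)) (coord c p) (delta_mx ord0 k).
  rewrite [LHS]tanvecE; last exact: smooth_partialf.
  apply: near_dd (H l) _.
  exact: smooth_pt_differentiable (smooth_pt_diff _ sr).
by rewrite !S diff_symmetric.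
Qed.

(** Each of the two composites is an operator of order two; their second-order parts agree because
    coordinate derivatives commute. *)
Lemma lie_tangent p X Y : smooth_field p X -> smooth_field p Y ->
  is_tangent p (lie X Y p).
Proof.
move=> sX sY; have [c hc cp] := chart_around p.
pose proof (smooth_field_at sX) as tX; pose proof (smooth_field_at sY) as tY.
have sx i : smooth_at p (xc c i) by exact: smooth_xc.
suff -> : lie X Y p = \sum_i lie X Y p (xc c i) *: partial c i p.
  by apply: tangent_sum => i _; apply: tangentZ; exact: partial_tangent.
apply/funext => f; rewrite functional_lincombE.
have [sf|nf] := pselect (smooth_at p f); last first.
  rewrite [LHS]/lie; case: asboolP => // _; rewrite big1// => i _.
  by rewrite (tangent_nsmooth (partial_tangent i hc cp) nf) mulr0.
(* First-order and second-order parts of the composite operator, in coordinates. *)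
have H (U V : N -> functional N) : smooth_field p U -> smooth_field p V ->
   U p (fun q => V q f) = \sum_i U p (fun q => V q (xc c i)) * partial c i p f
     + \sum_i \sum_j U p (xc c j) * V p (xc c i) * partial c j p (fun q => partial c i q f).
  move=> sU sV; pose proof (smooth_field_at sU) as tU.
  pose proof (smooth_field_partial hc cp sV) as E.
  rewrite (tangent_eq tU (g := fun q => \sum_i V q (xc c i) * partial c i q f)); last first.
    by apply: filterS E => q {1}->; rewrite functional_lincombE.
  rewrite (tangent_sumf tU); last first.
    by move=> i; apply: smooth_atM; [exact: sV.2 _ (sx i)|exact: smooth_partialf].
  rewrite -big_split; apply: eq_bigr => i _ /=.
  rewrite (tangent_mulf tU); [|exact: sV.2 _ (sx i)|exact: smooth_partialf].
  rewrite addrC [_ * partial c i p f]mulrC; congr (_ + _).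
  rewrite {1}(tangent_partial hc cp tU) functional_lincombE mulr_sumr.
  by apply: eq_bigr => j _; rewrite mulrCA mulrA.
rewrite (lieE _ _ sf) (H _ _ sX sY) (H _ _ sY sX).
rewrite [X in _ + X - _]exchange_big /= opprD addrACA.
have -> : \sum_j \sum_i X p (xc c j) * Y p (xc c i) * partial c j p (fun q => partial c i q f)
   = \sum_i \sum_j Y p (xc c j) * X p (xc c i) * partial c j p (fun q => partial c i q f).
  apply: eq_bigr => i _; apply: eq_bigr => j _.
  by rewrite (partial_symmetric _ _ hc cp sf) [X in X * _]mulrC.
rewrite subrr addr0 -sumrB; apply: eq_bigr => i _.
by rewrite lieE// mulrBl.
Qed.

End Fields.

(** * Connections and curvature in a frame *)

Section Trace.
Variables (R : realType) (n : nat) (N : chartedSpace R n).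
Implicit Types (V : set (functional N)) (L : functional N -> functional N).

Lemma basis_inj V k (e : 'I_k -> functional N) (a b : 'I_k -> R) : is_basis V e ->
  \sum_i a i *: e i = \sum_i b i *: e i -> a =1 b.
Proof.
move=> [eV /(_ (\sum_i a i *: e i))] + E i.
have aE : \sum_i a i *: e i = \sum_i (\row_i a i : 'rV_k) ord0 i *: e i.
  by apply: eq_bigr => j _; rewrite mxE.
rewrite {1}aE => /(_ (eV _))[c [_ cU]].
have := cU _ aE; have : c = \row_i b i.
  by apply: cU; rewrite E; apply: eq_bigr => j _; rewrite mxE.
by move=> -> /rowP/(_ i); rewrite !mxE.
Qed.

Lemma basis_lincomb V k (e : 'I_k -> functional N) (a : 'I_k -> R) : is_basis V e ->
  V (\sum_i a i *: e i).
Proof.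
move=> [/(_ (\row_i a i)) + _]; congr V; apply: eq_bigr => i _; by rewrite mxE.
Qed.

Lemma basis_coef V k (e : 'I_k -> functional N) v : is_basis V e -> V v ->
  exists a : 'I_k -> R, v = \sum_i a i *: e i.
Proof. by move=> [_ H] /H [a [-> _]]; exists (a ord0). Qed.

Lemma basis_vec V k (e : 'I_k -> functional N) i : is_basis V e -> V (e i).
Proof.
move=> eV; have := basis_lincomb (fun j => (j == i)%:R) eV.
rewrite (bigD1 i)//= eqxx scale1r big1 ?addr0// => j /negbTE ->.
by rewrite scale0r.
Qed.

Lemma sum_basis_change k l (e : 'I_k -> functional N) (P : 'M[R]_(k, l)) (a : 'I_l -> R) :
  \sum_j a j *: (\sum_i P i j *: e i) = \sum_i (\sum_j P i j * a j) *: e i.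
Proof.
under eq_bigr do rewrite scaler_sumr.
rewrite exchange_big; apply: eq_bigr => i _ /=; rewrite scaler_suml.
by apply: eq_bigr => j _; rewrite scalerA mulrC.
Qed.

Lemma basis_change V k l (e : 'I_k -> functional N) (e' : 'I_l -> functional N) :
  is_basis V e -> (forall j, V (e' j)) ->
  exists P : 'M[R]_(k, l), forall j, e' j = \sum_i P i j *: e i.
Proof.
move=> eV Ve'.
have /choice [P eP] : forall j, exists a : 'I_k -> R, e' j = \sum_i a i *: e i.
  by move=> j; exact: basis_coef eV (Ve' j).
by exists (\matrix_(i, j) P j i) => j; rewrite eP; apply: eq_bigr => i _; rewrite mxE.
Qed.

Lemma basis_changeK V k l (e : 'I_k -> functional N) (e' : 'I_l -> functional N)
    (P : 'M[R]_(k, l)) (Q : 'M[R]_(l, k)) : is_basis V e ->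
  (forall j, e' j = \sum_i P i j *: e i) -> (forall j, e j = \sum_i Q i j *: e' i) ->
  P *m Q = 1%:M.
Proof.
move=> eV eP eQ; apply/matrixP => i j; rewrite !mxE.
apply: (basis_inj (a := fun i => \sum_h P i h * Q h j) (b := fun i => (i == j)%:R) eV).
rewrite -sum_basis_change; under eq_bigr do rewrite -eP.
rewrite -eQ (bigD1 j)//= eqxx scale1r big1 ?addr0// => h /negbTE ->.
by rewrite scale0r.
Qed.

(** The basis chosen in [trace] is arbitrary, possibly of another size a priori. The rectangular
    matrices [P] and [Q] of the change of basis are inverse on both sides, and cyclicity of the
    trace gives the same value for [A] and [A']. *)
Lemma traceE V k (e : 'I_k -> functional N) L (A : 'M[R]_k) : is_basis V e ->
  (forall j, L (e j) = \sum_i A i j *: e i) ->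
  (forall a : 'I_k -> R, L (\sum_i a i *: e i) = \sum_i a i *: L (e i)) ->
  trace V L = \tr A.
Proof.
move=> eV LA Llin; rewrite /trace; case: xgetP; last first.
  by move=> /(_ (\tr A)) []; exists k, e, A.
move=> _ _ [l [e' [A' [eV' LA' ->]]]].
have [P eP] := basis_change eV (fun j => basis_vec j eV').
have [Q eQ] := basis_change eV' (fun j => basis_vec j eV).
have PQ := basis_changeK eV eP eQ; have QP := basis_changeK eV' eQ eP.
have AP : A *m P = P *m A'.
  apply/matrixP => i j; rewrite !mxE.
  apply: (@basis_inj V _ e (fun i => \sum_h A i h * P h j)
    (fun i => \sum_h P i h * A' h j) eV).
  rewrite -!sum_basis_change; under eq_bigr do rewrite -LA.
  under [RHS]eq_bigr do rewrite -eP.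
  by rewrite -LA' eP Llin.
by rewrite -[A]mulmx1 -PQ mulmxA AP -mulmxA mxtrace_mulC -mulmxA QP mulmx1.
Qed.

End Trace.

(** * Rules of calculation for connections *)

Section Curvature.
Variables (R : realType) (n : nat) (N : chartedSpace R n).
Context {hN : smooth_atlas N}.
Implicit Types (p q : N) (f : N -> R).
Implicit Types (u v w : functional N) (X Y Z : N -> functional N).
Variable nab : connection N.
Hypothesis hnab : is_connection nab.

Lemma connection_tangent p u X : is_tangent p u -> smooth_field p X ->
  is_tangent p (nab p u X).
Proof. by case: hnab => -[H _] _ _ _ _; exact: H. Qed.

Lemma connection_smooth p X Y : smooth_field p X -> smooth_field p Y ->
  smooth_field p (fun q => nab q (X q) Y).
Proof. by case: hnab => -[_ H] _ _ _ _; exact: H. Qed.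

Lemma connection_near p u X Y : is_tangent p u -> smooth_field p X ->
  near_pt p (fun q => X q = Y q) -> nab p u X = nab p u Y.
Proof.
case: hnab => _ H _ _ _ tu sX E; apply: H => //.
exact: eq_smooth_field sX.
Qed.

Lemma connection_lin p r u v X : is_tangent p u -> is_tangent p v ->
  smooth_field p X -> nab p (r *: u + v) X = r *: nab p u X + nab p v X.
Proof. by case: hnab => _ _ H _ _; exact: H. Qed.

Lemma connection0 p X : smooth_field p X -> nab p 0 X = 0.
Proof.
move=> sX; pose proof (tangent0 p) as t0.
(* At two zero vectors with coefficient [-1], linearity has a right-hand side that cancels. *)
have := connection_lin (-1) t0 t0 sX.
by rewrite scaler0 addr0 scaleN1r addNr.
Qed.

Lemma connection_suml p I (r : seq I) (a : I -> R) (F : I -> functional N) X :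
  (forall i, is_tangent p (F i)) -> smooth_field p X ->
  nab p (\sum_(i <- r) a i *: F i) X = \sum_(i <- r) a i *: nab p (F i) X.
Proof.
move=> tF sX; elim: r => [|i r IH]; first by rewrite !big_nil connection0.
rewrite !big_cons connection_lin ?IH//.
by apply: tangent_sum => j _; exact: tangentZ.
Qed.

Lemma connectionDr p u X Y : is_tangent p u -> smooth_field p X ->
  smooth_field p Y -> nab p u (fun q => X q + Y q) = nab p u X + nab p u Y.
Proof. by case: hnab => _ _ _ H _; exact: H. Qed.

Lemma connection_leibniz p u f X : is_tangent p u -> smooth_at p f ->
  smooth_field p X -> nab p u (fun q => f q *: X q) = u f *: X p + f p *: nab p u X.
Proof. by case: hnab => _ _ _ _ H; exact: H. Qed.

Lemma connection0r p u : is_tangent p u -> nab p u (fun=> 0) = 0.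
Proof.
move=> tu; pose proof (smooth_field0 p) as s0.
have E : nab p u (fun q => (0 : R) *: (0 : functional N)) = 0.
  rewrite (connection_leibniz tu (smooth_at_cst p 0) s0) scale0r addr0.
  by rewrite [LHS]scaler0.
rewrite -[RHS]E; apply: connection_near => //.
by apply: filterE => q; rewrite scaler0.
Qed.

Lemma connection_lincomb p u I (r : seq I) (z : I -> N -> R) (F : I -> N -> functional N) :
  is_tangent p u -> (forall i, smooth_at p (z i)) -> (forall i, smooth_field p (F i)) ->
  nab p u (fun q => \sum_(i <- r) z i q *: F i q) =
  \sum_(i <- r) (u (z i) *: F i p + z i p *: nab p u (F i)).
Proof.
move=> tu sz sF.
have sS (s : seq I) : smooth_field p (fun q => \sum_(i <- s) z i q *: F i q).
  by apply: smooth_field_sum => i _; exact: smooth_fieldZ.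
elim: r => [|i r IH].
  rewrite big_nil -[RHS](connection0r tu); apply: connection_near => //.
  by apply: filterE => q; rewrite big_nil.
have sZ : smooth_field p (fun q => z i q *: F i q) by exact: smooth_fieldZ.
rewrite big_cons -IH -connection_leibniz// -connectionDr//.
by apply: connection_near => //; apply: filterE => q; rewrite big_cons.
Qed.

Lemma connectionBr p u X Y : is_tangent p u -> smooth_field p X ->
  smooth_field p Y -> nab p u (fun q => X q - Y q) = nab p u X - nab p u Y.
Proof.
move=> tu sX sY.
have sY' : smooth_field p (fun q => (-1) *: Y q).
  exact: (smooth_fieldZ (smooth_at_cst p _)).
rewrite -[RHS]/(_ + - _) -scaleN1r.
rewrite (_ : -1 *: nab p u Y = nab p u (fun q => (-1) *: Y q)); last first.
  rewrite (connection_leibniz tu (smooth_at_cst p _) sY) (tangent_cst tu).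
  by rewrite scale0r add0r.
rewrite -connectionDr//; apply: connection_near => //; first exact: smooth_fieldB.
by apply: filterE => q; rewrite scaleN1r.
Qed.

(** * The curvature form of a connection in a local frame *)

Section Frame.
Variables (k m : nat) (p : N).
Variables (E : 'I_k -> N -> functional N) (x : 'I_m -> N -> R).
Variables (Gam : 'I_m -> 'I_k -> 'I_k -> N -> R).
Variables (dGam : 'I_m -> 'I_m -> 'I_k -> 'I_k -> R).
Hypothesis sE : forall i, smooth_field p (E i).
Hypothesis sx : forall a, smooth_at p (x a).
Hypothesis sGam : forall a i j, smooth_at p (Gam a i j).
Hypothesis nabE : near_pt p (fun q => forall i u, is_tangent q u ->
  nab q u (E i) = \sum_j (\sum_a u (x a) * Gam a i j q) *: E j q).
Hypothesis hdGam : forall w a i j, is_tangent p w ->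
  w (Gam a i j) = \sum_b w (x b) * dGam b a i j.

(** The connection form is a combination of the differentials of the [x a], and so are the
    differentials of its coefficients; these numbers are the resulting coefficients of the curvature
    form, with [i] the frame field acted on and [j] the component of the result. The number [m] of
    functions may be less than the rank [k]: on [TM M] they are the base coordinates. *)
Definition frame_curvature (a b : 'I_m) (i j : 'I_k) : R :=
  dGam a b i j - dGam b a i j
  + \sum_l (Gam b i l p * Gam a l j p - Gam a i l p * Gam b l j p).

Let om u i j q := \sum_a u (x a) * Gam a i j q.

(** Stated near [p] and not just at [p], because the result is differentiated again. *)
Lemma nab_frame X z : smooth_field p X -> (forall i, smooth_at p (z i)) ->
  near_pt p (fun q => nab q (X q) (fun q => \sum_i z i q *: E i q) =
    \sum_j (X q (z j) + \sum_i z i q * om (X q) i j q) *: E j q).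
Proof.
move=> sX sz.
have N1 : near_pt p (fun q => forall i, smooth_at q (z i)).
  by apply: near_forall => i; exact: smooth_at_near.
have N2 : near_pt p (fun q => forall i, smooth_field q (E i)).
  by apply: near_forall => i; exact: smooth_field_near.
have N3 : near_pt p (fun q => (forall i, smooth_at q (z i)) /\
    (forall i, smooth_field q (E i))) by apply: filterS2 N1 N2.
apply: filterS3 nabE sX.1 N3 => q nE tX [sz' sE'].
rewrite connection_lincomb// big_split /=.
under [X in _ + X]eq_bigr do rewrite (nE _ _ tX) scaler_sumr.
rewrite exchange_big -big_split; apply: eq_bigr => j _ /=.
rewrite scalerDl scaler_suml; congr (_ + _); apply: eq_bigr => i _.
by rewrite scalerA.
Qed.

Lemma om_smooth X i j : smooth_field p X -> smooth_at p (fun q => om (X q) i j q).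
Proof.
move=> sX; apply: smooth_at_sum => a _; apply: smooth_atM => //.
exact: sX.2 _ (sx a).
Qed.

(** The terms with a first derivative of [z] are gathered in the middle sum, which is symmetric in
    [X] and [Y] and so drops out of the curvature. *)
Lemma nab_nab_frame X Y z : smooth_field p X -> smooth_field p Y ->
  (forall i, smooth_at p (z i)) ->
  nab p (X p) (fun q => nab q (Y q) (fun q => \sum_i z i q *: E i q)) =
  \sum_j (X p (fun q => Y q (z j)) +
    \sum_i (X p (z i) * om (Y p) i j p + Y p (z i) * om (X p) i j p) +
    \sum_i z i p * (X p (fun q => om (Y q) i j q) +
      \sum_l om (Y p) i l p * om (X p) l j p)) *: E j p.
Proof.
move=> sX sY sz; have tX : is_tangent p (X p) by exact: smooth_field_at.
have szE : smooth_field p (fun q => \sum_i z i q *: E i q).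
  by apply: smooth_field_sum => i _; exact: smooth_fieldZ.
pose g j q := Y q (z j) + \sum_i z i q * om (Y q) i j q.
have sYz j : smooth_at p (fun q => Y q (z j)) by exact: sY.2 _ (sz j).
have szo i j : smooth_at p (fun q => z i q * om (Y q) i j q).
  by apply: smooth_atM => //; exact: om_smooth.
have sg j : smooth_at p (g j) by apply: smooth_atD => //; exact: smooth_at_sum.
rewrite (@connection_near p (X p) _ (fun q => \sum_j g j q *: E j q))//; last first.
- exact: nab_frame.
- exact: connection_smooth.
have /near_pt_self -> := nab_frame sX sg.
apply: eq_bigr => j _; congr (_ *: _).
rewrite /g (tangent_addf tX)//; last exact: smooth_at_sum.
rewrite (tangent_sumf tX)// -!addrA; congr (_ + _).
under eq_bigr => i _ do rewrite (tangent_mulf tX (sz i) (om_smooth i j sY)).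
under [X in _ + X = _]eq_bigr do rewrite mulrDl.
under [X in _ = _ + X]eq_bigr do rewrite mulrDr.
rewrite !big_split /=.
have -> : \sum_i om (Y p) i j p * X p (z i) = \sum_i X p (z i) * om (Y p) i j p.
  by apply: eq_bigr => i _; rewrite mulrC.
have -> : \sum_i (\sum_l z l p * om (Y p) l i p) * om (X p) i j p =
    \sum_i z i p * (\sum_l om (Y p) i l p * om (X p) l j p).
  under eq_bigr do rewrite mulr_suml.
  rewrite exchange_big; apply: eq_bigr => i _ /=.
  by rewrite mulr_sumr; apply: eq_bigr => l _; rewrite mulrA.
ring.
Qed.

Lemma curvature_frame X Y Z z : smooth_field p X -> smooth_field p Y ->
  smooth_field p Z -> (forall i, smooth_at p (z i)) ->
  near_pt p (fun q => Z q = \sum_i z i q *: E i q) ->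
  curvature nab X Y Z p = \sum_j (\sum_i z i p *
    (\sum_a \sum_b X p (x a) * Y p (x b) * frame_curvature a b i j)) *: E j p.
Proof.
move=> sX sY sZ sz ZE; rewrite /curvature.
have tX : is_tangent p (X p) by exact: smooth_field_at.
have tY : is_tangent p (Y p) by exact: smooth_field_at.
have tL : is_tangent p (lie X Y p) by exact: lie_tangent.
have szE : smooth_field p (fun q => \sum_i z i q *: E i q).
  by apply: smooth_field_sum => i _; exact: smooth_fieldZ.
(* The inner derivative is taken at points [q] near [p], so [Z] has to agree with its expansion near
   each such [q]. *)
have H U V : smooth_field p U -> smooth_field p V ->
    nab p (U p) (fun q => nab q (V q) Z) =
    nab p (U p) (fun q => nab q (V q) (fun q => \sum_i z i q *: E i q)).
  move=> sU sV; apply: connection_near => //.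
  - exact: smooth_field_at.
  - exact: connection_smooth.
  - apply: filterS3 (near_pt_near ZE) sV.1 (smooth_field_near sZ) => q ZE' tV sZ'.
    exact: connection_near.
rewrite !H// !nab_nab_frame// (connection_near tL sZ ZE) connection_lincomb//.
pose proof (near_pt_self nabE) as nE.
rewrite big_split /=.
under [X in _ - (_ + X)]eq_bigr do rewrite (nE _ _ tL) scaler_sumr.
rewrite [X in _ - (_ + X)]exchange_big -big_split -!sumrB /=.
apply: eq_bigr => j _.
under [X in _ - (_ + X)]eq_bigr do rewrite scalerA.
rewrite -scaler_suml -!scalerDl -!scalerBl; congr (_ *: _).
have -> : lie X Y p (z j) = X p (fun q => Y q (z j)) - Y p (fun q => X q (z j)).
  exact: lieE.
have -> : \sum_i (Y p (z i) * om (X p) i j p + X p (z i) * om (Y p) i j p) =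
  \sum_i (X p (z i) * om (Y p) i j p + Y p (z i) * om (X p) i j p).
  by apply: eq_bigr => i _; rewrite addrC.
set S1 := \sum_i (_ + _).
set S2 := \sum_i _; set S3 := \sum_i _; set S4 := \sum_i _.
transitivity (S2 - S3 - S4); first by ring.
rewrite /S2 /S3 /S4 -!sumrB; apply: eq_bigr => i _; rewrite -!mulrBr; congr (_ * _).
(* Leibniz rule for the connection form evaluated on [V]. The terms that differentiate [V q (x a)]
   cancel against the form evaluated on the bracket; the others carry [dGam]. *)
have Xo U V : smooth_field p U -> smooth_field p V ->
    U p (fun q => om (V q) i j q) = \sum_a U p (fun q => V q (x a)) * Gam a i j p +
      \sum_a \sum_b V p (x a) * U p (x b) * dGam b a i j.
  move=> sU sV; have tU : is_tangent p (U p) by exact: smooth_field_at.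
  have sVx a : smooth_at p (fun q => V q (x a)) by exact: sV.2 _ (sx a).
  rewrite (tangent_sumf tU); last by move=> a; exact: smooth_atM.
  rewrite -big_split; apply: eq_bigr => a _ /=.
  rewrite (tangent_mulf tU)// hdGam// [LHS]addrC; congr (_ + _); first exact: mulrC.
  by rewrite mulr_sumr; apply: eq_bigr => b _; rewrite mulrA.
rewrite !Xo//.
have -> : \sum_a lie X Y p (x a) * Gam a i j p =
   \sum_a X p (fun q => Y q (x a)) * Gam a i j p
   - \sum_a Y p (fun q => X q (x a)) * Gam a i j p.
  by rewrite -sumrB; apply: eq_bigr => a _; rewrite lieE// mulrBl.
have Oo U V : \sum_l om (V p) i l p * om (U p) l j p =
    \sum_a \sum_b U p (x a) * V p (x b) * \sum_l Gam b i l p * Gam a l j p.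
  under eq_bigr do rewrite /om mulr_suml.
  rewrite exchange_big /=.
  under eq_bigr => b _ do under eq_bigr => l _ do rewrite mulr_sumr.
  under eq_bigr => b _ do rewrite exchange_big /=.
  rewrite exchange_big /=; apply: eq_bigr => a _; apply: eq_bigr => b _.
  by rewrite mulr_sumr; apply: eq_bigr => l _; ring.
rewrite !Oo.
have sw (f : 'I_m -> 'I_m -> R) : \sum_a \sum_b f a b = \sum_a \sum_b f b a.
  by rewrite exchange_big.
rewrite (sw (fun a b => Y p (x a) * X p (x b) * dGam b a i j)).
rewrite [in RHS](_ : \sum_a _ =
  \sum_a \sum_b X p (x a) * Y p (x b) * dGam a b i j
  - \sum_a \sum_b X p (x a) * Y p (x b) * dGam b a i j
  + (\sum_a \sum_b X p (x a) * Y p (x b) * (\sum_l Gam b i l p * Gam a l j p)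
  - \sum_a \sum_b X p (x a) * Y p (x b) * (\sum_l Gam a i l p * Gam b l j p))).
  rewrite (sw (fun a b => Y p (x a) * X p (x b) * _)).
  have -> : \sum_a \sum_b Y p (x b) * X p (x a) * \sum_l Gam a i l p * Gam b l j p =
    \sum_a \sum_b X p (x a) * Y p (x b) * (\sum_l Gam a i l p * Gam b l j p).
    by apply: eq_bigr => a _; apply: eq_bigr => b _; ring.
  have -> : \sum_a \sum_b Y p (x b) * X p (x a) * dGam a b i j =
    \sum_a \sum_b X p (x a) * Y p (x b) * dGam a b i j.
    by apply: eq_bigr => a _; apply: eq_bigr => b _; ring.
  ring.
rewrite -!sumrB -big_split; apply: eq_bigr => a _ /=.
rewrite -!sumrB -big_split; apply: eq_bigr => b _ /=.
by rewrite /frame_curvature sumrB; ring.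
Qed.

Variable th : 'I_k -> N -> functional N -> R.
Hypothesis hth : near_pt p (fun q => forall w, is_tangent q w ->
  w = \sum_i th i q w *: E i q).
Hypothesis sth : forall i Z, smooth_field p Z -> smooth_at p (fun q => th i q (Z q)).

Let B v w a j := \sum_i \sum_b th i p w * v (x b) * frame_curvature a b i j.

(** Only the values of the three fields at [p] survive in the frame formula, so the extensions
    chosen by [curv] do not influence the result. *)
Lemma curv_frame u v w : is_tangent p u -> is_tangent p v -> is_tangent p w ->
  curv nab p u v w = \sum_j (\sum_a u (x a) * B v w a j) *: E j p.
Proof.
move=> tu tv tw; rewrite /curv.
have [sX Xp] : smooth_field p (extension p u) /\ extension p u p = u.
  exact: extensionP.
have [sY Yp] : smooth_field p (extension p v) /\ extension p v p = v.
  exact: extensionP.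
have [sZ Zp] : smooth_field p (extension p w) /\ extension p w p = w.
  exact: extensionP.
rewrite (curvature_frame sX sY sZ (fun i => sth i sZ)); last first.
  by apply: filterS2 sZ.1 hth => q tZ; apply.
apply: eq_bigr => j _; rewrite Xp Yp Zp; congr (_ *: _).
under [RHS]eq_bigr do rewrite mulr_sumr.
rewrite [RHS]exchange_big; apply: eq_bigr => i _ /=.
rewrite mulr_sumr; apply: eq_bigr => a _.
by rewrite !mulr_sumr; apply: eq_bigr => b _; ring.
Qed.

Lemma Ric_frame w' w : is_basis (is_tangent p) (fun i => E i p) ->
  is_tangent p w' -> is_tangent p w ->
  Ric nab p w' w = \sum_j \sum_a E j p (x a) *
    \sum_i \sum_b th i p w' * w (x b) * frame_curvature a b i j.
Proof.
move=> eB tw' tw; rewrite /Ric.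
have tE i : is_tangent p (E i p) by exact: basis_vec i eB.
pose A := \matrix_(i, j) \sum_a E j p (x a) * B w w' a i.
rewrite (traceE (A := A) eB).
- by apply: eq_bigr => j _; rewrite mxE.
- by move=> j; rewrite curv_frame//; apply: eq_bigr => i _; rewrite mxE.
(* Linearity in the first argument is read off from the explicit formula. *)
- move=> c; rewrite curv_frame//; last first.
    by apply: tangent_sum => i _; exact: tangentZ.
  under [RHS]eq_bigr do rewrite curv_frame// scaler_sumr.
  rewrite [RHS]exchange_big; apply: eq_bigr => j _ /=.
  under [RHS]eq_bigr do rewrite scalerA.
  rewrite -scaler_suml; congr (_ *: _).
  under eq_bigr do rewrite functional_lincombE mulr_suml.
  rewrite exchange_big; apply: eq_bigr => i _ /=.
  by rewrite mulr_sumr; apply: eq_bigr => a _; rewrite mulrA.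
Qed.

End Frame.

End Curvature.

(** * The Ricci tensor of a Levi-Civita connection *)

Lemma unitmx_lker0 (F : fieldType) n (S : 'M[F]_n) :
  (forall v : 'rV_n, v *m S = 0 -> v = 0) -> S \in unitmx.
Proof.
move=> H; rewrite -row_free_unit -kermx_eq0; apply/eqP/row_matrixP => i.
by rewrite row0; apply: H; apply/sub_kermxP; exact: row_sub.
Qed.

(** The left-hand sides of the hypothesis are the second derivatives of a Gram
    matrix [S] whose first derivatives are [G S + S G^T]. *)
Lemma skew_of_compat (F : realFieldType) n (S Ga Gb dab dba : 'M[F]_n) :
  dba *m S + Ga *m (Gb *m S + S *m Gb^T)
    + (S *m dba^T + (Gb *m S + S *m Gb^T) *m Ga^T) =
  dab *m S + Gb *m (Ga *m S + S *m Ga^T)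
    + (S *m dab^T + (Ga *m S + S *m Ga^T) *m Gb^T) ->
  (dab - dba + (Gb *m Ga - Ga *m Gb)) *m S =
  - (S *m (dab - dba + (Gb *m Ga - Ga *m Gb))^T).
Proof.
have -> : (dab - dba + (Gb *m Ga - Ga *m Gb))^T =
    dab^T - dba^T + (Ga^T *m Gb^T - Gb^T *m Ga^T).
  by rewrite -!trmx_mul; apply/matrixP => i j; rewrite !mxE.
rewrite !(mulmxDl, mulmxDr, mulNmx, mulmxN, mulmxA) => E.
apply/matrixP => i j; move/matrixP/(_ i j): E.
have addE (A B : 'M[F]_n) : (A + B) i j = A i j + B i j by rewrite mxE.
have oppE (A : 'M[F]_n) : (- A) i j = - A i j by rewrite mxE.
rewrite !(addE, oppE) => E; lra.
Qed.

Section TensorSums.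
Variables (R : realType) (n : nat) (N : chartedSpace R n).
Context {hN : smooth_atlas N}.
Variables (s : tensor2 N) (p : N).
Hypothesis s_tensor : is_tensor2 s.
Implicit Types (u v w : functional N).

Lemma tensor0l w : is_tangent p w -> s p 0 w = 0.
Proof.
move=> tw; pose proof (tangent0 p) as t0; case: s_tensor => H _ _.
by have := H p (-1) 0 0 w t0 t0 tw; rewrite scaler0 addr0 mulN1r addNr.
Qed.

Lemma tensor0r w : is_tangent p w -> s p w 0 = 0.
Proof.
move=> tw; pose proof (tangent0 p) as t0; case: s_tensor => _ H _.
by have := H p (-1) 0 0 w t0 t0 tw; rewrite scaler0 addr0 mulN1r addNr.
Qed.

Lemma tensor_suml I (r : seq I) (a : I -> R) (F : I -> functional N) w :
  (forall i, is_tangent p (F i)) -> is_tangent p w ->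
  s p (\sum_(i <- r) a i *: F i) w = \sum_(i <- r) a i * s p (F i) w.
Proof.
move=> tF tw; elim: r => [|i r IH]; first by rewrite !big_nil tensor0l.
case: s_tensor => H _ _; rewrite !big_cons H ?IH//.
by apply: tangent_sum => j _; exact: tangentZ.
Qed.

Lemma tensor_sumr I (r : seq I) (a : I -> R) (F : I -> functional N) w :
  (forall i, is_tangent p (F i)) -> is_tangent p w ->
  s p w (\sum_(i <- r) a i *: F i) = \sum_(i <- r) a i * s p w (F i).
Proof.
move=> tF tw; elim: r => [|i r IH]; first by rewrite !big_nil tensor0r.
case: s_tensor => _ H _; rewrite !big_cons H ?IH//.
by apply: tangent_sum => j _; exact: tangentZ.
Qed.

End TensorSums.

(** * Christoffel symbols and identities of the Riemann tensor *)

Section Christoffel.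
Variables (R : realType) (n : nat) (N : chartedSpace R n).
Context {hN : smooth_atlas N}.
Implicit Types (p q : N) (f : N -> R).
Implicit Types (u v w : functional N) (X Y Z : N -> functional N).
Variables (s : tensor2 N) (nab : connection N).
Hypothesis s_metric : is_metric s.
Hypothesis nab_lc : is_levi_civita s nab.
Variable c : chart R n N.
Hypothesis hc : atlas c.

Let hnab : is_connection nab. Proof. by case: nab_lc. Qed.

(** The derivative is a functional, so its component [j] is its value on the coordinate function
    [xc c j]; [a] is the direction and [i] the differentiated field. *)
Definition christoffel (a i j : 'I_n) : N -> R :=
  fun q => nab q (partial c a q) (partial c i) (xc c j).

Definition dchristoffel q (b a i j : 'I_n) : R := partial c b q (christoffel a i j).

(** [riemann q a b i j] is the component along [partial c j] of the curvature operator of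
    [partial c a] and [partial c b], applied to [partial c i]. *)
Definition riemann q := frame_curvature q christoffel (dchristoffel q).

Section At.
Variable p : N.
Hypothesis cp : dom c p.

Lemma christoffel_smooth a i j : smooth_at p (christoffel a i j).
Proof.
have sa : smooth_field p (partial c a) by exact: smooth_partial.
have si : smooth_field p (partial c i) by exact: smooth_partial.
by apply: (connection_smooth hnab sa si).2; exact: smooth_xc.
Qed.

Lemma nab_partial u i : is_tangent p u ->
  nab p u (partial c i) = \sum_j (\sum_a u (xc c a) * christoffel a i j p) *: partial c j p.
Proof.
move=> tu; have si : smooth_field p (partial c i) by exact: smooth_partial.
have ta a : is_tangent p (partial c a p) by exact: partial_tangent.
rewrite {1}(tangent_partial hc cp tu) connection_suml//.
under eq_bigr => a _.
  rewrite (tangent_partial hc cp (connection_tangent hnab (ta a) si)) scaler_sumr.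
  over.
rewrite exchange_big; apply: eq_bigr => j _ /=; rewrite scaler_suml.
by apply: eq_bigr => a _; rewrite scalerA.
Qed.

Lemma partial_basis : is_basis (is_tangent p) (fun i => partial c i p).
Proof.
split=> [a|v tv].
  by apply: tangent_sum => i _; apply: tangentZ; exact: partial_tangent.
exists (\row_i v (xc c i)); split.
  rewrite {1}(tangent_partial hc cp tv); apply: eq_bigr => i _; by rewrite mxE.
move=> a ->; apply/rowP => i; rewrite mxE functional_lincombE (bigD1 i)//=.
rewrite partial_xc// eqxx mulr1 big1 ?addr0// => j /negbTE ji.
by rewrite partial_xc// ji mulr0.
Qed.

Lemma dchristoffelE w a i j : is_tangent p w ->
  w (christoffel a i j) = \sum_b w (xc c b) * dchristoffel p b a i j.
Proof. by move=> tw; rewrite {1}(tangent_partial hc cp tw) functional_lincombE. Qed.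

End At.

Lemma Ric_riemann p w' w : dom c p -> is_tangent p w' -> is_tangent p w ->
  Ric nab p w' w =
  \sum_i \sum_b w' (xc c i) * w (xc c b) * \sum_j riemann p j b i j.
Proof.
move=> cp tw' tw.
have sE i : smooth_field p (partial c i) by exact: smooth_partial.
have sx i : smooth_at p (xc c i) by exact: smooth_xc.
have sG a i j : smooth_at p (christoffel a i j) by exact: christoffel_smooth.
have nE : near_pt p (fun q => forall i u, is_tangent q u -> nab q u (partial c i) =
    \sum_j (\sum_a u (xc c a) * christoffel a i j q) *: partial c j q).
  by apply: (filterS _ (near_pt_dom hc cp)) => q cq i u; exact: nab_partial.
have hth : near_pt p (fun q => forall w, is_tangent q w ->
    w = \sum_i w (xc c i) *: partial c i q).
  by apply: (filterS _ (near_pt_dom hc cp)) => q cq v; exact: tangent_partial.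
have sth i Z : smooth_field p Z -> smooth_at p (fun q => Z q (xc c i)).
  by move=> sZ; exact: sZ.2 _ (sx i).
rewrite (Ric_frame hnab sE sx sG nE (fun w a i j => dchristoffelE cp a i j)
  (th := fun i q w => w (xc c i)) hth sth (partial_basis cp) tw' tw).
transitivity (\sum_j \sum_i \sum_b w' (xc c i) * w (xc c b) * riemann p j b i j).
  apply: eq_bigr => j _; rewrite (bigD1 j)//= partial_xc// eqxx mul1r.
  rewrite [X in _ + X]big1 ?addr0// => i /negbTE ij.
  by rewrite partial_xc// eq_sym ij mul0r.
rewrite exchange_big; apply: eq_bigr => i _; rewrite exchange_big.
by apply: eq_bigr => b _; rewrite mulr_sumr.
Qed.

(** Torsion vanishes and coordinate fields commute, as their values on the coordinate functions are
    constant. *)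
Lemma christoffel_sym p a i j : dom c p -> christoffel a i j p = christoffel i a j p.
Proof.
move=> cp; case: nab_lc => _ /(_ p (partial c a) (partial c i)) + _.
have sa : smooth_field p (partial c a) by exact: smooth_partial.
have si : smooth_field p (partial c i) by exact: smooth_partial.
move=> /(_ sa si) /(congr1 (fun v => v (xc c j))) E; apply/eqP.
rewrite -subr_eq0; apply/eqP; apply: (etrans E).
rewrite lieE; last exact: smooth_xc.
have Z k l : partial c k p (fun q => partial c l q (xc c j)) = 0.
  have tk : is_tangent p (partial c k p) by exact: partial_tangent.
  rewrite -[RHS](tangent_cst tk (l == j)%:R); apply: (tangent_eq tk).
  by apply: filterS (near_pt_dom hc cp) => q cq; rewrite partial_xc.
by rewrite !Z subrr.
Qed.

Lemma dchristoffel_sym p b a i j : dom c p ->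
  dchristoffel p b a i j = dchristoffel p b i a j.
Proof.
move=> cp; apply: (tangent_eq (partial_tangent b hc cp)).
by apply: filterS (near_pt_dom hc cp) => q cq; exact: christoffel_sym.
Qed.

Lemma riemann_bianchi p a b i j : dom c p ->
  riemann p a b i j + riemann p b i a j + riemann p i a b j = 0.
Proof.
move=> cp; rewrite /riemann /frame_curvature !sumrB.
rewrite (dchristoffel_sym a i b)// (dchristoffel_sym b a i)// (dchristoffel_sym i a b)//.
have S k l h : \sum_t christoffel k l t p * christoffel h t j p =
               \sum_t christoffel l k t p * christoffel h t j p.
  by apply: eq_bigr => t _; rewrite christoffel_sym.
rewrite (S i b) (S a i) (S b a); ring.
Qed.

Definition gram q : 'M[R]_n := \matrix_(i, j) s q (partial c i q) (partial c j q).

Let s_tensor : is_tensor2 s. Proof. by case: s_metric. Qed.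

Lemma nab_partial2 p a i : dom c p ->
  nab p (partial c a p) (partial c i) = \sum_j christoffel a i j p *: partial c j p.
Proof.
move=> cp; apply: tangent_partial => //; apply: connection_tangent => //.
  exact: partial_tangent.
exact: smooth_partial.
Qed.

Lemma gram_smooth p i j : dom c p -> smooth_at p (fun q => gram q i j).
Proof.
move=> cp; have si : smooth_field p (partial c i) by exact: smooth_partial.
have sj : smooth_field p (partial c j) by exact: smooth_partial.
apply: eq_smooth_at (_ : smooth_at p (fun q => s q (partial c i q) (partial c j q))).
  by apply: filterE => q; rewrite mxE.
by case: s_tensor => _ _; exact.
Qed.

Lemma metric_compat p a i j : dom c p ->
  partial c a p (fun q => gram q i j) =
  \sum_k christoffel a i k p * gram p k j + \sum_k christoffel a j k p * gram p i k.
Proof.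
move=> cp; have si : smooth_field p (partial c i) by exact: smooth_partial.
have sj : smooth_field p (partial c j) by exact: smooth_partial.
have tp k : is_tangent p (partial c k p) by exact: partial_tangent.
case: nab_lc => _ _ /(_ p _ (partial c i) (partial c j) (tp a) si sj).
rewrite !nab_partial2// tensor_suml// tensor_sumr// => E.
rewrite (tangent_eq (tp a) (g := fun q => s q (partial c i q) (partial c j q))).
  by rewrite E; congr (_ + _); apply: eq_bigr => k _; rewrite mxE.
by apply: filterE => q; rewrite mxE.
Qed.

Lemma gram_unit p : dom c p -> gram p \in unitmx.
Proof.
move=> cp; apply: unitmx_lker0 => v vS; apply/rowP => i; rewrite mxE.
have tp k : is_tangent p (partial c k p) by exact: partial_tangent.
have tv : is_tangent p (\sum_k v ord0 k *: partial c k p).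
  by apply: tangent_sum => k _; exact: tangentZ.
have E : \sum_k v ord0 k *: partial c k p = \sum_k (fun=> 0) k *: partial c k p.
  rewrite [RHS]big1 => [|k _]; last by rewrite scale0r.
  case: s_metric => _ _ /(_ p _ tv) H; apply: H => w tw.
  rewrite (tangent_partial hc cp tw).
  rewrite tensor_sumr// big1// => j _; rewrite tensor_suml//.
  move/rowP/(_ j): vS; rewrite !mxE; under eq_bigr do rewrite mxE.
  by move=> ->; rewrite mulr0.
exact: (basis_inj (partial_basis cp) E).
Qed.

(** Commuting second derivatives of the Gram matrix [S] give [K S = - S K^T] for the matrix [K] of a
    curvature operator. As [S] is invertible, [K] is conjugate to [- K^T], so its trace equals its
    own opposite. *)
Lemma riemann_trace p a b : dom c p -> \sum_i riemann p a b i i = 0.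
Proof.
move=> cp.
pose G e := \matrix_(i, j) christoffel e i j p.
pose dG d e := \matrix_(i, j) dchristoffel p d e i j.
pose S := gram p; pose dS e := G e *m S + S *m (G e)^T.
have dSE e i j : partial c e p (fun q => gram q i j) = dS e i j.
  rewrite metric_compat// !mxE; congr (_ + _); apply: eq_bigr => k _; rewrite !mxE//.
  by rewrite mulrC.
(* Metric compatibility differentiated once more, in the matrix form expected by
   [skew_of_compat]. *)
have ddS d e i j : partial c d p (fun q => partial c e q (fun q => gram q i j)) =
    (dG d e *m S + G e *m dS d + (S *m (dG d e)^T + dS d *m (G e)^T)) i j.
  have td : is_tangent p (partial c d p) by exact: partial_tangent.
  rewrite (tangent_eq td (g := fun q => \sum_k christoffel e i k q * gram q k j +
    \sum_k christoffel e j k q * gram q i k)); last first.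
    by apply: (filterS _ (near_pt_dom hc cp)) => q cq; exact: metric_compat.
  have sG k l t : smooth_at p (christoffel k l t) by exact: christoffel_smooth.
  have sS k l : smooth_at p (fun q => gram q k l) by exact: gram_smooth.
  have sM k l t i1 j1 : smooth_at p (fun q => christoffel k l t q * gram q i1 j1).
    exact: smooth_atM.
  rewrite (tangent_addf td); [|exact: smooth_at_sum|exact: smooth_at_sum].
  rewrite !(tangent_sumf td)//.
  have T1 : \sum_k partial c d p (fun q => christoffel e i k q * gram q k j) =
      (G e *m dS d) i j + (dG d e *m S) i j.
    rewrite [X in X + _]mxE [X in _ + X]mxE -big_split; apply: eq_bigr => k _.
    rewrite (tangent_mulf td (sG e i k) (sS k j)) dSE [G e i k]mxE [dG d e i k]mxE.
    by rewrite [X in _ + X = _]mulrC.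
  have T2 : \sum_k partial c d p (fun q => christoffel e j k q * gram q i k) =
      (dS d *m (G e)^T) i j + (S *m (dG d e)^T) i j.
    rewrite [X in X + _]mxE [X in _ + X]mxE -big_split; apply: eq_bigr => k _.
    rewrite (tangent_mulf td (sG e j k) (sS i k)) dSE [(G e)^T k j]mxE [G e j k]mxE.
    rewrite [(dG d e)^T k j]mxE [dG d e j k]mxE.
    by rewrite [X in X + _ = _]mulrC.
  have addE (A B : 'M[R]_n) : (A + B) i j = A i j + B i j by rewrite mxE.
  rewrite T1 T2 !addE; ring.
pose K := \matrix_(i, j) riemann p a b i j.
have KE : K = dG a b - dG b a + (G b *m G a - G a *m G b).
  apply/matrixP => i j; rewrite !mxE /riemann /frame_curvature sumrB.
  by congr (_ + (_ - _)); apply: eq_bigr => l _; rewrite !mxE.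
have KS : K *m S = - (S *m K^T).
  rewrite KE; apply: skew_of_compat; rewrite -/(dS a) -/(dS b).
  by apply/matrixP => i j; rewrite -!ddS partial_symmetric//; exact: gram_smooth.
have Su : S \in unitmx by exact: gram_unit.
have : \tr K = - \tr K.
  rewrite -{1}[K](mulmxK Su) KS mulNmx linearN /= mxtrace_mulC mulmxA.
  by rewrite mulVmx// mul1mx mxtrace_tr.
rewrite [\tr K](_ : _ = \sum_i riemann p a b i i); last first.
  by apply: eq_bigr => i _; rewrite mxE.
lra.
Qed.

(** Contract the Bianchi identity over the output index: the third term is the trace of a curvature
    operator. *)
Lemma ricci_sym p b i : dom c p ->
  \sum_j riemann p j b i j = \sum_j riemann p j i b j.
Proof.
move=> cp; transitivity (\sum_j riemann p j i b j - \sum_j riemann p b i j j).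
  rewrite -sumrB; apply: eq_bigr => j _.
  have := riemann_bianchi j b i j cp.
  have -> : riemann p i j b j = - riemann p j i b j.
    rewrite /riemann /frame_curvature !sumrB; ring.
  lra.
by rewrite (riemann_trace b i cp) subr0.
Qed.

Lemma Ric_sym p w' w : dom c p -> is_tangent p w' -> is_tangent p w ->
  Ric nab p w' w = Ric nab p w w'.
Proof.
move=> cp tw' tw; rewrite !Ric_riemann// [LHS]exchange_big /=.
apply: eq_bigr => i _; apply: eq_bigr => b _.
by rewrite ricci_sym// [X in X * _]mulrC.
Qed.

End Christoffel.

(** * The tangent bundle *)

Section Lsubmx.
Variables (R : realType) (m k : nat).
Implicit Types (X a : 'rV[R]_(m + k)) (g : 'rV[R]_m -> R).

Lemma lsubmx_row X : lsubmx X = \row_i X ord0 (lshift k i).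
Proof. by apply/rowP => i; rewrite !mxE. Qed.

Lemma smooth_pt_lsubmx g X : smooth_pt g (lsubmx X) ->
  smooth_pt (fun Y => g (lsubmx Y)) X.
Proof.
rewrite lsubmx_row => sg.
apply: (@eq_smooth_pt _ _ (fun Y => g (\row_i Y ord0 (lshift k i)))).
  by apply: (@filterE _ (nbhs X)) => Y; rewrite lsubmx_row.
by apply: smooth_pt_comp => // i; exact: smooth_pt_coord.
Qed.

Lemma dd_lsubmx g X a : differentiable g (lsubmx X) ->
  dd (fun Y => g (lsubmx Y)) X a = dd g (lsubmx X) (lsubmx a).
Proof.
move=> dg; pose F (i : 'I_m) (Y : 'rV[R]_(m + k)) := Y ord0 (lshift k i).
have [dF dFa] := @differentiable_row _ _ _ F X (fun i =>
  smooth_pt_differentiable (smooth_pt_coord (lshift k i) X)).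
have E : (fun Y => g (lsubmx Y)) = fun Y => g (\row_i F i Y).
  by apply/funext => Y; rewrite lsubmx_row.
rewrite E (dd_comp a dF) -?lsubmx_row// dFa diff_dd; congr (dd _ _ _).
apply/rowP => i; rewrite [RHS]mxE mxE diff_dd; exact: dd_coord.
Qed.

End Lsubmx.

(** * Charts of the tangent bundle *)

Section TMAtlas.
Variables (R : realType) (m : nat) (M : chartedSpace R m).
Context {hM : smooth_atlas M}.
Implicit Types (c : chart R m M) (z : TM M).

Lemma tangentVector_ext (z z' : tangentVector M) :
  foot z = foot z' -> vec z = vec z' -> z = z'.
Proof.
case: z z' => [p v vP] [p' v' vP'] /= E E'; subst p' v'.
by congr TangentVector; exact: Prop_irrelevance.
Qed.

Definition tvec c p a (hc : atlas c) (cp : dom c p) : TM M :=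
  TangentVector (tanvec_tangent a hc cp).

Lemma coord_foot c z : lsubmx (coord (tangent_chart c) z) = coord c (foot z).
Proof. by rewrite /= row_mxKl. Qed.

Lemma coord_vec c z i : coord (tangent_chart c) z ord0 (rshift m i) = vec z (xc c i).
Proof. by rewrite /= row_mxEr mxE. Qed.

Lemma near_lsubmx c z (P : set 'rV[R]_m) :
  (\forall x \near coord c (foot z), P x) ->
  \forall X \near coord (tangent_chart c) z, P (lsubmx X).
Proof.
move=> H; have := @continuous_lsubmx R 1 m m (coord (tangent_chart c) z) P.
by apply; rewrite coord_foot.
Qed.

Lemma tangent_chart_inj c z z' : atlas c -> dom c (foot z) -> dom c (foot z') ->
  coord (tangent_chart c) z = coord (tangent_chart c) z' -> z = z'.
Proof.
move=> hc cz cz' E.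
have Ef : foot z = foot z' by apply: (chart_inj hc) => //; rewrite -!coord_foot E.
apply: tangentVector_ext => //.
rewrite (tangent_partial hc cz (vecP z)).
rewrite (tangent_partial hc cz' (vecP z')) -Ef; apply: eq_bigr => i _.
by rewrite -!coord_vec E.
Qed.

Lemma tangent_chart_image c z : atlas c -> dom c (foot z) ->
  \forall X \near coord (tangent_chart c) z, exists z',
    [/\ dom c (foot z'), coord (tangent_chart c) z' = X &
        foot z' = cinv c (foot z) (lsubmx X)].
Proof.
move=> hc cz; pose proof (near_lsubmx (near_image hc cz)) as K.
(* The fibre direction is unconstrained: over a base point in the chart, any [rsubmx X] is the row
   of components of a tangent vector. *)
apply: filterS K => X [cX EX]; exists (tvec (rsubmx X) hc cX); split=> //.
rewrite -[RHS]hsubmxK /=; congr row_mx => //.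
by apply/rowP => i; rewrite !mxE -[LHS]/(tanvec _ _ _ (xc c i)) tanvec_xc// mxE.
Qed.

(** Declared as an instance below, so that the whole theory of charted spaces applies to the total
    space. *)
Lemma TM_smooth_atlas : smooth_atlas (TM M).
Proof.
split.
- move=> z; have [c hc cz] : exists2 c, atlas c & dom c (foot z) by exact: chart_around.
  by exists (tangent_chart c) => //; exists c.
- move=> _ [c hc <-]; split=> [z z'|z cz].
    by rewrite !inE => cz cz'; exact: tangent_chart_inj.
  split=> //; pose proof (tangent_chart_image hc cz) as K.
  by apply: filterS K => X [z' [cz' E _]]; exists z'; split.
- move=> _ _ z [c hc <-] [c' hc' <-] cz cz' I /=.
  pose proof (near_lsubmx (trans_near hc hc' cz cz')) as nc.
  pose proof (tangent_chart_image hc cz) as ni.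
  case: (splitP I) => i EI.
    have {EI} -> : I = lshift m i by exact: val_inj.
    exists (fun X => coord c' (cinv c (foot z) (lsubmx X)) ord0 i).
      apply: (@smooth_pt_lsubmx _ _ _ (fun x => coord c' (cinv c (foot z) x) ord0 i)).
      rewrite coord_foot; exact: trans_smooth.
    split=> //; apply: filterS2 nc ni => X c'X [z' [cz1 E F]].
    by exists z'; split=> //; split; rewrite /= ?F// row_mxEl row_mxKl -F cinvK.
  have {EI} -> : I = rshift m i by exact: val_inj.
  (* Fibre coordinates transform linearly, by the Jacobian of the change of charts at the base
     point. *)
  exists (fun X : 'rV[R]_(m + m) => \sum_j X ord0 (rshift m j) *
      dd (rep c (foot z) (xc c' i)) (lsubmx X) (delta_mx ord0 j)).
    apply: smooth_pt_sum => j _; apply: smooth_ptM; first exact: smooth_pt_coord.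
    apply: (@smooth_pt_lsubmx _ _ _ (fun x => dd _ x (delta_mx ord0 j))).
    rewrite coord_foot; apply: smooth_pt_diff; apply/smooth_atE => //.
    exact: smooth_xc.
  split=> //; apply: filterS2 nc ni => X c'X [z' [cz1 E F]].
  have c'z' : dom c' (foot z') by rewrite F.
  exists z'; split=> //; split=> //.
  rewrite row_mxEr mxE -[LHS]/(vec z' (xc c' i)).
  rewrite {1}(tangent_partial hc cz1 (vecP z')) functional_lincombE.
  apply: eq_bigr => j _; rewrite row_mxEr mxE; congr (_ * _).
  rewrite row_mxKl /partial tanvecE; last exact: smooth_xc.
  apply: near_dd; first exact: rep_base.
  apply: smooth_pt_differentiable.
  apply: (eq_smooth_pt (f := rep c (foot z') (xc c' i))).
    by apply: filterS (rep_base (xc c' i) hc cz cz1) => x ->.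
  by apply/smooth_atE => //; exact: smooth_xc.
Qed.

End TMAtlas.

#[global] Existing Instance TM_smooth_atlas.

(** * Vertical vectors and the tangent structure in coordinates *)

Section Lift.
Variables (R : realType) (m : nat) (M : chartedSpace R m).
Context {hM : smooth_atlas M}.
Implicit Types (p : M) (z : TM M) (f : M -> R).
Implicit Types (u v w : functional (TM M)).
Variable c : chart R m M.
Hypothesis hc : atlas c.

Notation C := (tangent_chart c : chart R (m + m) (TM M)).

Lemma atlas_tangent_chart : atlas C. Proof. by exists c. Qed.
Hint Resolve atlas_tangent_chart : core.

Lemma foot_cinv z : dom c (foot z) -> \forall X \near coord C z,
  foot (cinv C z X) = cinv c (foot z) (lsubmx X).
Proof.
move=> cz; pose proof (tangent_chart_image hc cz) as K.
by apply: filterS K => X [z' [cz' <- <-]]; rewrite cinvK.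
Qed.

Lemma near_foot z (P : set M) : near_pt (foot z) P -> near_pt z (fun y => P (foot y)).
Proof.
have [d hd dz] : exists2 d, atlas d & dom d (foot z) by exact: chart_around.
move=> /(near_ptE _ hd dz) H.
pose D : chart R (m + m) (TM M) := tangent_chart d.
have hD : atlas D by exists d.
have dZ : dom D z by [].
apply/(near_ptE _ hD dZ); pose proof (tangent_chart_image hd dz) as K.
pose proof (near_lsubmx H) as H'.
apply: filterS2 H' K => X PX [z' [dz' EX E]].
by rewrite -EX (cinvK z hD (dz' : dom D z')) E.
Qed.

Lemma near_dom_foot z : dom c (foot z) -> near_pt z (fun y => dom c (foot y)).
Proof. by move=> cz; apply: near_foot; exact: near_pt_dom. Qed.

Lemma rep_foot z f : dom c (foot z) ->
  \forall X \near coord C z, rep c (foot z) f (lsubmx X) = rep C z (f \o @foot R m M) X.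
Proof.
by move=> cz; apply: filterS (foot_cinv cz) => X E; rewrite /rep /= E.
Qed.

Lemma smooth_foot z f : dom c (foot z) -> smooth_at (foot z) f -> smooth_at z (f \o @foot R m M).
Proof.
move=> cz /(smooth_atE _ hc cz) sf; apply/(smooth_atE _ atlas_tangent_chart) => //.
apply: (eq_smooth_pt (rep_foot f cz)); apply: smooth_pt_lsubmx.
by rewrite coord_foot.
Qed.

(** Base coordinates as functions on the total space: a tangent vector is vertical exactly when it
    kills all of them. *)
Definition xl i : TM M -> R := xc c i \o @foot R m M.

Lemma xc_lshift i : xc C (lshift m i) = xl i.
Proof. by apply/funext => z; rewrite /xc /= row_mxEl. Qed.

Lemma smooth_xl z i : dom c (foot z) -> smooth_at z (xl i).
Proof. by move=> cz; apply: smooth_foot => //; exact: smooth_xc. Qed.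

Lemma dd_rep_foot z f a : dom c (foot z) -> smooth_at (foot z) f ->
  tanvec C z a (f \o @foot R m M) = dd (rep c (foot z) f) (coord c (foot z)) (lsubmx a).
Proof.
move=> cz sf; rewrite tanvecE; last exact: smooth_foot.
have df : differentiable (rep c (foot z) f) (lsubmx (coord C z)).
  by rewrite coord_foot; apply: smooth_pt_differentiable; apply/smooth_atE.
rewrite -(coord_foot c z) -(dd_lsubmx a df).
apply: near_dd (rep_foot f cz) _.
apply: smooth_pt_differentiable; apply: smooth_pt_lsubmx.
by rewrite coord_foot; apply/smooth_atE.
Qed.

Lemma partial_lshift_foot z f i : dom c (foot z) -> smooth_at (foot z) f ->
  partial C (lshift m i) z (f \o @foot R m M) = partial c i (foot z) f.
Proof.
move=> cz sf; rewrite /partial dd_rep_foot// tanvecE//; congr (dd _ _ _).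
by apply/rowP => j; rewrite !mxE eq_lshift.
Qed.

Lemma partial_rshift_foot z f i : dom c (foot z) -> smooth_at (foot z) f ->
  partial C (rshift m i) z (f \o @foot R m M) = 0.
Proof.
move=> cz sf; rewrite /partial dd_rep_foot//.
rewrite (_ : lsubmx _ = 0).
  by rewrite -(scale0r (0 : 'rV[R]_m)) ddZr mul0r.
by apply/rowP => j; rewrite !mxE eq_lrshift andbF.
Qed.

(** The field of the [i]-th fibre coordinate, which is the vertical lift of [partial c i]. *)
Definition vpartial i : TM M -> functional (TM M) := partial C (rshift m i).

Lemma vpartial_xl i j z : dom c (foot z) -> vpartial i z (xl j) = 0.
Proof. by move=> cz; apply: partial_rshift_foot => //; exact: smooth_xc. Qed.

Lemma vpartial_xv i j z : dom c (foot z) ->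
  vpartial i z (xc C (rshift m j)) = (i == j)%:R.
Proof. by move=> cz; rewrite /vpartial partial_xc// eq_rshift. Qed.

Lemma vpartial_tangent i z : dom c (foot z) -> is_tangent z (vpartial i z).
Proof. by move=> cz; exact: partial_tangent. Qed.

Lemma smooth_vpartial i z : dom c (foot z) -> smooth_field z (vpartial i).
Proof. by move=> cz; exact: smooth_partial. Qed.

Lemma TM_tangent_partial z w : dom c (foot z) -> is_tangent z w ->
  w = \sum_i w (xl i) *: partial C (lshift m i) z
    + \sum_i w (xc C (rshift m i)) *: vpartial i z.
Proof.
move=> cz tw; rewrite {1}(tangent_partial atlas_tangent_chart _ tw)//.
rewrite big_split_ord; congr (_ + _).
by apply: eq_bigr => i _; rewrite xc_lshift.
Qed.

Lemma tangent_foot z w f : dom c (foot z) -> is_tangent z w -> smooth_at (foot z) f ->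
  w (f \o @foot R m M) = \sum_i w (xl i) * partial c i (foot z) f.
Proof.
move=> cz tw sf; rewrite {1}(TM_tangent_partial cz tw) functionalD !functional_lincombE.
rewrite [X in _ + X]big1 ?addr0 => [|i _]; last first.
  by rewrite /vpartial partial_rshift_foot// mulr0.
by apply: eq_bigr => i _; rewrite partial_lshift_foot.
Qed.

Lemma proj_pushE z w f : smooth_at (foot z) f -> proj_push z w f = w (f \o @foot R m M).
Proof. by move=> sf; rewrite /proj_push; case: asboolP. Qed.

Lemma proj_push_partial z w : dom c (foot z) -> is_tangent z w ->
  proj_push z w = \sum_i w (xl i) *: partial c i (foot z).
Proof.
move=> cz tw; apply/funext => f; rewrite functional_lincombE.
have [sf|nf] := pselect (smooth_at (foot z) f).
  by rewrite proj_pushE//; exact: tangent_foot.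
rewrite /proj_push; case: asboolP => // _; rewrite big1// => i _.
by rewrite (tangent_nsmooth (partial_tangent i hc cz) nf) mulr0.
Qed.

Lemma proj_push_tangent z w : dom c (foot z) -> is_tangent z w ->
  is_tangent (foot z) (proj_push z w).
Proof.
move=> cz tw; rewrite proj_push_partial//; apply: tangent_sum => i _.
by apply: tangentZ; exact: partial_tangent.
Qed.

Lemma proj_push_xc z w i : dom c (foot z) -> proj_push z w (xc c i) = w (xl i).
Proof. by move=> cz; rewrite proj_pushE//; exact: smooth_xc. Qed.

Lemma verticalP z w : dom c (foot z) ->
  vertical z w <-> is_tangent z w /\ forall i, w (xl i) = 0.
Proof.
move=> cz; split=> [[tw E]|[tw E]]; split=> //.
  by move=> i; rewrite -(proj_push_xc w i cz) E.
by rewrite proj_push_partial// big1// => i _; rewrite E scale0r.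
Qed.

Lemma vertical_vpartial z w : dom c (foot z) -> vertical z w ->
  w = \sum_i w (xc C (rshift m i)) *: vpartial i z.
Proof.
move=> cz /(verticalP _ cz)[tw E]; rewrite {1}(TM_tangent_partial cz tw).
by rewrite big1 ?add0r// => i _; rewrite E scale0r.
Qed.

Lemma vpartial_vertical i z : dom c (foot z) -> vertical z (vpartial i z).
Proof.
move=> cz; apply/(verticalP _ cz); split; first exact: vpartial_tangent.
by move=> j; exact: vpartial_xl.
Qed.

Lemma vertical_sum z I (r : seq I) (a : I -> R) (F : I -> functional (TM M)) :
  dom c (foot z) -> (forall i, vertical z (F i)) ->
  vertical z (\sum_(i <- r) a i *: F i).
Proof.
move=> cz vF; have {}vF i := (verticalP _ cz).1 (vF i).
apply/(verticalP _ cz); split.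
  by apply: tangent_sum => i _; apply: tangentZ; case: (vF i).
by move=> j; rewrite functional_lincombE big1// => i _; rewrite (vF i).2 mulr0.
Qed.

Lemma coord_fibre_line z (u : functional M) t : dom c (foot z) ->
  is_tangent (foot z) u ->
  dom c (foot (fibre_line z u t)) /\
  coord C (fibre_line z u t) =
    coord C z + t *: row_mx 0 (\row_i u (xc c i)).
Proof.
move=> cz tu; rewrite /fibre_line; case: pselect => [h|[]]; last first.
  by apply: tangentD; [exact: vecP|exact: tangentZ].
split=> //=; rewrite scale_row_mx scaler0 add_row_mx addr0; congr row_mx.
by apply/rowP => i; rewrite !mxE.
Qed.

(** In the chart the line in the fibre is straight, with zero base direction, so its velocity is a
    directional derivative of the representative. *)
Lemma vertical_lift_vpartial z (u : functional M) : dom c (foot z) ->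
  is_tangent (foot z) u ->
  vertical_lift z u = \sum_i u (xc c i) *: vpartial i z.
Proof.
move=> cz tu; set a : 'rV[R]_(m + m) := row_mx 0 (\row_i u (xc c i)).
transitivity (tanvec C z a); last first.
  rewrite tanvec_partial big_split_ord /= [X in X + _]big1 ?add0r; last first.
    by move=> i _; rewrite row_mxEl mxE scale0r.
  by apply: eq_bigr => i _; rewrite row_mxEr mxE.
apply/funext => F; rewrite /vertical_lift /tanvec; case: asboolP => // sF.
have cZ : dom C z by [].
pose proof ((smooth_atE _ atlas_tangent_chart cZ).1 sF) as sr.
have -> : (fun t => F (fibre_line z u t)) = fun t => rep C z F (coord C z + t *: a).
  apply/funext => t; have [ct <-] := coord_fibre_line t cz tu.
  by rewrite /rep (cinvK z atlas_tangent_chart ct).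
rewrite derive1E.
have d0 : differentiable (rep C z F) (coord C z + 0 *: a).
  by rewrite scale0r addr0; exact: smooth_pt_differentiable.
have := is_derive_line d0; rewrite scale0r addr0 => D.
exact: (@derive_val _ _ _ _ _ _ _ D).
Qed.

Lemma tstruct_vpartial z w : dom c (foot z) -> is_tangent z w ->
  tstruct z w = \sum_i w (xl i) *: vpartial i z.
Proof.
move=> cz tw; rewrite /tstruct vertical_lift_vpartial//; last exact: proj_push_tangent.
by apply: eq_bigr => i _; rewrite proj_push_xc.
Qed.

Lemma tstruct_vertical z w : dom c (foot z) -> is_tangent z w -> vertical z (tstruct z w).
Proof.
move=> cz tw; rewrite tstruct_vpartial//; apply: vertical_sum => // i.
exact: vpartial_vertical.
Qed.

Lemma smooth_tstruct z X : dom c (foot z) -> smooth_field z X ->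
  smooth_field z (fun y => tstruct y (X y)).
Proof.
move=> cz sX.
apply: (eq_smooth_field (X := fun y => \sum_i X y (xl i) *: vpartial i y)).
  by apply: filterS2 sX.1 (near_dom_foot cz) => y tX cy; rewrite tstruct_vpartial.
apply: smooth_field_sum => i _; apply: smooth_fieldZ; last exact: smooth_vpartial.
exact: sX.2 _ (smooth_xl i cz).
Qed.

Lemma vpartial_inj z (a b : 'I_m -> R) : dom c (foot z) ->
  \sum_i a i *: vpartial i z = \sum_i b i *: vpartial i z -> a =1 b.
Proof.
move=> cz E i; have := congr1 (fun v => v (xc C (rshift m i))) E.
rewrite !functional_lincombE (bigD1 i)//= [X in _ = X](bigD1 i)//=.
rewrite !vpartial_xv// eqxx !mulr1 !big1 ?addr0// => j /negbTE ji;
  by rewrite vpartial_xv// ji mulr0.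
Qed.

End Lift.

(** * Horizontal lifts *)

Section SmoothMatrix.
Variables (R : realType) (n : nat) (N : chartedSpace R n).
Context {hN : smooth_atlas N}.
Implicit Types (p : N).

Lemma smooth_at_det p k (A : N -> 'M[R]_k) :
  (forall i j, smooth_at p (fun q => A q i j)) -> smooth_at p (fun q => \det (A q)).
Proof.
move=> sA; apply: smooth_at_sum => sg _; apply: smooth_atM.
  exact: smooth_at_cst.
by apply: smooth_at_prod => i _.
Qed.

(** Cofactors divided by the determinant. Invertibility is required near [p] because [invmx] returns
    singular matrices unchanged. *)
Lemma smooth_at_invmx p k (A : N -> 'M[R]_k) i j : A p \in unitmx ->
  (forall i j, smooth_at p (fun q => A q i j)) ->
  near_pt p (fun q => A q \in unitmx) ->
  smooth_at p (fun q => invmx (A q) i j).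
Proof.
move=> uA sA nA.
apply: (@eq_smooth_at _ _ _ _ _ (fun q => (\det (A q))^-1 * (\adj (A q)) i j)).
  by apply: filterS nA => q uq; rewrite /invmx uq [RHS]mxE.
apply: smooth_atM.
  apply: (smooth_atV (f := fun q => \det (A q))); last exact: smooth_at_det.
  by move: uA; rewrite unitmxE unitfE.
apply: (@eq_smooth_at _ _ _ _ _ (fun q => (-1) ^+ (j + i) * \det (row' j (col' i (A q))))).
  by apply: filterE => q; rewrite mxE.
apply: smooth_atM; first exact: smooth_at_cst.
apply: smooth_at_det => k1 k2.
by apply: (eq_smooth_at _ (sA (lift j k1) (lift i k2))); apply: filterE => q; rewrite !mxE.
Qed.

End SmoothMatrix.

(** * The splitting into horizontal and vertical vectors *)

Section Horizontal.
Variables (R : realType) (m : nat) (M : chartedSpace R m).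
Context {hM : smooth_atlas M}.
Implicit Types (p : M) (z y : TM M) (f : M -> R).
Implicit Types (u v w : functional (TM M)).
Variable H : TM M -> set (functional (TM M)).
Hypothesis hH : horizontal_bundle H.

Lemma horizontal_tangent z w : H z w -> is_tangent z w.
Proof. by case: hH => -[+ _] _; exact. Qed.

(** [H z] is given as a bare set; its linear structure comes from the local basis of the
    subbundle. *)
Lemma horizontal_sum z I (r : seq I) (a : I -> R) (F : I -> functional (TM M)) :
  (forall i, H z (F i)) -> H z (\sum_(i <- r) a i *: F i).
Proof.
move=> HF; case: hH => -[_ /(_ z)[E [_ nB]]] _.
have eB : is_basis (H z) (E^~ z) by exact: near_pt_self nB.
have /choice [b bE] i : exists b : 'I_m -> R, F i = \sum_j b j *: E j z.
  exact: basis_coef eB (HF i).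
rewrite (_ : \sum_(i <- r) _ = \sum_j (\sum_(i <- r) a i * b i j) *: E j z).
  exact: basis_lincomb eB.
under eq_bigr do rewrite bE scaler_sumr.
rewrite exchange_big; apply: eq_bigr => j _ /=; rewrite scaler_suml.
by apply: eq_bigr => i _; rewrite scalerA.
Qed.

Lemma horizontal0 z : H z 0.
Proof.
have := @horizontal_sum z 'I_0 [::] (fun=> 0) (fun=> 0).
by rewrite big_nil; apply; case.
Qed.

Lemma horizontal_lin z r u v : H z u -> H z v -> H z (r *: u + v).
Proof.
move=> Hu Hv; have := @horizontal_sum z bool [:: true; false] (fun b => if b then r else 1)
  (fun b => if b then u else v).
by rewrite !big_cons big_nil addr0 scale1r; apply; case.
Qed.

Lemma horizontalB z u v : H z u -> H z v -> H z (u - v).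
Proof. by move=> Hu Hv; rewrite addrC -scaleN1r; exact: horizontal_lin. Qed.

Lemma vertical0 z : vertical z (0 : functional (TM M)).
Proof.
split; first exact: tangent0.
by apply/funext => f; rewrite /proj_push; case: asboolP.
Qed.

(** Such a vector splits both as itself plus zero and as zero plus itself, and the splitting is
    unique. *)
Lemma horizontal_vertical0 z w : H z w -> vertical z w -> w = 0.
Proof.
move=> Hw vw; case: hH => _ /(_ z w (horizontal_tangent Hw))[u [_ U]].
have <- : u = w by apply: U; split=> //; rewrite subrr; exact: vertical0.
by apply: U; split; [exact: horizontal0|rewrite subr0].
Qed.

Lemma prHP z w : is_tangent z w -> H z (prH H z w) /\ vertical z (prV H z w).
Proof.
move=> tw; rewrite /prV /prH; case: xgetP => [u _ []//|].
by case: hH => _ /(_ z w tw)[u [Hu _]] /(_ u).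
Qed.

Section Chart.
Variable c : chart R m M.
Hypothesis hc : atlas c.

Notation C := (tangent_chart c : chart R (m + m) (TM M)).

(** The difference is horizontal and kills the base coordinates, hence is vertical too. This is the
    uniqueness principle behind all horizontal constructions made by choice. *)
Lemma horizontal_inj z u v : dom c (foot z) -> H z u -> H z v ->
  (forall i, u (xl c i) = v (xl c i)) -> u = v.
Proof.
move=> cz Hu Hv E; apply/eqP; rewrite -subr_eq0; apply/eqP.
apply: (horizontal_vertical0 (horizontalB Hu Hv)); apply/(verticalP hc _ cz); split.
  by apply: tangentB; exact: horizontal_tangent.
by move=> i; rewrite functionalB E subrr.
Qed.

Lemma prH_unique z w u : dom c (foot z) -> is_tangent z w -> H z u ->
  (forall i, w (xl c i) = u (xl c i)) -> prH H z w = u.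
Proof.
move=> cz tw Hu E; have [Hw /(verticalP hc _ cz)[_ vw]] := prHP tw.
apply: (horizontal_inj cz) => // i; rewrite -E; apply/esym/eqP; rewrite -subr_eq0.
by apply/eqP; exact: vw i.
Qed.

Lemma prH_xl z w i : dom c (foot z) -> is_tangent z w -> prH H z w (xl c i) = w (xl c i).
Proof.
move=> cz tw; have [_ /(verticalP hc _ cz)[_ /(_ i)/eqP]] := prHP tw.
by rewrite subr_eq0 => /eqP.
Qed.

Definition hlift i z : functional (TM M) := horizontal_lift H z (partial c i (foot z)).

Lemma hliftP i z : dom c (foot z) ->
  H z (hlift i z) /\ forall j, hlift i z (xl c j) = (i == j)%:R.
Proof.
move=> cz; pose P := partial C (lshift m i) z.
have tP : is_tangent z P by exact: (partial_tangent _ (atlas_tangent_chart hc)).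
have Px j : P (xl c j) = (i == j)%:R.
  have sj : smooth_at (foot z) (xc c j) by exact: smooth_xc.
  rewrite -(partial_xc i j hc cz); exact: (partial_lshift_foot hc i cz sj).
have [HP vP] := prHP tP.
(* The horizontal part of the base coordinate field [P] is a lift, so the choice in
   [horizontal_lift] is not the default one. *)
have PE : proj_push z (prH H z P) = partial c i (foot z).
  rewrite (proj_push_partial hc cz (horizontal_tangent HP)) (bigD1 i)//= prH_xl// Px eqxx.
  rewrite scale1r big1 ?addr0// => j /negbTE ji.
  by rewrite prH_xl// Px eq_sym ji scale0r.
suff [Hl E] : H z (hlift i z) /\ proj_push z (hlift i z) = partial c i (foot z).
  by split=> // j; rewrite -(proj_push_xc hc _ j cz) E partial_xc.
rewrite /hlift /horizontal_lift; case: xgetP => [u _ []//|].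
by move=> /(_ (prH H z P)) [].
Qed.

Lemma hlift_H i z : dom c (foot z) -> H z (hlift i z).
Proof. by move=> /(hliftP i)[]. Qed.

Lemma hlift_xl i j z : dom c (foot z) -> hlift i z (xl c j) = (i == j)%:R.
Proof. by move=> /(hliftP i)[]. Qed.

Lemma hlift_tangent i z : dom c (foot z) -> is_tangent z (hlift i z).
Proof. by move=> cz; apply: horizontal_tangent; exact: hlift_H. Qed.

Lemma hlift_sum_xl (a : 'I_m -> R) z j : dom c (foot z) ->
  (\sum_i a i *: hlift i z) (xl c j) = a j.
Proof.
move=> cz; rewrite functional_lincombE (bigD1 j)//= hlift_xl// eqxx mulr1.
by rewrite big1 ?addr0// => i /negbTE ij; rewrite hlift_xl// ij mulr0.
Qed.

Lemma horizontal_hlift z w : dom c (foot z) -> H z w -> w = \sum_i w (xl c i) *: hlift i z.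
Proof.
move=> cz Hw; apply: (horizontal_inj cz) => //; last by move=> i; rewrite hlift_sum_xl.
by apply: horizontal_sum => i; exact: hlift_H.
Qed.

Lemma prH_hlift z w : dom c (foot z) -> is_tangent z w ->
  prH H z w = \sum_i w (xl c i) *: hlift i z.
Proof.
move=> cz tw; apply: prH_unique => //; last by move=> i; rewrite hlift_sum_xl.
by apply: horizontal_sum => i; exact: hlift_H.
Qed.

Lemma prH_vertical z w : dom c (foot z) -> vertical z w -> prH H z w = 0.
Proof.
move=> cz /(verticalP hc _ cz)[tw vw]; apply: prH_unique => //; first exact: horizontal0.
Qed.

Lemma prH_id z w : dom c (foot z) -> H z w -> prH H z w = w.
Proof. by move=> cz Hw; apply: prH_unique => //; exact: horizontal_tangent. Qed.

(** The lifts are chosen point by point. They are recovered from a smooth local basis [E] of [H]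
    through the inverse of the matrix [A] of its base components, invertible because a horizontal
    vector without base components is zero. *)
Lemma smooth_hlift i z : dom c (foot z) -> smooth_field z (hlift i).
Proof.
move=> cz; case: hH => -[_ /(_ z)[E [sE nB]]] _.
pose A y : 'M[R]_m := \matrix_(i, j) E i y (xl c j).
have uA y : dom c (foot y) -> is_basis (H y) (E^~ y) -> A y \in unitmx.
  move=> cy eB; apply: unitmx_lker0 => v vA; apply/rowP => k; rewrite mxE.
  have Hv : H y (\sum_i v ord0 i *: E i y) := basis_lincomb _ eB.
  suff E0 : \sum_i v ord0 i *: E i y = \sum_i (fun=> 0) i *: E i y.
    exact: basis_inj eB E0 k.
  rewrite [RHS]big1 => [|j _]; last by rewrite scale0r.
  apply: (horizontal_inj cy Hv (horizontal0 y)) => j; rewrite functional_lincombE.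
  transitivity ((v *m A y) ord0 j); last by rewrite vA mxE.
  by rewrite mxE; apply: eq_bigr => l _; rewrite mxE.
have nA : near_pt z (fun y => A y \in unitmx).
  by apply: filterS2 nB (near_dom_foot hc cz) => y eB cy; exact: uA.
apply: (eq_smooth_field (X := fun y => \sum_j invmx (A y) i j *: E j y)).
  apply: filterS3 nB (near_dom_foot hc cz) nA => y eB cy ny.
  apply: (horizontal_inj cy); [exact: basis_lincomb eB|exact: hlift_H|move=> j].
  rewrite functional_lincombE hlift_xl//.
  have /matrixP/(_ i j) := mulVmx ny; rewrite !mxE => <-.
  by apply: eq_bigr => k _; rewrite mxE.
apply: smooth_field_sum => j _; apply: smooth_fieldZ => //.
apply: (smooth_at_invmx _ _ _ _ nA); first exact: near_pt_self nA.
move=> k l; apply: (eq_smooth_at (f := fun y => E k y (xl c l))).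
  by apply: filterE => y; rewrite mxE.
by apply: (sE k).2; exact: smooth_xl.
Qed.

Lemma section_hlift i z : dom c (foot z) -> section_of H z (hlift i).
Proof.
move=> cz; split; first exact: smooth_hlift.
by apply: filterS (near_dom_foot hc cz) => y; exact: hlift_H.
Qed.

Lemma section_sum z (a : 'I_m -> TM M -> R) : dom c (foot z) ->
  (forall i, smooth_at z (a i)) ->
  section_of H z (fun y => \sum_i a i y *: hlift i y).
Proof.
move=> cz sa; split.
  apply: smooth_field_sum => i _; apply: smooth_fieldZ => //; exact: smooth_hlift.
apply: filterS (near_dom_foot hc cz) => y cy.
by apply: horizontal_sum => i; exact: hlift_H.
Qed.

Lemma tstruct_hlift i z : dom c (foot z) -> tstruct z (hlift i z) = vpartial c i z.
Proof.
move=> cz; rewrite (tstruct_vpartial hc cz (hlift_tangent i cz)) (bigD1 i)//=.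
rewrite hlift_xl// eqxx scale1r big1 ?addr0// => j /negbTE ji.
by rewrite hlift_xl// eq_sym ji scale0r.
Qed.

Lemma tstruct'P z w : dom c (foot z) -> is_tangent z w ->
  H z (tstruct' H z w) /\ tstruct z (tstruct' H z w) = prV H z w.
Proof.
move=> cz tw; rewrite /tstruct'; case: xgetP => [u _ []//|].
have [_ vw] := prHP tw.
(* The fibre components of the vertical part are used as coefficients of the lifts, since [tstruct]
   sends each lift to the fibre field of the same index. *)
move=> /(_ (\sum_i prV H z w (xc C (rshift m i)) *: hlift i z)) [].
have Hs : H z (\sum_i prV H z w (xc C (rshift m i)) *: hlift i z).
  by apply: horizontal_sum => i; exact: hlift_H.
split=> //; rewrite (tstruct_vpartial hc cz (horizontal_tangent Hs)).
rewrite [RHS](vertical_vpartial hc cz vw).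
by apply: eq_bigr => i _; rewrite hlift_sum_xl.
Qed.

Lemma tstruct_inj z u v : dom c (foot z) -> H z u -> H z v ->
  tstruct z u = tstruct z v -> u = v.
Proof.
move=> cz Hu Hv; rewrite !(tstruct_vpartial hc cz) ?(horizontal_tangent Hu) ?(horizontal_tangent Hv)//;
  try exact: horizontal_tangent.
by move=> /(vpartial_inj hc cz) E; exact: horizontal_inj cz Hu Hv E.
Qed.

Lemma tstruct0 z : tstruct z (0 : functional (TM M)) = 0.
Proof.
have [d hd dz] : exists2 d, atlas d & dom d (foot z) by exact: chart_around.
rewrite (tstruct_vpartial hd dz (tangent0 z)) big1// => i _.
by rewrite scale0r.
Qed.

Lemma tstruct'_horizontal z w : dom c (foot z) -> H z w -> tstruct' H z w = 0.
Proof.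
move=> cz Hw; have [HS ES] := tstruct'P cz (horizontal_tangent Hw).
apply: (tstruct_inj cz HS (horizontal0 z)).
by rewrite ES /prV prH_id// subrr tstruct0.
Qed.

Lemma tstruct'K z w : dom c (foot z) -> H z w -> tstruct' H z (tstruct z w) = w.
Proof.
move=> cz Hw; have vS : vertical z (tstruct z w).
  by apply: (tstruct_vertical hc cz); exact: horizontal_tangent.
have [HS ES] := tstruct'P cz (vS.1).
by apply: (tstruct_inj cz HS Hw); rewrite ES /prV prH_vertical// subr0.
Qed.

End Chart.

End Horizontal.

(** * The canonical and the Cartan connections *)

Section Canonical.
Variables (R : realType) (m : nat) (M : chartedSpace R m).
Context {hM : smooth_atlas M}.
Implicit Types (p : M) (z y : TM M) (f : M -> R).
Implicit Types (u v w : functional (TM M)).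
Variable H : TM M -> set (functional (TM M)).
Hypothesis hH : horizontal_bundle H.
Variable sigma : tensor2 (TM M).
Hypothesis hsigma : horizontal_tensor sigma.
Hypothesis sigma_sym : symmetric2 sigma.
Hypothesis sigma_nondeg : nondegenerate_on H sigma.
Variable c : chart R m M.
Hypothesis hc : atlas c.

Local Notation xl := (xl c).
Local Notation hlift := (hlift H c).
Local Notation vpartial := (vpartial c).

Let sigma_tensor : is_tensor2 sigma. Proof. by case: hsigma. Qed.

Lemma sigma_prH z v w : is_tangent z v -> is_tangent z w ->
  sigma z v w = sigma z (prH H z v) w.
Proof.
move=> tv tw; have [HP vP] := prHP hH tv.
have [V0 _] := hsigma.2 z _ _ vP tw.
have E : v = 1 *: prH H z v + prV H z v by rewrite scale1r /prV addrC subrK.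
case: sigma_tensor => L _ _; rewrite {1}E L//; first by rewrite V0 addr0 mul1r.
- exact: horizontal_tangent HP.
- exact: vP.1.
Qed.

Lemma tangent_metricr z v h : dom c (foot z) -> is_tangent z v -> H z h ->
  tangent_metric H sigma z v h = sigma z v h.
Proof.
move=> cz tv Hh; rewrite /tangent_metric (tstruct'_horizontal hH hc cz Hh) tensor0r ?addr0//.
by apply: (horizontal_tangent hH); case: (tstruct'P hH hc cz tv).
Qed.

Lemma tangent_metricl z v h : dom c (foot z) -> is_tangent z v -> H z h ->
  tangent_metric H sigma z h v = sigma z h v.
Proof.
move=> cz tv Hh; rewrite /tangent_metric (tstruct'_horizontal hH hc cz Hh) tensor0l ?addr0//.
by apply: (horizontal_tangent hH); case: (tstruct'P hH hc cz tv).
Qed.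

Lemma sigma_inj z u v : dom c (foot z) -> H z u -> H z v ->
  (forall k, sigma z u (hlift k z) = sigma z v (hlift k z)) -> u = v.
Proof.
move=> cz Hu Hv E; apply/eqP; rewrite -subr_eq0; apply/eqP.
have tl k : is_tangent z (hlift k z) by exact: hlift_tangent.
have Huv : H z (u - v) by exact: (horizontalB hH).
apply: (sigma_nondeg Huv) => w Hw; rewrite (horizontal_hlift hH hc cz Hw).
rewrite tensor_sumr//; last exact: (horizontal_tangent hH).
apply: big1 => k _.
rewrite addrC -scaleN1r; case: sigma_tensor => L _ _.
rewrite L//; [|exact: (horizontal_tangent hH)|exact: (horizontal_tangent hH)].
by rewrite E mulN1r addNr mulr0.
Qed.

(** Tested on the lifts the metric sees only [prH v], and tested on their images by [tstruct] only
    [tstruct' v]; both are zero as [sigma] is nondegenerate on [H]. *)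
Lemma tangent_metric_eq0 z v : dom c (foot z) -> is_tangent z v ->
  (forall w, is_tangent z w -> tangent_metric H sigma z v w = 0) -> v = 0.
Proof.
move=> cz tv E; have [HP vP] := prHP hH tv; have [HS ES] := tstruct'P hH hc cz tv.
have P0 : prH H z v = 0.
  apply: (sigma_inj cz HP (horizontal0 hH z)) => k; rewrite tensor0l//; last first.
    exact: hlift_tangent.
  rewrite -sigma_prH//; last exact: hlift_tangent.
  rewrite -tangent_metricr//; last exact: hlift_H.
  by apply: E; exact: hlift_tangent.
have S0 : tstruct' H z v = 0.
  apply: (sigma_inj cz HS (horizontal0 hH z)) => k; rewrite tensor0l//; last first.
    exact: hlift_tangent.
  have Hk : H z (hlift k z) by exact: hlift_H.
  have vS : vertical z (tstruct z (hlift k z)).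
    by apply: (tstruct_vertical hc cz); exact: (horizontal_tangent hH).
  have := E _ vS.1; rewrite /tangent_metric (tstruct'K hH hc cz Hk).
  by rewrite sigma_sym ?(hsigma.2 z _ _ vS tv).1 ?add0r//; exact: vS.1.
have : prV H z v = 0 by rewrite -ES S0 tstruct0.
by rewrite /prV P0 subr0.
Qed.

(** Vectors kill constants. This is how brackets of two lifts, or of a lift and a fibre field, are
    seen to be vertical. *)
Lemma lie_xl z X Y k (r t : R) : dom c (foot z) ->
  is_tangent z (X z) -> is_tangent z (Y z) ->
  near_pt z (fun y => X y (xl k) = r) -> near_pt z (fun y => Y y (xl k) = t) ->
  lie X Y z (xl k) = 0.
Proof.
move=> cz tX tY Xr Yt; rewrite lieE; last exact: smooth_xl.
rewrite (tangent_eq tX (g := fun=> t))// (tangent_eq tY (g := fun=> r))//.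
by rewrite (tangent_cst tX) (tangent_cst tY) subrr.
Qed.

Lemma near_hlift_xl z i k : dom c (foot z) ->
  near_pt z (fun y => hlift i y (xl k) = (i == k)%:R).
Proof. by move=> cz; apply: filterS (near_dom_foot hc cz) => y; exact: hlift_xl. Qed.

Variables (s : tensor2 M) (Ds : connection M).
Hypothesis sigma_proj : is_projection H sigma s.
Hypothesis hDs : is_levi_civita s Ds.

Local Notation S := (gram s c).
Local Notation Gam := (christoffel Ds c).

(** Projectability enters here: the Gram matrix of the lifts is pulled back from [M]. *)
Lemma sigma_hlift z i j : dom c (foot z) ->
  sigma z (hlift i z) (hlift j z) = S (foot z) i j.
Proof.
move=> cz; rewrite mxE; case: sigma_proj => _; apply; exact: partial_tangent.
Qed.

Lemma sigma_lincomb z (e f : 'I_m -> R) : dom c (foot z) ->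
  sigma z (\sum_i e i *: hlift i z) (\sum_j f j *: hlift j z) =
  \sum_i \sum_j e i * f j * S (foot z) i j.
Proof.
move=> cz; have tl k : is_tangent z (hlift k z) by exact: hlift_tangent.
have tf : is_tangent z (\sum_j f j *: hlift j z).
  by apply: tangent_sum => j _; exact: tangentZ.
rewrite (tensor_suml _ _ _ tl tf)//; apply: eq_bigr => i _.
rewrite (tensor_sumr _ _ _ tl (tl i))// mulr_sumr.
by apply: eq_bigr => j _; rewrite sigma_hlift// mulrA.
Qed.

Variable D : connection (TM M).
Hypothesis hD : is_levi_civita (tangent_metric H sigma) D.

Let D_connection : is_connection D. Proof. by case: hD. Qed.

Lemma prH_levi_civita z a i : dom c (foot z) ->
  prH H z (D z (hlift a z) (hlift i)) = \sum_j Gam a i j (foot z) *: hlift j z.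
Proof.
move=> cz.
have tl k : is_tangent z (hlift k z) by exact: hlift_tangent.
have sl k : smooth_field z (hlift k) by exact: smooth_hlift.
have tD e k : is_tangent z (D z (hlift e z) (hlift k)) by exact: connection_tangent.
have Hl l : H z (hlift l z) by exact: hlift_H.
pose T e k l := sigma z (D z (hlift e z) (hlift k)) (hlift l z).
pose G e k l := \sum_j Gam e k j (foot z) * S (foot z) j l.
have Ssym k l : S (foot z) k l = S (foot z) l k.
  by rewrite -!sigma_hlift// sigma_sym.
(* The Gram matrix being pulled back, the lift [e] differentiates it as [partial c e] does on [M],
   where compatibility of [Ds] with [s] applies. *)
have T1 e k l : T e k l + T e l k = G e k l + G e l k.
  case: hD => _ _ /(_ z _ _ _ (tl e) (sl k) (sl l)).
  rewrite tangent_metricr// tangent_metricl// -/(T e k l).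
  rewrite (sigma_sym (tl k) (tD e l)) -/(T e l k) => <-.
  rewrite (tangent_eq (tl e) (g := (fun q => S q k l) \o @foot _ _ M)); last first.
    apply: filterS (near_dom_foot hc cz) => y cy /=.
    rewrite (tangent_metricr cy (hlift_tangent hH hc k cy) (hlift_H hH hc l cy)).
    exact: sigma_hlift.
  have sm : is_metric s by case: sigma_proj.
  rewrite (tangent_foot hc cz (tl e) (gram_smooth sm hc k l cz)).
  rewrite (bigD1 e)//= hlift_xl// eqxx mul1r big1 ?addr0; last first.
    by move=> b /negbTE ba; rewrite hlift_xl// eq_sym ba mul0r.
  rewrite (metric_compat sm hDs hc _ _ _ cz); congr (_ + _).
  by apply: eq_bigr => j _; rewrite Ssym.
(* Torsion vanishes, and the bracket of two lifts is vertical, hence invisible to [sigma]. *)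
have T2 e k l : T e k l = T k e l.
  apply/eqP; rewrite -subr_eq0; apply/eqP.
  have L : sigma z (D z (hlift e z) (hlift k) - D z (hlift k z) (hlift e)) (hlift l z) = 0.
    case: hD => _ /(_ z _ _ (sl e) (sl k)) -> _.
    have tL : is_tangent z (lie (hlift e) (hlift k) z) by exact: lie_tangent.
    apply: (hsigma.2 z _ _ _ (tl l)).1; apply/(verticalP hc _ cz); split=> // l0.
    by apply: lie_xl => //; exact: near_hlift_xl.
  case: sigma_tensor => Lin _ _; rewrite addrC -scaleN1r Lin// mulN1r in L.
  by rewrite -[RHS]L addrC.
have G2 e k l : G e k l = G k e l.
  by apply: eq_bigr => j _; rewrite (christoffel_sym hDs hc).
(* [T - G] is symmetric in its first two indices, by vanishing torsion, and skew
   in the last two, by metric compatibility, so it vanishes. *)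
have TG : T a i =1 G a i.
  move=> k.
  move: (T1 a i k) (T1 i k a) (T1 k a i).
  rewrite (T2 i a k) (T2 k a i) (T2 k i a) (G2 i a k) (G2 k a i) (G2 k i a).
  lra.
apply: (sigma_inj cz (prHP hH (tD a i)).1).
  by apply: (horizontal_sum hH) => j.
move=> k; rewrite -sigma_prH// -/(T a i k) TG tensor_suml//.
by apply: eq_bigr => j _; rewrite sigma_hlift.
Qed.

Variable nabD : connection (TM M).
Hypothesis hnabD : is_canonical_connection H D nabD.

Let nabD_connection : is_connection nabD. Proof. by case: hnabD. Qed.

(** The identities defining the canonical connection are stated jointly for two horizontal and two
    vertical sections; the zero field completes the list. *)
Lemma section_vertical0 z : section_of (@vertical R m M) z (fun=> 0).
Proof.
split; first exact: smooth_field0.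
by apply: filterE => y; exact: vertical0.
Qed.

Lemma section_vertical z (a : 'I_m -> R) : dom c (foot z) ->
  section_of (@vertical R m M) z (fun y => \sum_i a i *: vpartial i y).
Proof.
move=> cz; split.
  apply: smooth_field_sum => i _; apply: (smooth_fieldZ (smooth_at_cst z (a i))).
  exact: smooth_vpartial.
apply: filterS (near_dom_foot hc cz) => y cy; apply: (vertical_sum hc) => // i.
exact: vpartial_vertical.
Qed.

(** The derivative is the horizontal part of a bracket with a lift; extending [v] with constant
    fibre components makes that bracket vertical. *)
Lemma nabD_vertical z v i : dom c (foot z) -> vertical z v -> nabD z v (hlift i) = 0.
Proof.
move=> cz vv; pose Y y := \sum_k v (xc (tangent_chart c : chart R (m + m) (TM M))
  (rshift m k)) *: vpartial k y.
have Yv : Y z = v by rewrite [RHS](vertical_vpartial hc cz vv).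
have sY : section_of (@vertical R m M) z Y by exact: section_vertical.
have sl : section_of H z (hlift i) by exact: section_hlift.
have s0 : section_of (@vertical R m M) z (fun=> 0) by exact: section_vertical0.
have [_ + _ _] := hnabD.2 z _ _ _ _ sl sl sY s0.
rewrite Yv => ->; apply: (prH_vertical hH hc cz); apply/(verticalP hc _ cz); split.
  by apply: lie_tangent; [exact: sY.1|exact: sl.1].
move=> k; apply: (lie_xl (r := 0) (t := (i == k)%:R)) => //.
- by rewrite Yv; exact: vv.1.
- exact: hlift_tangent.
- apply: filterS (near_dom_foot hc cz) => y cy; rewrite /Y functional_lincombE.
  by apply: big1 => l _; rewrite vpartial_xl// mulr0.
- exact: near_hlift_xl.
Qed.

Lemma nabD_hlift z w i : dom c (foot z) -> is_tangent z w ->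
  nabD z w (hlift i) =
  \sum_j (\sum_a w (xl a) * Gam a i j (foot z)) *: hlift j z.
Proof.
move=> cz tw; have [HP vP] := prHP hH tw.
have sl k : section_of H z (hlift k) by exact: section_hlift.
have tl k : is_tangent z (hlift k z) by exact: hlift_tangent.
have s0 : section_of (@vertical R m M) z (fun=> 0) by exact: section_vertical0.
have E : w = 1 *: prH H z w + prV H z w by rewrite scale1r /prV addrC subrK.
rewrite {1}E (connection_lin nabD_connection); first last.
- exact: (sl i).1.
- exact: vP.1.
- exact: (horizontal_tangent hH).
rewrite (nabD_vertical i cz vP) addr0 scale1r (prH_hlift hH hc cz tw).
rewrite (connection_suml nabD_connection)//; last exact: (sl i).1.
under eq_bigr => a _.
  have [_ _ -> _] := hnabD.2 z _ _ _ _ (sl a) (sl i) s0 s0.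
  rewrite prH_levi_civita// scaler_sumr.
  over.
rewrite exchange_big; apply: eq_bigr => j _ /=; rewrite scaler_suml.
by apply: eq_bigr => a _; rewrite scalerA.
Qed.

(** Stated for all horizontal sections because the Cartan tensor chooses its own extensions. In
    vertical directions the lifts are parallel and their Gram matrix is constant, so the Leibniz
    rule for the components accounts for every term. *)
Lemma cov_sigma_vertical z v X X' : dom c (foot z) -> vertical z v ->
  section_of H z X -> section_of H z X' -> cov_sigma sigma nabD z v X X' = 0.
Proof.
move=> cz vv [sX HX] [sX' HX'].
have [tv v0] := (verticalP hc _ cz).1 vv.
have tl k : is_tangent z (hlift k z) by exact: hlift_tangent.
have sl k : smooth_field z (hlift k) by exact: smooth_hlift.
pose a k y := X y (xl k); pose b k y := X' y (xl k).
have sxl k : smooth_at z (xl k) by exact: smooth_xl.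
have sa k : smooth_at z (a k) by exact: sX.2 _ (sxl k).
have sb k : smooth_at z (b k) by exact: sX'.2 _ (sxl k).
have nX : near_pt z (fun y => X y = \sum_k a k y *: hlift k y).
  by apply: filterS2 HX (near_dom_foot hc cz) => y Hy cy; exact: horizontal_hlift.
have nX' : near_pt z (fun y => X' y = \sum_k b k y *: hlift k y).
  by apply: filterS2 HX' (near_dom_foot hc cz) => y Hy cy; exact: horizontal_hlift.
have nab_v Z e : smooth_field z Z -> (forall k, smooth_at z (e k)) ->
    near_pt z (fun y => Z y = \sum_k e k y *: hlift k y) ->
    nabD z v Z = \sum_k v (e k) *: hlift k z.
  move=> sZ se nZ; rewrite (connection_near nabD_connection tv sZ nZ).
  rewrite (connection_lincomb nabD_connection)//; apply: eq_bigr => k _.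
  by rewrite nabD_vertical// scaler0 addr0.
have sm : is_metric s by case: sigma_proj.
pose T y := \sum_i \sum_j (a i y * b j y) * ((fun q => S q i j) \o @foot _ _ M) y.
have sS i j : smooth_at (foot z) (fun q => S q i j) by exact: gram_smooth.
have sSf i j : smooth_at z ((fun q => S q i j) \o @foot _ _ M) by exact: (smooth_foot hc cz (sS i j)).
have sab i j : smooth_at z (fun y => a i y * b j y) by exact: smooth_atM.
have vS i j : v ((fun q => S q i j) \o @foot _ _ M) = 0.
  by rewrite (tangent_foot hc cz tv (sS i j)) big1// => k _; rewrite v0 mul0r.
have vT : v T = \sum_i \sum_j (a i z * v (b j) + b j z * v (a i)) * S (foot z) i j.
  rewrite (tangent_sumf tv); last first.
    by move=> i; apply: smooth_at_sum => j _; exact: smooth_atM.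
  apply: eq_bigr => i _; rewrite (tangent_sumf tv); last first.
    by move=> j; exact: smooth_atM.
  apply: eq_bigr => j _.
  rewrite (tangent_mulf tv (sab i j) (sSf i j)) vS mulr0 add0r.
  by rewrite (tangent_mulf tv (sa i) (sb j)) mulrC.
rewrite /cov_sigma (nab_v X a)// (nab_v X' b)//.
rewrite (near_pt_self nX) (near_pt_self nX') !sigma_lincomb//.
rewrite (tangent_eq tv (g := T)) ?vT; last first.
  apply: filterS3 nX nX' (near_dom_foot hc cz) => y -> -> cy; rewrite /T.
  exact: sigma_lincomb.
rewrite -!sumrB big1// => i _; rewrite -!sumrB big1// => j _; ring.
Qed.

Lemma horizontal_extensionP z u : dom c (foot z) -> H z u ->
  section_of H z (horizontal_extension H z u).
Proof.
move=> cz Hu; rewrite /horizontal_extension; case: xgetP => [X _ []//|].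
move=> /(_ (fun y => \sum_i u (xl i) *: hlift i y)) []; split.
  by apply: section_sum => // i; exact: smooth_at_cst.
by rewrite -(horizontal_hlift hH hc cz Hu).
Qed.

Lemma Psi0 z w w' : dom c (foot z) -> is_tangent z w -> is_tangent z w' ->
  Psi H sigma nabD z w w' = 0.
Proof.
(* The default value of the choice is already [0]; a chosen vector is orthogonal to all others. *)
move=> cz tw tw'; rewrite /Psi; case: xgetP => // v _ [tv E].
apply: (tangent_metric_eq0 cz tv) => w'' tw''; rewrite E// /cartan_tensor.
have [HS _] := tstruct'P hH hc cz tw.
rewrite cov_sigma_vertical ?mulr0//.
- by apply: (tstruct_vertical hc cz); exact: (horizontal_tangent hH).
- by apply: horizontal_extensionP => //; case: (prHP hH tw').
- by apply: horizontal_extensionP => //; case: (prHP hH tw'').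
Qed.

Lemma cartan_hlift z w i : dom c (foot z) -> is_tangent z w ->
  cartan_connection H sigma nabD z w (hlift i) =
  \sum_j (\sum_a w (xl a) * Gam a i j (foot z)) *: hlift j z.
Proof.
move=> cz tw; rewrite /cartan_connection Psi0 ?addr0//; first exact: nabD_hlift.
exact: hlift_tangent.
Qed.

End Canonical.

(** * The double metric Cartan connection *)

Section DoubleCartan.
Variables (R : realType) (m : nat) (M : chartedSpace R m).
Context {hM : smooth_atlas M}.
Implicit Types (p : M) (z y : TM M) (f : M -> R).
Implicit Types (u v w : functional (TM M)).
Variable H : TM M -> set (functional (TM M)).
Hypothesis hH : horizontal_bundle H.
Variables sigma psi : tensor2 (TM M).
Hypothesis hsigma : horizontal_tensor sigma.
Hypothesis sigma_sym : symmetric2 sigma.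
Hypothesis sigma_nondeg : nondegenerate_on H sigma.
Hypothesis hpsi : horizontal_tensor psi.
Variables (s : tensor2 M) (Ds : connection M).
Hypothesis sigma_proj : is_projection H sigma s.
Hypothesis hDs : is_levi_civita s Ds.
Variable D : connection (TM M).
Hypothesis hD : is_levi_civita (tangent_metric H sigma) D.
Variable nabD : connection (TM M).
Hypothesis hnabD : is_canonical_connection H D nabD.
Variable DC : connection (TM M).
Hypothesis hDC : is_double_cartan_connection H sigma psi nabD DC.
Variable c : chart R m M.
Hypothesis hc : atlas c.

Local Notation C := (tangent_chart c : chart R (m + m) (TM M)).
Local Notation xl := (xl c).
Local Notation hlift := (hlift H c).
Local Notation vpartial := (vpartial c).
Local Notation S := (gram s c).
Local Notation Gam := (christoffel Ds c).
Local Notation Q := (Qend H sigma psi).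

Let sigma_tensor : is_tensor2 sigma. Proof. by case: hsigma. Qed.
Let psi_tensor : is_tensor2 psi. Proof. by case: hpsi. Qed.
Let s_metric : is_metric s. Proof. by case: sigma_proj. Qed.
Let DC_connection : is_connection DC. Proof. by case: hDC. Qed.

Lemma tstruct_sum z I (r : seq I) (a : I -> R) (F : I -> functional (TM M)) :
  dom c (foot z) -> (forall i, is_tangent z (F i)) ->
  tstruct z (\sum_(i <- r) a i *: F i) = \sum_(i <- r) a i *: tstruct z (F i).
Proof.
move=> cz tF; rewrite (tstruct_vpartial hc cz); last first.
  by apply: tangent_sum => i _; exact: tangentZ.
under [RHS]eq_bigr do rewrite (tstruct_vpartial hc cz (tF _)) scaler_sumr.
rewrite [RHS]exchange_big; apply: eq_bigr => j _ /=.
rewrite functional_lincombE scaler_suml; apply: eq_bigr => i _.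
by rewrite scalerA.
Qed.

Lemma tstructB z u v : dom c (foot z) -> is_tangent z u -> is_tangent z v ->
  tstruct z (u - v) = tstruct z u - tstruct z v.
Proof.
move=> cz tu tv; rewrite !(tstruct_vpartial hc cz)//; last exact: tangentB.
by rewrite -sumrB; apply: eq_bigr => i _; rewrite -scalerBl.
Qed.

Lemma eq_section z X Y : near_pt z (fun y => X y = Y y) ->
  section_of H z X -> section_of H z Y.
Proof.
move=> E [sX HX]; split; first exact: eq_smooth_field sX.
by apply: filterS2 E HX => y ->.
Qed.

(** Both the equation defining [Q] and the uniqueness of its solution can be tested on the lifts
    alone. *)
Lemma Q_unique z u q : dom c (foot z) -> is_tangent z u -> H z q ->
  (forall k, psi z u (hlift k z) = - sigma z q (hlift k z)) -> Q z u = q.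
Proof.
move=> cz tu Hq E; rewrite /Qend; case: xgetP => [q' _ [Hq' E']|].
  apply: (sigma_inj hH hsigma sigma_nondeg hc cz Hq' Hq) => k.
  apply: oppr_inj; rewrite -E -E'//; exact: hlift_H.
move=> /(_ q) []; split=> // v Hv.
have tl k : is_tangent z (hlift k z) by exact: hlift_tangent.
rewrite (horizontal_hlift hH hc cz Hv) (tensor_sumr psi_tensor)//.
rewrite (tensor_sumr sigma_tensor) ?(horizontal_tangent hH)//; last exact: (horizontal_tangent hH).
by rewrite -sumrN; apply: eq_bigr => k _; rewrite E mulrN.
Qed.

(** With [P] the matrix of [psi] on the lifts, the equation defining [Q] reads [P = - Qmx S]; row
    [i] holds the components of [Q] applied to the [i]-th lift. *)
Definition Qmx z : 'M[R]_m :=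
  - (\matrix_(i, k) psi z (hlift i z) (hlift k z)) *m invmx (S (foot z)).

Lemma psi_Qmx z i k : dom c (foot z) ->
  psi z (hlift i z) (hlift k z) =
  - sigma z (\sum_j Qmx z i j *: hlift j z) (hlift k z).
Proof.
move=> cz; have tl l : is_tangent z (hlift l z) by exact: hlift_tangent.
rewrite (tensor_suml sigma_tensor)//.
have : Qmx z *m S (foot z) = - (\matrix_(i, k) psi z (hlift i z) (hlift k z)).
  by rewrite /Qmx mulmxKV//; exact: gram_unit.
move/matrixP/(_ i k); rewrite [LHS]mxE [RHS]mxE [X in - X]mxE => /esym E.
rewrite -[LHS]opprK E; congr (- _); apply: eq_bigr => j _.
by rewrite (sigma_hlift hc sigma_proj).
Qed.

Lemma Q_hlift z i : dom c (foot z) -> Q z (hlift i z) = \sum_j Qmx z i j *: hlift j z.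
Proof.
move=> cz; apply: Q_unique => //; first exact: hlift_tangent.
- by apply: (horizontal_sum hH) => j; exact: hlift_H.
- by move=> k; exact: psi_Qmx.
Qed.

Lemma Qmx_smooth z i j : dom c (foot z) -> smooth_at z (fun y => Qmx y i j).
Proof.
move=> cz; have sl k : smooth_field z (hlift k) by exact: smooth_hlift.
apply: (eq_smooth_at (f := fun y => \sum_k (- psi y (hlift i y) (hlift k y)) *
  ((fun q => invmx (S q) k j) \o @foot _ _ M) y)).
  by apply: filterE => y; rewrite [RHS]mxE; apply: eq_bigr => k _; rewrite !mxE.
apply: smooth_at_sum => k _; apply: smooth_atM.
  by apply: smooth_atN; case: psi_tensor => _ _; apply.
apply: (smooth_foot hc cz); apply: smooth_at_invmx.
- exact: gram_unit.
- by move=> k1 k2; exact: gram_smooth.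
- by apply: filterS (near_pt_dom hc cz) => q cq; exact: gram_unit.
Qed.

Lemma section_Q z i : dom c (foot z) -> section_of H z (fun y => Q y (hlift i y)).
Proof.
move=> cz; apply: (eq_section (X := fun y => \sum_j Qmx y i j *: hlift j y)).
  by apply: filterS (near_dom_foot hc cz) => y cy; rewrite Q_hlift.
by apply: section_sum => // j; exact: Qmx_smooth.
Qed.

Definition elift i y : functional (TM M) := hlift i y - tstruct y (Q y (hlift i y)).

Lemma smooth_elift z i : dom c (foot z) -> smooth_field z (elift i).
Proof.
move=> cz; apply: smooth_fieldB; first exact: smooth_hlift.
by apply: (smooth_tstruct hc cz); case: (section_Q i cz).
Qed.

Lemma Q_sum z (a : 'I_m -> R) : dom c (foot z) ->
  Q z (\sum_i a i *: hlift i z) = \sum_i a i *: Q z (hlift i z).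
Proof.
move=> cz; have tl k : is_tangent z (hlift k z) by exact: hlift_tangent.
have HQ k : H z (Q z (hlift k z)).
  by rewrite Q_hlift//; apply: (horizontal_sum hH) => j; exact: hlift_H.
have tQ k : is_tangent z (Q z (hlift k z)) by exact: (horizontal_tangent hH).
apply: Q_unique => //; [|exact: (horizontal_sum hH)|move=> k].
  by apply: tangent_sum => i _; exact: tangentZ.
rewrite (tensor_suml psi_tensor)// (tensor_suml sigma_tensor)// -sumrN.
by apply: eq_bigr => i _; rewrite psi_Qmx// -Q_hlift// mulrN.
Qed.

Lemma Q_hlift_tangent z i : dom c (foot z) -> is_tangent z (Q z (hlift i z)).
Proof. by move=> cz; apply: (smooth_field_at (X := fun y => Q y (hlift i y))); case: (section_Q i cz). Qed.

Lemma elift_xl z i j : dom c (foot z) -> elift i z (xl j) = (i == j)%:R.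
Proof.
move=> cz; have tQ : is_tangent z (Q z (hlift i z)) by exact: Q_hlift_tangent.
have vS : vertical z (tstruct z (Q z (hlift i z))) by exact: (tstruct_vertical hc cz).
move: vS => /(verticalP hc _ cz)[_ E].
by rewrite /elift functionalB E subr0 hlift_xl.
Qed.

Let om w i j z := \sum_a w (xl a) * Gam a i j (foot z).

Let cartan_hliftE z w i : dom c (foot z) -> is_tangent z w ->
  cartan_connection H sigma nabD z w (hlift i) = \sum_j om w i j z *: hlift j z.
Proof.
move=> cz tw.
exact: (cartan_hlift hH hsigma sigma_sym sigma_nondeg hc sigma_proj hDs hD hnabD).
Qed.

Lemma DC_vpartial z w i : dom c (foot z) -> is_tangent z w ->
  DC z w (vpartial i) = \sum_j om w i j z *: vpartial j z.
Proof.
move=> cz tw; have sv : smooth_field z (vpartial i) by exact: smooth_vpartial.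
have tl k : is_tangent z (hlift k z) by exact: hlift_tangent.
have N : near_pt z (fun y => vpartial i y = tstruct y (hlift i y)).
  by apply: filterS (near_dom_foot hc cz) => y cy; rewrite tstruct_hlift.
rewrite (connection_near DC_connection tw sv N).
have sl : section_of H z (hlift i) by exact: section_hlift.
rewrite (hDC.2 z w (hlift i) tw sl).1 cartan_hliftE// tstruct_sum//.
by apply: eq_bigr => j _; rewrite tstruct_hlift.
Qed.

Lemma DC_elift z w i : dom c (foot z) -> is_tangent z w ->
  DC z w (elift i) = \sum_j om w i j z *: elift j z.
Proof.
move=> cz tw; have tl k : is_tangent z (hlift k z) by exact: hlift_tangent.
have sl : section_of H z (hlift i) by exact: section_hlift.
have sQ : section_of H z (fun y => Q y (hlift i y)) by exact: section_Q.
have sSQ : smooth_field z (fun y => tstruct y (Q y (hlift i y))).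
  by apply: (smooth_tstruct hc cz); exact: sQ.1.
rewrite (connectionBr DC_connection tw sl.1 sSQ).
rewrite (hDC.2 z w _ tw sQ).1 (hDC.2 z w _ tw sl).2 /cov_Q.
(* [S A] occurs in the derivative of the lift, through [cov_Q], and again in that of [S Q] applied
   to the lift; the two cancel. Distributing [S] over the difference requires [A] to be tangent. *)
set A := cartan_connection H sigma nabD z w (fun y => Q y (hlift i y)).
have tA : is_tangent z A.
  have tQ : is_tangent z (Q z (hlift i z)) by exact: Q_hlift_tangent.
  rewrite /A /cartan_connection.
  rewrite (Psi0 hH hsigma sigma_sym sigma_nondeg hc sigma_proj hnabD cz tw tQ) addr0.
  by apply: (connection_tangent hnabD.1 tw); exact: sQ.1.
have tQl k : is_tangent z (Q z (hlift k z)) by exact: Q_hlift_tangent.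
rewrite cartan_hliftE// Q_sum//.
rewrite tstructB//; last by apply: tangent_sum => j _; exact: tangentZ.
rewrite tstruct_sum// addrA addrAC addrK -sumrB.
by apply: eq_bigr => j _; rewrite -scalerBr.
Qed.

Definition eframe (I : 'I_(m + m)) : TM M -> functional (TM M) :=
  match fintype.split I with inl i => elift i | inr i => vpartial i end.

(** Dual to [eframe]: the fibre components are those that remain after subtracting the combination
    of the [elift a] with the same base components. *)
Definition ecoframe (I : 'I_(m + m)) (z : TM M) w : R :=
  match fintype.split I with
  | inl i => w (xl i)
  | inr i => w (xc C (rshift m i)) - \sum_a w (xl a) * elift a z (xc C (rshift m i))
  end.

(** Two equal diagonal blocks; entries are functions for the connection coefficients and numbers for
    their derivatives, whence the type parameter. *)
Definition diag2 T (a0 : T) (A : 'I_m -> 'I_m -> T) (I J : 'I_(m + m)) : T :=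
  match fintype.split I, fintype.split J with
  | inl i, inl j => A i j
  | inr i, inr j => A i j
  | _, _ => a0
  end.

Lemma split_lshift (i : 'I_m) : fintype.split (lshift m i) = inl i.
Proof. exact: (unsplitK (inl i)). Qed.

Lemma split_rshift (i : 'I_m) : fintype.split (rshift m i) = inr i.
Proof. exact: (unsplitK (inr i)). Qed.

Let eGam a := diag2 (fun=> 0) (fun i j => Gam a i j \o @foot _ _ M).
Let edGam z b a := diag2 0 (dchristoffel Ds c (foot z) b a).

Section At.
Variable z : TM M.
Hypothesis cz : dom c (foot z).

Lemma smooth_eframe I : smooth_field z (eframe I).
Proof.
rewrite /eframe; case: (fintype.split I) => i; first exact: smooth_elift.
exact: smooth_vpartial.
Qed.

Lemma ecoframe_sum (a : 'I_(m + m) -> R) I :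
  ecoframe I z (\sum_J a J *: eframe J z) = a I.
Proof.
have E w : w = \sum_J a J *: eframe J z ->
    (forall i, w (xl i) = a (lshift m i)) /\
    (forall i, w (xc C (rshift m i)) =
      \sum_b a (lshift m b) * elift b z (xc C (rshift m i)) + a (rshift m i)).
  move=> ->; split=> i; rewrite functional_lincombE big_split_ord /=.
    rewrite [X in _ + X]big1 ?addr0 => [|j _]; last first.
      by rewrite /eframe split_rshift vpartial_xl// mulr0.
    rewrite (bigD1 i)//= /eframe split_lshift elift_xl// eqxx mulr1 big1 ?addr0//.
    by move=> j /negbTE ji; rewrite split_lshift elift_xl// ji mulr0.
  congr (_ + _); first by apply: eq_bigr => j _; rewrite /eframe split_lshift.
  rewrite (bigD1 i)//= /eframe split_rshift vpartial_xv// eqxx mulr1 big1 ?addr0//.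
  by move=> j /negbTE ji; rewrite split_rshift vpartial_xv// ji mulr0.
have [El Er] := E _ erefl; rewrite /ecoframe -[in RHS](fintype.splitK I).
case: (fintype.split I) => i /=; first exact: El.
under [X in _ - X]eq_bigr do rewrite El.
by rewrite Er addrAC subrr add0r.
Qed.

Lemma ecoframeE w : is_tangent z w -> w = \sum_I ecoframe I z w *: eframe I z.
Proof.
move=> tw; have te a : is_tangent z (elift a z).
  by apply: smooth_field_at; exact: smooth_elift.
have tv : is_tangent z (w - \sum_a w (xl a) *: elift a z).
  by apply: tangentB => //; apply: tangent_sum => a _; exact: tangentZ.
have vv : vertical z (w - \sum_a w (xl a) *: elift a z).
  apply/(verticalP hc _ cz); split=> // i; rewrite functionalB functional_lincombE.
  rewrite (bigD1 i)//= elift_xl// eqxx mulr1 big1 ?addr0 ?subrr// => j /negbTE ji.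
  by rewrite elift_xl// ji mulr0.
rewrite -[LHS](subrK (\sum_a w (xl a) *: elift a z)) addrC big_split_ord /=.
congr (_ + _).
  by apply: eq_bigr => i _; rewrite /ecoframe /eframe split_lshift.
rewrite [LHS](vertical_vpartial hc cz vv); apply: eq_bigr => i _.
by rewrite /ecoframe /eframe split_rshift functionalB functional_lincombE.
Qed.

Lemma eframe_basis : is_basis (is_tangent z) (fun I => eframe I z).
Proof.
split=> [a|v tv].
  apply: tangent_sum => I _; apply: tangentZ; apply: smooth_field_at.
  exact: smooth_eframe.
exists (\row_I ecoframe I z v); split.
  by rewrite {1}(ecoframeE tv); apply: eq_bigr => I _; rewrite mxE.
by move=> a ->; apply/rowP => I; rewrite mxE ecoframe_sum.
Qed.

Lemma smooth_ecoframe I Z : smooth_field z Z ->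
  smooth_at z (fun y => ecoframe I y (Z y)).
Proof.
move=> sZ; rewrite /ecoframe; case: (fintype.split I) => i.
  by apply: sZ.2; exact: smooth_xl.
have sv : smooth_at z (xc C (rshift m i)).
  by apply: smooth_xc => //; exact: atlas_tangent_chart.
apply: smooth_atD; first exact: sZ.2 _ sv.
apply: smooth_atN; apply: smooth_at_sum => a _; apply: smooth_atM.
  by apply: sZ.2; exact: smooth_xl.
by apply: (smooth_elift a cz).2.
Qed.

Lemma smooth_eGam a I J : smooth_at z (eGam a I J).
Proof.
rewrite /eGam /diag2; case: (fintype.split I) => i; case: (fintype.split J) => j;
  try exact: smooth_at_cst.
- by apply: (smooth_foot hc cz); exact: (christoffel_smooth hDs hc).
- by apply: (smooth_foot hc cz); exact: (christoffel_smooth hDs hc).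
Qed.

Lemma DC_eframe I w : is_tangent z w ->
  DC z w (eframe I) = \sum_J (\sum_a w (xl a) * eGam a I J z) *: eframe J z.
Proof.
move=> tw; rewrite big_split_ord /= /eGam /diag2 /eframe.
case: (fintype.split I) => i.
  rewrite DC_elift// [X in _ + X]big1 ?addr0 => [|j _].
    by apply: eq_bigr => j _; rewrite split_lshift.
  by rewrite split_rshift big1 ?scale0r// => a _; rewrite mulr0.
rewrite DC_vpartial// [X in X + _]big1 ?add0r => [|j _].
  by apply: eq_bigr => j _; rewrite split_rshift.
by rewrite split_lshift big1 ?scale0r// => a _; rewrite mulr0.
Qed.

Lemma edGamE w a I J : is_tangent z w ->
  w (eGam a I J) = \sum_b w (xl b) * edGam z b a I J.
Proof.
move=> tw; rewrite /eGam /edGam /diag2.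
have E i j : w (Gam a i j \o @foot _ _ M) =
    \sum_b w (xl b) * dchristoffel Ds c (foot z) b a i j.
  by apply: (tangent_foot hc cz tw); exact: (christoffel_smooth hDs hc).
have E0 : w (fun=> 0) = \sum_b w (xl b) * 0.
  by rewrite (tangent_cst tw) big1// => b _; rewrite mulr0.
by case: (fintype.split I) => i; case: (fintype.split J) => j.
Qed.

(** Products of block diagonal matrices are block diagonal. Only output components along the first
    copy are computed, as the trace uses no others. *)
Lemma eframe_curvature a b I j :
  frame_curvature z eGam (edGam z) a b I (lshift m j) =
  if fintype.split I is inl i then riemann Ds c (foot z) a b i j else 0.
Proof.
rewrite /riemann /frame_curvature big_split_ord /= /eGam /edGam /diag2.
under eq_bigr do rewrite !split_lshift.
under [X in _ + (_ + X)]eq_bigr do rewrite split_lshift !split_rshift.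
rewrite split_lshift; case: (fintype.split I) => i.
  rewrite [X in _ + (_ + X)]big1 ?addr0// => k _; rewrite ?mulr0 ?mul0r ?subrr//.
rewrite !big1 ?subrr ?addr0// => k _; rewrite ?mulr0 ?mul0r ?subrr//.
Qed.

End At.

Lemma Ric_DC z w' w : dom c (foot z) -> is_tangent z w' -> is_tangent z w ->
  Ric DC z w' w = Ric Ds (foot z) (proj_push z w') (proj_push z w).
Proof.
move=> cz tw' tw.
have tp v : is_tangent z v -> is_tangent (foot z) (proj_push z v).
  exact: (proj_push_tangent hc cz).
rewrite (Ric_riemann hDs hc cz (tp _ tw') (tp _ tw)).
have nE : near_pt z (fun y => forall I u, is_tangent y u -> DC y u (eframe I) =
    \sum_J (\sum_a u (xl a) * eGam a I J y) *: eframe J y).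
  by apply: (filterS _ (near_dom_foot hc cz)) => y cy I u; exact: DC_eframe.
have nth : near_pt z (fun y => forall v, is_tangent y v ->
    v = \sum_I ecoframe I y v *: eframe I y).
  by apply: (filterS _ (near_dom_foot hc cz)) => y cy v; exact: ecoframeE.
have sx i : smooth_at z (xl i) by exact: smooth_xl.
rewrite (Ric_frame DC_connection (smooth_eframe cz) sx (smooth_eGam cz) nE
  (fun w a I J => edGamE cz (w := w) a I J) nth (smooth_ecoframe cz) (eframe_basis cz) tw' tw).
(* The fibre fields kill the base coordinates, so they contribute nothing to the trace. *)
rewrite big_split_ord /= [X in _ + X]big1 ?addr0 => [|j _]; last first.
  by apply: big1 => a _; rewrite /eframe split_rshift vpartial_xl// mul0r.
transitivity (\sum_j \sum_i \sum_b w' (xl i) * w (xl b) * riemann Ds c (foot z) j b i j).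
  apply: eq_bigr => j _; rewrite (bigD1 j)//= [X in _ + X]big1 ?addr0; last first.
    move=> a /negbTE aj; rewrite /eframe split_lshift elift_xl//.
    by rewrite eq_sym aj mul0r.
  rewrite {1}/eframe split_lshift elift_xl// eqxx mul1r big_split_ord /=.
  (* Curvature keeps the vertical part of [w'] inside the second copy, so it has no component along
     the first. *)
  rewrite [X in _ + X]big1 ?addr0 => [|i _]; last first.
    by apply: big1 => b _; rewrite eframe_curvature split_rshift mulr0.
  apply: eq_bigr => i _; apply: eq_bigr => b _.
  by rewrite eframe_curvature split_lshift /ecoframe split_lshift.
rewrite exchange_big; apply: eq_bigr => i _; rewrite exchange_big /=.
apply: eq_bigr => b _; rewrite mulr_sumr; apply: eq_bigr => j _.
by rewrite !(proj_push_xc hc).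
Qed.



Lemma Ric_DC_vpartial z a w : dom c (foot z) -> is_tangent z w ->
  Ric DC z (vpartial a z) w = 0 /\ Ric DC z w (vpartial a z) = 0.
Proof.
move=> cz tw; have tv : is_tangent z (vpartial a z) by exact: vpartial_tangent.
have tp v : is_tangent z v -> is_tangent (foot z) (proj_push z v).
  exact: (proj_push_tangent hc cz).
have v0 i : proj_push z (vpartial a z) (xc c i) = 0.
  by rewrite (proj_push_xc hc _ i cz) vpartial_xl.
have [tpv tpw] := (tp _ tv, tp _ tw).
rewrite !Ric_DC// (Ric_riemann hDs hc cz tpv tpw) (Ric_riemann hDs hc cz tpw tpv).
by split; apply: big1 => i _; apply: big1 => b _; rewrite v0 ?mulr0 !mul0r.
Qed.

Lemma Q_tangent z u : is_tangent z (Q z u).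
Proof.
rewrite /Qend; case: xgetP => [q _ [Hq _]|_]; first exact: (horizontal_tangent hH).
exact: tangent0.
Qed.

(** Horizontal tensors vanish on the fibre fields, while [tstruct'] turns these into lifts: only the
    last term of the metric remains. *)
Lemma sasaki_vpartial z a b : dom c (foot z) ->
  sasaki_metric H sigma psi z (vpartial a z) (vpartial b z) = 2^-1 * S (foot z) a b.
Proof.
move=> cz; rewrite /sasaki_metric.
have vv k : vertical z (vpartial k z) by exact: vpartial_vertical.
have tv k : is_tangent z (vpartial k z) by exact: vpartial_tangent.
have Sv k : tstruct' H z (vpartial k z) = hlift k z.
  by rewrite -(tstruct_hlift hH hc k cz) (tstruct'K hH hc)//; exact: hlift_H.
have tl k : is_tangent z (hlift k z) by exact: hlift_tangent.
rewrite !Sv (hpsi.2 z _ _ (vv a) (tl b)).1 (hpsi.2 z _ _ (vv b) (tl a)).1.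
rewrite /beta (hsigma.2 z _ _ (vv b) _).2; last first.
  by apply: tangentB => //; exact: Q_tangent.
by rewrite !subr0 add0r (sigma_hlift hc sigma_proj).
Qed.

End DoubleCartan.

Theorem proposition3p5 (R : realType) (m : nat) (M : chartedSpace R m)
    (hM : is_manifold M)
    (H : TM M -> set (functional (TM M))) (hH : horizontal_bundle H)
    (sigma psi : tensor2 (TM M))
    (hsigma : horizontal_tensor sigma) (sigma_sym : symmetric2 sigma)
    (sigma_nondeg : nondegenerate_on H sigma)
    (hpsi : horizontal_tensor psi) (psi_skew : skew2 psi)
    (beta_nondeg : nondegenerate_on H (beta H sigma psi))
    (s : tensor2 M) (sigma_proj : is_projection H sigma s)
    (Ds : connection M) (hDs : is_levi_civita s Ds)
    (D : connection (TM M)) (hD : is_levi_civita (tangent_metric H sigma) D)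
    (nabD : connection (TM M)) (hnabD : is_canonical_connection H D nabD)
    (DC : connection (TM M))
    (hDC : is_double_cartan_connection H sigma psi nabD DC) :
  (einstein_cartan (sasaki_metric H sigma psi) DC <-> ricci_flat DC) /\
  (ricci_flat DC <-> ricci_flat Ds).
Proof.
have aM : smooth_atlas M := manifold_smooth_atlas hM.
have sm : is_metric s by case: sigma_proj.
have RicE (z : TM M) (w' w : functional (TM M)) : is_tangent z w' -> is_tangent z w ->
    Ric DC z w' w = Ric Ds (foot z) (proj_push z w') (proj_push z w).
  have [c hc cz] : exists2 c, atlas c & dom c (foot z) by exact: chart_around.
  exact: (Ric_DC hH hsigma sigma_sym sigma_nondeg hpsi sigma_proj hDs hD hnabD hDC hc).
have tp (z : TM M) (w : functional (TM M)) : is_tangent z w -> is_tangent (foot z) (proj_push z w).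
  have [c hc cz] : exists2 c, atlas c & dom c (foot z) by exact: chart_around.
  exact: (proj_push_tangent hc cz).
split; split.
- move=> [lam E] z u v tu tv.
  have [c hc cz] : exists2 c, atlas c & dom c (foot z) by exact: chart_around.
  (* In dimension [0] there is no vertical vector to force [lam = 0], but the Ricci tensor is then
     an empty sum. *)
  have [a _|m0] := pickP (xpredT : pred 'I_m); last first.
    rewrite RicE// (Ric_riemann hDs hc cz (tp _ _ tu) (tp _ _ tv)).
    by apply: big1 => i; have := m0 i.
  suff lam0 : lam = 0.
    (* Symmetrisation loses nothing: the Ricci tensor of [Ds] is symmetric, so the left-hand side is
       twice the Ricci tensor. *)
    move: (E z u v tu tv); rewrite lam0 mulr0 mul0r !RicE//.
    rewrite (Ric_sym sm hDs hc cz (tp _ _ tu) (tp _ _ tv)); lra.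
  have lamS b d : lam * gram s c (foot z) b d = 0.
    have tvb k : is_tangent z (vpartial c k z) by exact: vpartial_tangent.
    move: (E z _ _ (tvb b) (tvb d)).
    have RV k l : Ric DC z (vpartial c k z) (vpartial c l z) = 0.
      by case: (Ric_DC_vpartial hH hsigma sigma_sym sigma_nondeg hpsi sigma_proj
        hDs hD hnabD hDC hc k cz (tvb l)).
    rewrite !RV (sasaki_vpartial hH hsigma hpsi sigma_proj hc)//.
    by rewrite addr0 mulrACA mulfV ?pnatr_eq0// mul1r.
  (* All entries of [lam] times an invertible matrix vanish; multiplying by the inverse and reading
     the entry at [a], [a] gives [lam = 0]. *)
  have uS : gram s c (foot z) \in unitmx by exact: gram_unit.
  have /matrixP/(_ a a) := mulmxV uS.
  move=> /(congr1 (fun x => lam * x)); rewrite !mxE eqxx mulr1 => <-.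
  rewrite mulr_sumr big1// => k _; rewrite mulrA.
  by have := lamS a k; rewrite mxE => ->; rewrite mul0r.
- move=> RF; exists 0 => z u v tu tv.
  by rewrite !RF// addr0 mulr0 mul0r.
- move=> RF p u v tu tv.
  have [c hc cp] : exists2 c, atlas c & dom c p by exact: chart_around.
  (* The zero vector provides a point of the total space over [p]. *)
  have t0 : is_tangent p (0 : functional M) by exact: tangent0.
  pose z : TM M := TangentVector t0.
  have cz : dom c (foot z) by [].
  (* The projection is onto the tangent space, by horizontal lifting, so the Ricci tensor at [z]
     determines that at [p]. *)
  have lift (w : functional M) : is_tangent p w ->
      exists2 w', is_tangent z w' & proj_push z w' = w.
    move=> tw; exists (\sum_i w (xc c i) *: hlift H c i z).
      apply: tangent_sum => i _; apply: tangentZ; exact: hlift_tangent.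
    rewrite (proj_push_partial hc cz); last first.
      apply: tangent_sum => i _; apply: tangentZ; exact: hlift_tangent.
    rewrite [RHS](tangent_partial hc cp tw); apply: eq_bigr => i _.
    by rewrite hlift_sum_xl.
  have [u' tu' <-] := lift u tu; have [v' tv' <-] := lift v tv.
  by rewrite -[p]/(foot z) -RicE// RF.
- by move=> RF z u v tu tv; rewrite RicE// RF//; exact: tp.
Qed.
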